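(* Let $n\ge 1$ and $k\geq 1$ be integers and let $\mathcal{A}$ be a separable unital C$^*$-algebra. If the map $$O_{\mathcal{A}}:\mathcal{B}^{\mathcal{A}}(\mathbb{R}^{2n})\longrightarrow\mathcal{H}_{\mathcal{A}},\qquad b\longmapsto b(x,D),$$ is a bijection, then the map $$O_{M_k(\mathcal{A})}:\mathcal{B}^{M_k(\mathcal{A})}(\mathbb{R}^{2n})\longrightarrow\mathcal{H}_{M_k(\mathcal{A})},\qquad b\longmapsto b(x,D),$$ is also a bijection.
   Context: For a separable unital C$^*$-algebra $\mathcal{A}$ with norm $\|\cdot\|$, let $\mathcal{S}^{\mathcal{A}}(\mathbb{R}^n)$ be the set of all smooth $\mathcal{A}$-valued functions on $\mathbb{R}^n$ which, together with all their derivatives, are bounded by arbitrary negative powers of $|x|$. It is a right $\mathcal{A}$-module under pointwise multiplication, with $\mathcal{A}$-valued inner product $\langle f,g\rangle=\int f(x)^*g(x)\,dx$ and norm $\|f\|_2=\|\langle f,f\rangle\|^{1/2}$. Let $E_{\mathcal A}$ be its Banach-space completion for this norm; it is a (right) Hilbert $\mathcal{A}$-module. Let $\mathcal{B}^*(E_{\mathcal A})$ be the set of all (bounded) adjointable operators on $E_{\mathcal A}$, i.e. maps $T:E_{\mathcal A}\to E_{\mathcal A}$ for which there is $T^*:E_{\mathcal A}\to E_{\mathcal A}$ with $\langle Tf,g\rangle=\langle f,T^*g\rangle$ for all $f,g$. Let $\mathcal{B}^{\mathcal{A}}(\mathbb{R}^{2n})$ be the set of all smooth bounded functions $\mathbb{R}^{2n}\to\mathcal{A}$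 whose derivatives of arbitrary order are also bounded. For $b\in\mathcal{B}^{\mathcal{A}}(\mathbb{R}^{2n})$, the pseudodifferential operator $B=b(x,D)$ is defined for $u\in\mathcal{S}^{\mathcal{A}}(\mathbb{R}^n)$ by $$(Bu)(x)=\frac{1}{(2\pi)^{n/2}}\int e^{ix\cdot\xi}\,b(x,\xi)\,\hat u(\xi)\,d\xi,\qquad \hat u(\xi)=(2\pi)^{-n/2}\int e^{-iy\cdot\xi}u(y)\,dy.$$ It is known that $b(x,D)$ extends to an element of $\mathcal{B}^*(E_{\mathcal A})$, also denoted $b(x,D)$. For $z,\zeta\in\mathbb{R}^n$, let $T_z$ and $M_\zeta$ be the operators on $E_{\mathcal A}$ extending $T_zu(x)=u(x-z)$ and $M_\zeta u(x)=e^{i\zeta\cdot x}u(x)$, $u\in\mathcal{S}^{\mathcal{A}}(\mathbb{R}^n)$. An operator $B\in\mathcal{B}^*(E_{\mathcal A})$ is called Heisenberg smooth if the mapping $$\mathbb{R}^{2n}\ni(z,\zeta)\longmapsto B_{z,\zeta}=T_{-z}M_{-\zeta}BM_\zeta T_z\in\mathcal{B}^*(E_{\mathcal A})$$ is $C^\infty$ with respect to the norm topology. $\mathcal{H}_{\mathcal{A}}$ denotes the set of all Heisenberg smooth operators in $\mathcal{B}^*(E_{\mathcal A})$. It is known that $b(x,D)\in\mathcal{H}_{\mathcal{A}}$ for every $b\in\mathcal{B}^{\mathcal{A}}(\mathbb{R}^{2n})$, so $O_{\mathcal{A}}$ is well defined. $M_k(\mathcal{A})$ is the (separable, unital) C$^*$-algebra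 of $k\times k$ matrices with entries in $\mathcal{A}$. All the objects with $M_k(\mathcal{A})$ in place of $\mathcal{A}$ are defined by the same procedure applied to the C$^*$-algebra $M_k(\mathcal{A})$. *)

(* Defs.v *)
(* Complex scalars are R[i], for an arbitrary R : realType; norms of complex
   normed modules are therefore R[i]-valued. *)
From HB Require Import structures.
From mathcomp Require Import all_boot all_order all_algebra.
From mathcomp Require Import complex.
From mathcomp Require Import boolp classical_sets functions cardinality reals.
From mathcomp Require Import topology normedtype exp trigo.

Set Warnings "-redundant-canonical-projection,-projection-no-head-constant".
Set Implicit Arguments.
Unset Strict Implicit.
Unset Printing Implicit Defensive.
Import Order.TTheory GRing.Theory Num.Theory.
Import numFieldNormedType.Exports.
Local Open Scope classical_set_scope.
Local Open Scope complex_scope.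
Local Open Scope ring_scope.

Reserved Notation "x ** y" (at level 40, left associativity).
Reserved Notation "x ^star" (at level 1, format "x ^star").

(* The product is not a MathComp ring multiplication because the hierarchies
   of rings and of normed modules only meet at numDomainType. The zero algebra
   is allowed. *)
HB.mixin Record isCStarAlgebra (R : realType) A
    of CompleteNormedModule R[i] A := {
  cs_mul : A -> A -> A;
  cs_one : A;
  cs_star : A -> A;
  cs_mulA : associative cs_mul;
  cs_mul1l : left_id cs_one cs_mul;
  cs_mul1r : right_id cs_one cs_mul;
  cs_mulDl : forall x y z : A, cs_mul (x + y) z = cs_mul x z + cs_mul y z;
  cs_mulDr : forall x y z : A, cs_mul x (y + z) = cs_mul x y + cs_mul x z;
  cs_mulZl : forall (c : R[i]) (x y : A), cs_mul (c *: x) y = c *: cs_mul x y;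
  cs_mulZr : forall (c : R[i]) (x y : A), cs_mul x (c *: y) = c *: cs_mul x y;
  cs_starK : involutive cs_star;
  cs_starD : forall x y : A, cs_star (x + y) = cs_star x + cs_star y;
  cs_starZ : forall (c : R[i]) (x : A), cs_star (c *: x) = c^*%R *: cs_star x;
  cs_starM : forall x y : A,
    cs_star (cs_mul x y) = cs_mul (cs_star y) (cs_star x);
  cs_normM : forall x y : A, `|cs_mul x y| <= `|x| * `|y| :> R[i];
  cs_normC : forall x : A, `|cs_mul (cs_star x) x| = `|x| ^+ 2 :> R[i] }.

#[short(type="cstarAlgType")]
HB.structure Definition CStarAlgebra (R : realType) :=
  {A of CompleteNormedModule R[i] A & isCStarAlgebra R A}.

Notation "x ** y" := (cs_mul x y) : ring_scope.
Notation "x ^star" := (cs_star x) : ring_scope.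

Definition separable (T : topologicalType) : Prop :=
  exists2 D : set T, countable D & dense D.

(* phi identifies the *-algebra of k x k matrices over A with M. A *-algebra
   carries at most one complete C*-norm, so M is then the C*-algebra M_k(A). *)
Record is_matrix_algebra (R : realType) (A : cstarAlgType R) (k : nat)
    (M : cstarAlgType R) (phi : 'M[A]_k -> M) : Prop := IsMatrixAlgebra {
  phi_bij : bijective phi;
  phiD : forall X Y : 'M[A]_k, phi (X + Y) = phi X + phi Y;
  phiZ : forall (c : R[i]) (X : 'M[A]_k),
    phi (\matrix_(i, j) (c *: X i j)) = c *: phi X;
  phiM : forall X Y : 'M[A]_k,
    phi (\matrix_(i, j) \sum_(l < k) X i l ** Y l j) = phi X ** phi Y;
  phi1 : phi (\matrix_(i, j) if i == j then cs_one else 0) = cs_one;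
  phi_star : forall X : 'M[A]_k, phi (\matrix_(i, j) (X j i)^star) = (phi X)^star }.

(* right Hilbert modules; the inner product is linear in the second variable *)
HB.mixin Record isHilbertModule (R : realType) (A : cstarAlgType R) E
    of CompleteNormedModule R[i] E := {
  hm_act : E -> A -> E;
  hm_inner : E -> E -> A;
  hm_actDl : forall (f g : E) (a : A),
    hm_act (f + g) a = hm_act f a + hm_act g a;
  hm_actDr : forall (f : E) (a b : A),
    hm_act f (a + b) = hm_act f a + hm_act f b;
  hm_actM : forall (f : E) (a b : A), hm_act f (a ** b) = hm_act (hm_act f a) b;
  hm_act1 : forall f : E, hm_act f cs_one = f;
  hm_actZl : forall (c : R[i]) (f : E) (a : A),
    hm_act (c *: f) a = c *: hm_act f a;
  hm_actZr : forall (c : R[i]) (f : E) (a : A),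
    hm_act f (c *: a) = c *: hm_act f a;
  hm_innerD : forall f g h : E, hm_inner f (g + h) = hm_inner f g + hm_inner f h;
  hm_innerZ : forall (c : R[i]) (f g : E),
    hm_inner f (c *: g) = c *: hm_inner f g;
  hm_inner_act : forall (f g : E) (a : A),
    hm_inner f (hm_act g a) = hm_inner f g ** a;
  hm_innerC : forall f g : E, (hm_inner f g)^star = hm_inner g f;
  hm_inner_ge0 : forall f : E, exists a : A, hm_inner f f = a^star ** a;
  hm_normE : forall f : E, `|f| ^+ 2 = `|hm_inner f f| :> R[i] }.

#[short(type="hilbertModType")]
HB.structure Definition HilbertModule (R : realType) (A : cstarAlgType R) :=
  {E of CompleteNormedModule R[i] E & isHilbertModule R A E}.

Lemma norm_ReE (R : realType) (V : normedModType R[i]) (x : V) :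
  `|x| = (complex.Re (`|x| : R[i]))%:C :> R[i].
Proof. by rewrite RRe_real// normr_real. Qed.

Lemma normC_ReE (R : realType) (c : R[i]) :
  `|c| = (complex.Re `|c|)%:C :> R[i].
Proof. by rewrite RRe_real// normr_real. Qed.

Section AdjointableOperators.
Context {R : realType} {A : cstarAlgType R} {E : hilbertModType A}.
Implicit Types (T : E -> E) (c : R[i]).

Definition adjointable T : Prop :=
  (exists M : R, forall f, `|T f| <= M%:C * `|f|) /\
  (exists S : E -> E, forall f g : E, hm_inner (T f) g = hm_inner f (S g) :> A).

Definition adjointableb : pred (E -> E) := fun T => `[< adjointable T >].

Lemma hm_innerDl (f g h : E) :
  hm_inner (f + g) h = hm_inner f h + hm_inner g h :> A.
Proof. by rewrite -hm_innerC hm_innerD cs_starD !hm_innerC. Qed.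

Lemma hm_innerZl c (f h : E) :
  hm_inner (c *: f) h = c^*%R *: hm_inner f h :> A.
Proof. by rewrite -hm_innerC hm_innerZ cs_starZ !hm_innerC. Qed.

Lemma adjointable_submod : submod_closed adjointableb.
Proof.
split=> [|c T1 T2 /asboolP[[M1 bT1] [S1 aS1]] /asboolP[[M2 bT2] [S2 aS2]]].
  apply/asboolP; split.
    by exists 0 => f; rewrite mul0r normr0.
  exists 0 => f g.
  rewrite (_ : (0 : E -> E) f = 0 *: 0); last by rewrite scale0r.
  rewrite hm_innerZl conjC0 scale0r.
  by rewrite (_ : (0 : E -> E) g = 0 *: 0) ?hm_innerZ ?scale0r.
apply/asboolP; split.
  exists (complex.Re `|c| * M1 + M2) => f.
  rewrite (le_trans (ler_normD _ _))// rmorphD rmorphM /= -normC_ReE mulrDl.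
  by rewrite lerD// normrZ -mulrA ler_wpM2l.
exists (c^*%R *: S1 + S2) => f g.
by rewrite hm_innerDl hm_innerZl aS1 aS2 hm_innerD hm_innerZ.
Qed.

HB.instance Definition _ :=
  GRing.isSubmodClosed.Build R[i] (E -> E) adjointableb adjointable_submod.

Lemma adjointable_comp T1 T2 :
  adjointable T1 -> adjointable T2 -> adjointable (T1 \o T2).
Proof.
move=> [[M1 bT1] [S1 aS1]] [[M2 bT2] [S2 aS2]]; split; last first.
  by exists (S2 \o S1) => f g /=; rewrite aS1 aS2.
exists (Num.max M1 0 * M2) => f /=; rewrite rmorphM /= -mulrA.
apply: (le_trans (bT1 _)); apply: (@le_trans _ _ ((Num.max M1 0)%:C * `|T2 f|)).
  by rewrite ler_wpM2r// lecR le_max lexx.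
by rewrite ler_wpM2l// (lecR 0) le_max lexx orbT.
Qed.

Record adjop := AdjOp { adjop_fun :> E -> E; adjopP : adjointableb adjop_fun }.

HB.instance Definition _ := [isSub for adjop_fun].
HB.instance Definition _ := [Choice of adjop by <:].
HB.instance Definition _ := [SubChoice_isSubLmodule of adjop by <:].

Definition adjop_comp (S T : adjop) : adjop :=
  AdjOp (asboolT (adjointable_comp (asboolW (adjopP S)) (asboolW (adjopP T)))).

Definition opbounds (T : adjop) : set R :=
  [set M : R | 0 <= M /\ forall f, `|T f| <= M%:C * `|f|].

Definition opnorm (T : adjop) : R := inf (opbounds T).

Lemma opbounds_has_inf (T : adjop) : has_inf (opbounds T).
Proof.
split; last by exists 0 => M [].
have /asboolP[[M bT] _] := adjopP T; exists (Num.max M 0); split.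
  by rewrite le_max lexx orbT.
by move=> f; rewrite (le_trans (bT f))// ler_wpM2r// lecR le_max lexx.
Qed.

Lemma opnorm_ge0 (T : adjop) : 0 <= opnorm T.
Proof. by apply: lb_le_inf; [case: (opbounds_has_inf T) | move=> M []]. Qed.

Lemma opnorm_le (T : adjop) (M : R) :
  0 <= M -> (forall f, `|T f| <= M%:C * `|f|) -> opnorm T <= M.
Proof. by move=> M0 bT; apply: ge_inf; [case: (opbounds_has_inf T) | split]. Qed.

Lemma opnormP (T : adjop) f : `|T f| <= (opnorm T)%:C * `|f|.
Proof.
rewrite (norm_ReE (T f)) (norm_ReE f) -rmorphM /= lecR.
have : 0 <= `|f| by [].
rewrite (norm_ReE f) (lecR 0) le_eqVlt => /predU1P[f0|f0].
  have /asboolP[[M bT] _] := adjopP T; have := bT f.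
  by rewrite (norm_ReE (T f)) (norm_ReE f) -f0 -rmorphM /= lecR !mulr0.
rewrite -ler_pdivrMr//; apply: lb_le_inf; first by case: (opbounds_has_inf T).
move=> M [_ bT]; rewrite ler_pdivrMr//.
by have := bT f; rewrite (norm_ReE (T f)) (norm_ReE f) -rmorphM /= lecR.
Qed.

Lemma opnormD (S T : adjop) :
  (opnorm (S + T))%:C <= (opnorm S)%:C + (opnorm T)%:C.
Proof.
rewrite -rmorphD /= lecR; apply: opnorm_le; first by rewrite addr_ge0 ?opnorm_ge0.
move=> f; rewrite rmorphD mulrDl.
exact: le_trans (ler_normD _ _) (lerD (opnormP S f) (opnormP T f)).
Qed.

Lemma opnormZ c (T : adjop) : (opnorm (c *: T))%:C = `|c| * (opnorm T)%:C.
Proof.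
have Re_ge0 (d : R[i]) : 0 <= complex.Re `|d|.
  by rewrite -ler0c -normC_ReE.
have le1 (d : R[i]) (U : adjop) : opnorm (d *: U) <= complex.Re `|d| * opnorm U.
  apply: opnorm_le => [|f]; first by rewrite mulr_ge0 ?opnorm_ge0.
  by rewrite normrZ rmorphM /= -normC_ReE -mulrA ler_wpM2l// opnormP.
rewrite (normC_ReE c) -rmorphM; congr (_%:C); apply/eqP.
rewrite eq_le le1 andTb; have [->|c0] := eqVneq c 0.
  by rewrite normr0 mul0r opnorm_ge0.
have := le1 c^-1 (c *: T); rewrite scalerA mulVf// scale1r => leT.
rewrite -lecR !rmorphM /= -normC_ReE -ler_pdivlMl ?normr_gt0//.
by rewrite -normfV normC_ReE -rmorphM lecR.
Qed.

Lemma opnorm0_eq0 (T : adjop) : (opnorm T)%:C = 0 -> T = 0.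
Proof.
move=> T0; apply/val_inj/funext => f /=; apply/eqP.
by rewrite -normr_le0 (le_trans (opnormP _ _))// T0 mul0r.
Qed.

HB.instance Definition _ :=
  Lmodule_isNormed.Build R[i] adjop opnormD opnormZ opnorm0_eq0.

End AdjointableOperators.
Arguments adjop {R A} E.

Section SmoothFunctions.
Context {R : realType} {V : normedModType R[i]} {m : nat}.
Implicit Types f : 'rV[R]_m -> V.

(* The partial derivatives are taken along real increments although V is
   complex, hence not the library's 'D_v f x. *)
Definition diff_quotient (i : 'I_m) f (x : 'rV[R]_m) (h : R) : V :=
  (h^-1)%:C *: (f (x + h *: delta_mx 0 i) - f x).

Definition pderive (i : 'I_m) f (x : 'rV[R]_m) : V :=
  lim (diff_quotient i f x @ 0^').

(* pderives [:: i1; ..; ir] f is the derivative of f along i1, .., ir, the last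
   index being applied first *)
Definition pderives (s : seq 'I_m) f : 'rV[R]_m -> V := foldr pderive f s.

Definition smooth f : Prop := forall s : seq 'I_m,
  continuous (pderives s f) /\
  forall (i : 'I_m) (x : 'rV[R]_m), cvg (diff_quotient i (pderives s f) x @ 0^').

(* `|x| is the sup norm of 'rV[R]_m; any other norm gives the same functions. *)
Definition schwartz f : Prop := smooth f /\
  forall (s : seq 'I_m) (p : nat), exists M : R, forall x : 'rV[R]_m,
    (`|x| ^+ p)%:C * `|pderives s f x| <= M%:C.

Definition smooth_bounded : set ('rV[R]_m -> V) :=
  [set f | smooth f /\
    forall s : seq 'I_m, exists M : R, forall x, `|pderives s f x| <= M%:C].

(* Riemann sum of f over [-r, r]^m for the grid with N.+1 cells per side *)
Definition riemann_sum f (r N : nat) : V :=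
  let h : R := 2 * r%:R / N.+1%:R in
  (h ^+ m)%:C *:
    \sum_(k : {ffun 'I_m -> 'I_N.+1}) f (\row_i (h * (k i)%:R - r%:R)).

(* Improper Riemann integral over R^m: the limit for r -> oo of the Riemann
   integrals over [-r, r]^m. For the continuous, rapidly decreasing functions
   integrated below it is the Bochner-Lebesgue integral. *)
Definition integral f : V :=
  lim ((fun r => lim (riemann_sum f r @ \oo)) @ \oo).

End SmoothFunctions.

Definition expi {R : realType} (t : R) : R[i] := cos t +i* sin t.

Definition dotp {R : realType} {n : nat} (x y : 'rV[R]_n) : R :=
  \sum_(i < n) x 0 i * y 0 i.

Section PseudodifferentialOperators.
Context {R : realType} {A : cstarAlgType R} {n : nat}.
Implicit Types (u : 'rV[R]_n -> A) (b : 'rV[R]_(n + n) -> A).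

Definition fourier u (xi : 'rV[R]_n) : A :=
  ((2 * pi) `^ (- (n%:R / 2)))%:C *:
    integral (fun y => expi (- dotp y xi) *: u y).

(* the point (x, xi) of R^2n is row_mx x xi *)
Definition psido b u (x : 'rV[R]_n) : A :=
  ((2 * pi) `^ (- (n%:R / 2)))%:C *:
    integral (fun xi => expi (dotp x xi) *: (b (row_mx x xi) ** fourier u xi)).

Definition translate (z : 'rV[R]_n) u (x : 'rV[R]_n) : A := u (x - z).

Definition modulate (zeta : 'rV[R]_n) u (x : 'rV[R]_n) : A :=
  expi (dotp zeta x) *: u x.

(* iota exhibits E as a completion of the Schwartz functions for the norm
   |<f, f>|^(1/2); its values outside the Schwartz functions are irrelevant. *)
Record is_L2_completion (E : hilbertModType A) (iota : ('rV[R]_n -> A) -> E) :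
    Prop := IsL2Completion {
  iotaD : forall u v, schwartz u -> schwartz v ->
    iota (fun x => u x + v x) = iota u + iota v;
  iotaZ : forall (c : R[i]) u, schwartz u ->
    iota (fun x => c *: u x) = c *: iota u;
  iota_act : forall (a : A) u, schwartz u ->
    iota (fun x => u x ** a) = hm_act (iota u) a;
  iota_inner : forall u v, schwartz u -> schwartz v ->
    hm_inner (iota u) (iota v) = integral (fun x => (u x)^star ** v x);
  iota_dense : dense (iota @` [set u | schwartz u]) }.

Context {E : hilbertModType A} (iota : ('rV[R]_n -> A) -> E).
Implicit Types L : ('rV[R]_n -> A) -> 'rV[R]_n -> A.

(* The adjointable operator extending L, which is unique by density. The value
   0 when there is no extension is a dummy: the operators below have one. *)
Definition extension L : adjop E :=
  xget 0 [set T : adjop E | forall u, schwartz u ->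
    schwartz (L u) /\ T (iota u) = iota (L u)].

Definition symbol_op b : adjop E := extension (psido b).

Definition heisenberg_conj (B : adjop E) (w : 'rV[R]_(n + n)) : adjop E :=
  let T z := extension (translate z) in
  let M zeta := extension (modulate zeta) in
  let z := lsubmx w in
  let zeta := rsubmx w in
  adjop_comp (T (- z)) (adjop_comp (M (- zeta))
    (adjop_comp B (adjop_comp (M zeta) (T z)))).

Definition heisenberg_smooth : set (adjop E) :=
  [set B | smooth (heisenberg_conj B)].

End PseudodifferentialOperators.

(* Main.v *)
(* The norms of the entries are equivalent to the norm of [M_k(A)]: a bounded
   self-adjoint [h] with |h| <= 1/2 is the real part of a unitary
   [h + i sqrt(1 - h^2)], and this identity is transported by a *-isomorphism, so
   that *-isomorphisms and their inverses are bounded. Hence [M_k(A)]-valued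
   Schwartz functions, symbols and the module [E_{M_k(A)}] decompose into entries,
   and adjointable operators, being right [M_k(A)]-linear, become [k x k] matrices
   of adjointable operators on [E_A]. The symbol map acts entrywise in this
   picture and translations and modulations act diagonally, so that bijectivity
   passes from the entries to the matrices. The entrywise formula for [b(x,D)u]
   needs the additivity of the integrals involved, hence their convergence, which
   follows from the rapid decay of the Fourier transform of a Schwartz function.
   The existence of the operators [b(x,D)] over [A] is a consequence of the
   injectivity of the symbol map. *)

Require Import Defs.
From mathcomp Require Import all_boot all_order all_algebra.
From mathcomp Require Import complex ring lra zify.
From mathcomp Require Import boolp classical_sets functions cardinality reals.
From mathcomp Require Import topology normedtype sequences derive exp trigo.

Set Implicit Arguments.
Unset Strict Implicit.
Unset Printing Implicit Defensive.
Import Order.TTheory GRing.Theory Num.Theory.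
Import numFieldNormedType.Exports.
Local Open Scope classical_set_scope.
Local Open Scope complex_scope.
Local Open Scope ring_scope.

(** * Real-valued norms *)

(** Only the equivalence of norms is ever used, so crude constants are kept throughout.

    [lim] returns a default value when there is no limit, so an identity between integrals says
    nothing before convergence is known. All integrands are therefore brought into one class,
    [tame], of continuous functions dominated by a summable product weight, on which [integral] is a
    genuine limit and commutes with sums and bounded linear maps. For the integral defining b(x,D)u
    this asks for continuity and decay of the transform of u. The decay rests on the vanishing of
    the integral of a partial derivative, which is proved on the Riemann sums themselves: when the
    increment equals the mesh, the difference quotients telescope to boundary terms.

    That b(x,D)u is a Schwartz function is not read off the integral: it is part of what an
    extension of b(x,D) provides, and passes from the entries to the matrix. *)

Section RealNorm.
Context {R : realType} {V : normedModType R[i]}.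
Implicit Types (x y : V) (c : R[i]) (a : R).

(* Real-valued norm: the norm of the library lives in the only partially
   ordered [R[i]], where [lra] and case analysis on the order are unavailable. *)
Definition nr x : R := complex.Re `|x|.

Lemma nrE x : `|x| = (nr x)%:C.
Proof. exact: norm_ReE. Qed.

Lemma nr_ge0 x : 0 <= nr x.
Proof. by rewrite -ler0c -nrE. Qed.

Lemma nr0 : nr 0 = 0.
Proof. by rewrite /nr normr0. Qed.

Lemma nr_eq0 x : nr x = 0 -> x = 0.
Proof. by move=> x0; apply/eqP; rewrite -normr_eq0 nrE x0. Qed.

Lemma nrN x : nr (- x) = nr x.
Proof. by rewrite /nr normrN. Qed.

Lemma nrB x y : nr (x - y) = nr (y - x).
Proof. by rewrite -nrN opprB. Qed.

Lemma ler_nrD x y : nr (x + y) <= nr x + nr y.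
Proof. by rewrite -lecR rmorphD /= -!nrE ler_normD. Qed.

Lemma ler_nrB x y : nr (x - y) <= nr x + nr y.
Proof. by rewrite -(nrN y) ler_nrD. Qed.

Lemma ler_nrBD y x z : nr (x - z) <= nr (x - y) + nr (y - z).
Proof. by rewrite -[x - z](subrKA y) ler_nrD. Qed.

Lemma ler_nr_dist x y : nr x - nr y <= nr (x - y).
Proof. by rewrite lerBlDr -{1}[x](subrK y) ler_nrD. Qed.

Lemma ler_nr_sum (I : Type) (r : seq I) (P : pred I) (F : I -> V) :
  nr (\sum_(i <- r | P i) F i) <= \sum_(i <- r | P i) nr (F i).
Proof.
elim/big_rec2: _ => [|i y x _ le_xy]; first by rewrite nr0.
by rewrite (le_trans (ler_nrD _ _))// lerD2l.
Qed.

Lemma nr_scale c x : nr (c *: x) = complex.Re `|c| * nr x.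
Proof.
have : (nr (c *: x))%:C = (complex.Re `|c|)%:C * (nr x)%:C.
  by rewrite -!nrE -normC_ReE normrZ.
by rewrite -rmorphM => /complexI.
Qed.

Lemma nr_realscale a x : nr (a%:C *: x) = `|a| * nr x.
Proof. by rewrite nr_scale normc_def /= expr0n addr0 sqrtr_sqr. Qed.

Lemma nr_expi (t : R) x : nr (expi t *: x) = nr x.
Proof. by rewrite nr_scale normc_def /= cos2Dsin2 sqrtr1 mul1r. Qed.

Lemma nr_le_norm x (M : R) : (`|x| <= M%:C) = (nr x <= M).
Proof. by rewrite nrE lecR. Qed.

Lemma cvg_nrP {T : Type} {F : set_system T} {FF : Filter F} (f : T -> V) (l : V) :
  f @ F --> l <-> forall e : R, 0 < e -> \forall t \near F, nr (f t - l) < e.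
Proof.
split=> [/cvgrPdist_lt fl e e0|fl].
  have := fl e%:C; rewrite (ltcR 0) => /(_ e0); apply: filterS => t.
  by rewrite distrC nrE ltcR.
apply/cvgrPdist_lt => e e0.
have er : e = (complex.Re e)%:C by rewrite RRe_real// gtr0_real.
have := fl (complex.Re e); rewrite -(ltcR 0) -er => /(_ e0); apply: filterS => t.
by rewrite distrC nrE er ltcR.
Qed.

Lemma cvgn_nrP (f : nat -> V) (l : V) :
  f @ \oo --> l <->
  forall e : R, 0 < e -> exists N, forall n, (N <= n)%N -> nr (f n - l) < e.
Proof.
split=> [/cvg_nrP fl e e0|fl].
  have [N _ NP] := fl e e0; exists N => n; exact: NP.
apply/cvg_nrP => e e0; have [N NP] := fl e e0; exists N => // n /=; exact: NP.
Qed.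

Lemma closeness_eq x y : (forall e : R, 0 < e -> nr (x - y) <= e) -> x = y.
Proof.
move=> H; apply/subr0_eq/nr_eq0/eqP; rewrite eq_le nr_ge0 andbT.
by apply/ler_addgt0Pl => e e0; rewrite addr0 H.
Qed.

Lemma nr_cvg_le {T : Type} {F : set_system T} {FF : ProperFilter F}
    (f : T -> V) (l : V) (M : R) :
  f @ F --> l -> (\forall t \near F, nr (f t) <= M) -> nr l <= M.
Proof.
move=> /cvg_nrP fl fM; apply/ler_addgt0Pl => e e0.
have [t [ft ftM]] := filter_ex (filterI (fl e e0) fM).
by have := ler_nr_dist l (f t); rewrite nrB; lra.
Qed.

End RealNorm.

Lemma cauchyn_cvg {R : realType} {V : completeNormedModType R[i]} (f : nat -> V) :
  (forall e : R, 0 < e -> exists N, forall p q, (N <= p)%N -> (N <= q)%N ->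
    nr (f p - f q) < e) -> cvg (f @ \oo).
Proof.
move=> fC; apply/cauchy_cvgP/cauchy_exP => e e0.
have er : e = (complex.Re e)%:C by rewrite RRe_real// gtr0_real.
have [|N NP] := fC (complex.Re e); first by rewrite -(ltcR 0) -er.
exists (f N); exists N => // p /= Np.
by rewrite -ball_normE /ball_ /= nrE er ltcR NP.
Qed.


(** * C*-algebras *)

Lemma nr_cvg_unique {R : realType} {V : normedModType R[i]} {T : Type}
    {F : set_system T} {FF : ProperFilter F} (f : T -> V) (l l' : V) :
  f @ F --> l -> f @ F --> l' -> l = l'.
Proof.
move=> /cvg_nrP fl /cvg_nrP fl'; apply: closeness_eq => e e0.
have e2 : 0 < e / 2 by lra.
have [t [ft ft']] := filter_ex (filterI (fl _ e2) (fl' _ e2)).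
have := ler_nrBD (f t) l l'; rewrite (nrB l (f t)); lra.
Qed.

Lemma half_pow_lt {R : realType} (e : R) : 0 < e ->
  exists N, forall n, (N <= n)%N -> 2^-1 ^+ n < e.
Proof.
move=> e0; exists (Num.bound e^-1) => n Nn.
rewrite exprVn -[ltRHS]invrK ltf_pV2 ?posrE ?invr_gt0 ?exprn_gt0//.
have eN : e^-1 < (Num.bound e^-1)%:R by apply: archi_boundP; rewrite invr_ge0 ltW.
apply: (lt_le_trans eN); rewrite -natrX ler_nat; apply: (leq_trans Nn).
by rewrite ltnW// ltn_expl.
Qed.

Section CStarAlgebraTheory.
Context {R : realType} {A : cstarAlgType R}.
Implicit Types x y z h : A.

Lemma cs_mul0l x : 0 ** x = 0 :> A.
Proof. by apply: (addrI (0 ** x)); rewrite -cs_mulDl !addr0. Qed.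

Lemma cs_mul0r x : x ** 0 = 0 :> A.
Proof. by apply: (addrI (x ** 0)); rewrite -cs_mulDr !addr0. Qed.

Lemma cs_mulNl x y : (- x) ** y = - (x ** y) :> A.
Proof. by apply: (addrI (x ** y)); rewrite -cs_mulDl !subrr cs_mul0l. Qed.

Lemma cs_mulNr x y : x ** (- y) = - (x ** y) :> A.
Proof. by apply: (addrI (x ** y)); rewrite -cs_mulDr !subrr cs_mul0r. Qed.

Lemma cs_mulBl x y z : (x - y) ** z = x ** z - y ** z :> A.
Proof. by rewrite cs_mulDl cs_mulNl. Qed.

Lemma cs_mulBr x y z : x ** (y - z) = x ** y - x ** z :> A.
Proof. by rewrite cs_mulDr cs_mulNr. Qed.

Lemma cs_star0 : 0^star = 0 :> A.
Proof. by apply: (addrI (0^star)); rewrite -cs_starD !addr0. Qed.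

Lemma cs_starN x : (- x)^star = - x^star :> A.
Proof. by apply: (addrI (x^star)); rewrite -cs_starD !subrr cs_star0. Qed.

Lemma cs_star1 : cs_one^star = cs_one :> A.
Proof. by rewrite -[LHS]cs_mul1r -[X in _ ** X]cs_starK -cs_starM cs_mul1r cs_starK. Qed.

Lemma cs_star_realZ (a : R) x : (a%:C *: x)^star = a%:C *: x^star :> A.
Proof.
by rewrite cs_starZ; congr (_ *: _); apply: conj_Creal; rewrite complex_real.
Qed.

Lemma nrM x y : nr (x ** y) <= nr x * nr y.
Proof. by rewrite -lecR rmorphM /= -!nrE cs_normM. Qed.

Lemma nr_starM x : nr (x^star ** x) = nr x ^+ 2.
Proof. by apply: complexI; rewrite rmorphXn /= -!nrE cs_normC. Qed.

(** The C*-identity gives |y|^2 <= |y^star| |y| for every y; the two inequalities are the cases of x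
    and of [x^star]. *)
Lemma nr_star x : nr (x^star) = nr x.
Proof.
have le_star y : nr y <= nr (y^star).
  have [->|y0] := eqVneq (nr y) 0; first exact: nr_ge0.
  have := nrM (y^star) y; rewrite nr_starM expr2.
  by rewrite ler_pM2r// lt_neqAle eq_sym y0 nr_ge0.
by apply/eqP; rewrite eq_le le_star -{2}[x]cs_starK le_star.
Qed.

(** Only an inequality, because the unit of the zero algebra has norm 0. *)
Lemma nr1_le1 : nr (cs_one : A) <= 1.
Proof.
have := nr_starM (cs_one : A); rewrite cs_star1 cs_mul1l.
have := nr_ge0 (cs_one : A); nra.
Qed.

Lemma nr_isometry x : x^star ** x = cs_one -> nr x <= 1.
Proof.
move=> ux; have := nr_starM x; rewrite ux.
by have := nr1_le1; have := nr_ge0 x; nra.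
Qed.

Lemma cs_cvgM {T : Type} {F : set_system T} {FF : ProperFilter F}
    (f g : T -> A) (a b : A) :
  f @ F --> a -> g @ F --> b -> (fun t => f t ** g t) @ F --> a ** b.
Proof.
move=> /cvg_nrP fa /cvg_nrP gb; apply/cvg_nrP => e e0.
have a0 := nr_ge0 a; have b0 := nr_ge0 b.
pose d := Num.min 1 (e / (nr a + nr b + 2)).
have d0 : 0 < d by rewrite lt_min ltr01 divr_gt0//; lra.
have d1 : d <= 1 by rewrite ge_min lexx.
have de : d * (nr a + nr b + 2) <= e.
  by rewrite -ler_pdivlMr ?ge_min ?lexx ?orbT//; lra.
apply: filterS (filterI (fa _ d0) (gb _ d0)) => t [fd gd].
have -> : f t ** g t - a ** b = (f t - a) ** g t + a ** (g t - b).
  by rewrite cs_mulBl cs_mulBr subrKA.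
have gtb := ler_nrD (g t - b) b; rewrite subrK in gtb.
have := ler_nrD ((f t - a) ** g t) (a ** (g t - b)).
have := nrM (f t - a) (g t); have := nrM a (g t - b).
have := nr_ge0 (f t - a); have := nr_ge0 (g t - b); have := nr_ge0 (g t).
nra.
Qed.

Lemma cs_cvg_star {T : Type} {F : set_system T} {FF : ProperFilter F}
    (f : T -> A) (a : A) :
  f @ F --> a -> (fun t => (f t)^star) @ F --> a^star.
Proof.
move=> /cvg_nrP fa; apply/cvg_nrP => e /fa; apply: filterS => t.
by rewrite -cs_starN -cs_starD nr_star.
Qed.

(** * Square roots of 1 - h^2 and unitaries *)

Section Circle.
Variables (h : A) (hsa : h^star = h) (h_le : nr h <= 2^-1).

(* The iteration converges to 1 - sqrt (1 - h^2). *)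
Let y (n : nat) : A := iter n (fun y => (2^-1)%:C *: (h ** h + y ** y)) 0.

Let hh_le : nr (h ** h) <= 4^-1.
Proof.
apply: (le_trans (nrM _ _)); rewrite (_ : 4^-1 = 2^-1 * 2^-1); last by lra.
by rewrite ler_pM ?nr_ge0.
Qed.

Let y_le n : nr (y n) <= 2^-1.
Proof.
elim: n => [|n IH]; first by rewrite /= nr0 invr_ge0.
rewrite /= nr_realscale ger0_norm ?invr_ge0//.
have yy : nr (y n) * nr (y n) <= 2^-1 * 2^-1 by rewrite ler_pM ?nr_ge0.
have := ler_nrD (h ** h) (y n ** y n); move: (nrM (y n) (y n)) hh_le yy.
set a := nr (h ** h); set b := nr (y n ** y n).
set c := nr _ * _; set d := nr (_ + _). lra.
Qed.

(** The splitting y'^2 - y^2 = y'(y' - y) + (y' - y)y needs no commutation. The iterates have norm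
    at most 1/2, so squaring does not increase distances between consecutive ones, and the prefactor
    1/2 makes the iteration contract. *)
Let y_step n : nr (y n.+1 - y n) <= 2^-1 ^+ n.
Proof.
elim: n => [|n IH].
  by rewrite expr0 subr0 (le_trans (y_le 1))// invf_le1 ?ler1n.
rewrite [y n.+2]iterS [X in _ - X]iterS -scalerBr -/(y n.+1) -/(y n).
rewrite opprD addrACA subrr add0r nr_realscale ger0_norm ?invr_ge0//.
rewrite exprS ler_wpM2l ?invr_ge0//; apply: le_trans IH.
have -> : y n.+1 ** y n.+1 - y n ** y n =
    y n.+1 ** (y n.+1 - y n) + (y n.+1 - y n) ** y n.
  by rewrite cs_mulBl cs_mulBr subrKA.
apply: (le_trans (ler_nrD _ _)).
have := nrM (y n.+1) (y n.+1 - y n); have := nrM (y n.+1 - y n) (y n).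
have := y_le n; have := y_le n.+1; have := nr_ge0 (y n.+1 - y n); nra.
Qed.

Let y_dist n p : nr (y (n + p) - y n) <= 2 * 2^-1 ^+ n - 2 * 2^-1 ^+ (n + p).
Proof.
elim: p => [|p IH]; first by rewrite addn0 !subrr nr0.
have := ler_nrBD (y (n + p)) (y (n + p).+1) (y n).
have := y_step (n + p); rewrite addnS exprS; lra.
Qed.

Let y_cvg : cvg (y @ \oo).
Proof.
apply: cauchyn_cvg => e e0.
have [|N NP] := @half_pow_lt _ (e / 4); first by lra.
have yN n : (N <= n)%N -> nr (y n - y N) < e / 2.
  move=> Nn; have := y_dist N (n - N); rewrite subnKC//.
  have := NP N (leqnn _); have : 0 <= (2^-1 : R) ^+ n by rewrite exprn_ge0 ?invr_ge0.
  by lra.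
exists N => p q /yN Np /yN Nq; have := ler_nrBD (y N) (y p) (y q).
rewrite (nrB (y N)); lra.
Qed.

(** The equation for x = 1 - sqrt(1 - h^2) is (1 - x)^2 = 1 - h^2 written without the unit. Each
    clause is the limit of an identity between iterates. The last one keeps x in every corner that
    contains h: [e] only has to act as a unit on [h] and may differ from [cs_one]. *)
Lemma circle_complement : exists x : A, [/\ x^star = x, h ** x = x ** h,
  x + x = h ** h + x ** x &
  forall e : A, e ** h = h -> h ** e = h -> e ** x = x /\ x ** e = x].
Proof.
pose x : A := lim (y @ \oo); have yx : y @ \oo --> x by exact: y_cvg.
have yx1 : (fun n => y n.+1) @ \oo --> x.
  apply/cvgn_nrP => e /((cvgn_nrP _ _).1 yx)[N NP].
  by exists N => n Nn; apply: NP; rewrite leqW.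
have cst (a : A) : (fun=> a) @ \oo --> a by exact: cvg_cst.
exists x; split.
- apply: nr_cvg_unique yx; have -> : y = fun n => (y n)^star.
    apply/funext; elim=> [|n IH]; first by rewrite /= cs_star0.
    by rewrite [y n.+1]iterS -/(y n) cs_star_realZ cs_starD !cs_starM hsa -IH.
  exact: cs_cvg_star.
- apply: (nr_cvg_unique (cs_cvgM (cst h) yx)).
  rewrite (_ : (fun n => h ** y n) = fun n => y n ** h); first exact: cs_cvgM.
  apply/funext; elim=> [|n IH]; first by rewrite /= cs_mul0l cs_mul0r.
  rewrite [y n.+1]iterS -/(y n) cs_mulZl cs_mulZr cs_mulDl cs_mulDr.
  by congr (_ *: (_ + _)); rewrite ?cs_mulA// IH -!cs_mulA IH.
- have e2 : (2%:C : R[i]) *: x = x + x.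
    by rewrite -[in RHS](scale1r x) -scalerDl -rmorphD.
  rewrite -e2; apply: (@nr_cvg_unique _ _ _ \oo _ (fun n => 2%:C *: y n.+1)).
    apply/cvgn_nrP => e e0; have e20 : 0 < e / 2 by lra.
    have [N NP] := (cvgn_nrP _ _).1 yx1 _ e20; exists N => n /NP.
    by rewrite -scalerBr nr_realscale ger0_norm//; lra.
  rewrite (_ : (fun n => _) = fun n => h ** h + y n ** y n); last first.
    apply/funext => n; rewrite [y n.+1]iterS scalerA -rmorphM /=.
    by rewrite divff ?scale1r// pnatr_eq0.
  apply: cvgD; first exact: cst.
  exact: cs_cvgM.
- move=> e eh he; split.
    apply: nr_cvg_unique yx; have -> : y = fun n => e ** y n.
      apply/funext; elim=> [|n IH]; first by rewrite /= cs_mul0r.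
      by rewrite [y n.+1]iterS -/(y n) cs_mulZr cs_mulDr !cs_mulA eh -IH.
    exact: cs_cvgM.
  apply: nr_cvg_unique yx; have -> : y = fun n => y n ** e.
    apply/funext; elim=> [|n IH]; first by rewrite /= cs_mul0l.
    by rewrite [y n.+1]iterS -/(y n) cs_mulZl cs_mulDl -!cs_mulA he -IH.
  exact: cs_cvgM.
Qed.

End Circle.

(* With [k = 1 - x] the hypothesis says [h^2 + k^2 = 1]. *)
Lemma circle_unitary h x : h^star = h -> x^star = x -> h ** x = x ** h ->
    x + x = h ** h + x ** x ->
  let u := h + 'i *: (cs_one - x) in
  [/\ u^star ** u = cs_one, (u^star)^star ** u^star = cs_one &
      h = (2^-1)%:C *: (u + u^star)].
Proof.
move=> hsa xsa hx xx u; set k := cs_one - x in u *.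
have ksa : k^star = k by rewrite cs_starD cs_starN cs_star1 xsa.
have hk : h ** k = k ** h by rewrite cs_mulBl cs_mulBr cs_mul1l cs_mul1r hx.
have hhkk : h ** h + k ** k = cs_one.
  have -> : k ** k = x ** x + (cs_one - (x + x)).
    rewrite cs_mulBl !cs_mulBr !cs_mul1l !cs_mul1r opprB opprD addrC.
    by rewrite -!addrA; congr (_ + _); rewrite addrCA.
  by rewrite addrA -xx addrC subrK.
have isom (s : R[i]) : s^*%R = - s -> s * s = -1 ->
    (h + s *: k)^star ** (h + s *: k) = cs_one.
  move=> sc ss; rewrite cs_starD cs_starZ hsa ksa sc scaleNr cs_mulBl !cs_mulDr.
  rewrite !cs_mulZl !cs_mulZr hk scalerA ss scaleN1r opprD opprK.
  by rewrite addrA addrK.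
have us : u^star = h - 'i *: k.
  by rewrite /u cs_starD cs_starZ hsa ksa conjCi scaleNr.
split.
- by apply: isom; rewrite ?conjCi// -expr2 sqrCi.
- rewrite us -scaleNr; apply: isom; first by rewrite rmorphN /= conjCi.
  by rewrite mulrNN -expr2 sqrCi.
- rewrite us addrACA subrr addr0 -[X in X + _]scale1r -[X in _ + X]scale1r.
  by rewrite -scalerDl scalerA -rmorphD -rmorphM mulVf ?scale1r// pnatr_eq0.
Qed.

(** Half the sum of a unitary and its adjoint has norm at most 1. The hypotheses are *-algebraic
    identities, hence preserved by *-morphisms, and yet they bound a norm: this is how bounds pass
    between algebras whose norms are not known to be comparable. *)
Lemma circle_bound h x : h^star = h -> x^star = x -> h ** x = x ** h ->
  x + x = h ** h + x ** x -> nr h <= 1.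
Proof.
move=> hsa xsa hx xx; have [uu _ ->] := circle_unitary hsa xsa hx xx.
set u := h + _ in uu *; rewrite nr_realscale ger0_norm ?invr_ge0//.
by have := ler_nrD u (u^star); rewrite nr_star; have := nr_isometry uu; lra.
Qed.

(** Isometries span A: a self-adjoint element of norm at most 1/2 is half the sum of two unitaries,
    scaling reaches all self-adjoint elements, and real and imaginary parts reach the rest. *)
Lemma isometry_ind (P : A -> Prop) :
  (forall u, u^star ** u = cs_one -> P u) ->
  (forall (c : R[i]) x y, P x -> P y -> P (c *: x + y)) ->
  forall x, P x.
Proof.
move=> Pu PD; have P0 : P 0.
  have P1 : P cs_one by apply: Pu; rewrite cs_star1 cs_mul1l.
  by have := PD (-1) _ _ P1 P1; rewrite scaleN1r addNr.
have PZ (c : R[i]) x : P x -> P (c *: x).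
  by move=> Px; rewrite -[_ *: _]addr0; apply: PD.
have small h : h^star = h -> nr h <= 2^-1 -> P h.
  move=> hsa h2; have [x [xsa hx xx _]] := circle_complement hsa h2.
  have [uu uu' ->] := circle_unitary hsa xsa hx xx.
  by apply: PZ; rewrite -[X in X + _]scale1r; apply: PD; exact: Pu.
have Psa h : h^star = h -> P h.
  (* Dividing by d brings the norm below 1/2; the summand 1 keeps d positive when h = 0. *)
  move=> hsa; pose d := 2 * nr h + 1; have h0 := nr_ge0 h.
  have d0 : 0 < d by rewrite /d; lra.
  have -> : h = d%:C *: (d^-1%:C *: h).
    by rewrite scalerA -rmorphM mulfV ?scale1r// gt_eqF.
  apply/PZ/small; first by rewrite cs_star_realZ hsa.
  rewrite nr_realscale ger0_norm ?invr_ge0 ?(ltW d0)// ler_pdivrMl//.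
  by rewrite /d; lra.
move=> x.
have -> : x = (2^-1)%:C *: (x + x^star) + (- 'i * (2^-1)%:C) *: ('i *: (x - x^star)).
  rewrite scalerA mulrAC mulNr -expr2 sqrCi opprK mul1r -scalerDr addrACA.
  rewrite addrN addr0 -[X in X + _]scale1r -[X in _ + X]scale1r.
  by rewrite -scalerDl scalerA -rmorphD -rmorphM mulVf ?scale1r// pnatr_eq0.
rewrite addrC; apply: PD; [|apply: PZ]; apply: Psa.
  by rewrite cs_starZ conjCi cs_starD cs_starN cs_starK scaleNr -scalerN opprB.
by rewrite cs_starD cs_starK addrC.
Qed.

End CStarAlgebraTheory.

(* [T] stands for a *-morphism, defined on the corner [D] only; the C*-identity
   reduces its boundedness to self-adjoint elements. *)
Lemma selfadjoint_bound {R : realType} {A B : cstarAlgType R} (T : A -> B)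
    (D : set A) :
  (forall c : R, {in D, forall a, D (c%:C *: a) /\ T (c%:C *: a) = c%:C *: T a}) ->
  {in D, forall a, D (a^star ** a) /\ T (a^star ** a) = (T a)^star ** T a} ->
  {in D, forall a, a^star = a -> nr a <= 2^-1 -> nr (T a) <= 1} ->
  {in D, forall a, nr (T a) <= 2 * nr a}.
Proof.
move=> TZ TM Tb.
have sab : {in D, forall a, a^star = a -> nr (T a) <= 2 * nr a}.
  move=> a Da asa; have [a0|a_neq0] := eqVneq (nr a) 0.
    have [_] := TZ 0 _ Da; rewrite (nr_eq0 a0) !scale0r => ->.
    by rewrite !nr0 mulr0.
  have a0 : 0 < nr a by rewrite lt_neqAle eq_sym a_neq0 nr_ge0.
  (* Rescaling to norm exactly 1/2, where [Tb] applies; hence the factor 2. *)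
  pose d := 2 * nr a; have d0 : 0 < d by rewrite /d; lra.
  have [Dda Tda] := TZ d^-1 _ Da.
  have := Tb _ (mem_set Dda); rewrite Tda cs_star_realZ asa !nr_realscale.
  rewrite ger0_norm ?invr_ge0 ?(ltW d0)// !ler_pdivrMl// mulr1; apply=> //.
  by rewrite /d; lra.
(* The C*-identity in both algebras turns the bound for the self-adjoint [a^star ** a] into |T a|^2
   <= 2 |a|^2. *)
move=> a Da; have [Daa Taa] := TM _ Da.
have := sab _ (mem_set Daa); rewrite cs_starM cs_starK Taa !nr_starM => /(_ erefl).
by have := nr_ge0 a; have := nr_ge0 (T a); nra.
Qed.

(** * Matrix algebras *)

Section MatrixAlgebra.
Context {R : realType} {A M : cstarAlgType R} {k : nat} (phi : 'M[A]_k -> M).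
Hypothesis Mk : is_matrix_algebra phi.
Implicit Types (x y : M) (a b : A) (i j l : 'I_k).

Let phiK_ex : exists psi : M -> 'M[A]_k, cancel phi psi /\ cancel psi phi.
Proof. by have [psi ? ?] := phi_bij Mk; exists psi. Qed.

Definition unphi : M -> 'M[A]_k := projT1 (cid phiK_ex).

Lemma phiK : cancel phi unphi.
Proof. exact: (projT2 (cid phiK_ex)).1. Qed.

Lemma unphiK : cancel unphi phi.
Proof. exact: (projT2 (cid phiK_ex)).2. Qed.

Definition entry i j x : A := unphi x i j.

Definition embed i j a : M :=
  phi (\matrix_(p, q) if (p == i) && (q == j) then a else 0).

Lemma entry_inj x y : (forall i j, entry i j x = entry i j y) -> x = y.
Proof.
by move=> xy; rewrite -[x]unphiK -[y]unphiK; congr phi; apply/matrixP.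
Qed.

Lemma entryD i j x y : entry i j (x + y) = entry i j x + entry i j y.
Proof. by rewrite /entry -{1}[x]unphiK -{1}[y]unphiK -(phiD Mk) phiK mxE. Qed.

Lemma entryZ i j (c : R[i]) x : entry i j (c *: x) = c *: entry i j x.
Proof. by rewrite /entry -{1}[x]unphiK -(phiZ Mk) phiK mxE. Qed.

Lemma entryM i j x y :
  entry i j (x ** y) = \sum_l entry i l x ** entry l j y.
Proof. by rewrite /entry -{1}[x]unphiK -{1}[y]unphiK -(phiM Mk) phiK mxE. Qed.

Lemma entry1 i j : entry i j cs_one = if i == j then cs_one else 0.
Proof. by rewrite /entry -(phi1 Mk) phiK mxE. Qed.

Lemma entry_star i j x : entry i j (x^star) = (entry j i x)^star.
Proof. by rewrite /entry -{1}[x]unphiK -(phi_star Mk) phiK mxE. Qed.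

Lemma entry_embed i j p q a :
  entry p q (embed i j a) = if (p == i) && (q == j) then a else 0.
Proof. by rewrite /entry phiK mxE. Qed.

Lemma entry0 i j : entry i j 0 = 0.
Proof. by rewrite -[0 in LHS](scale0r (0 : M)) entryZ scale0r. Qed.

Lemma entry_sum (I : Type) (r : seq I) (P : pred I) (F : I -> M) i j :
  entry i j (\sum_(t <- r | P t) F t) = \sum_(t <- r | P t) entry i j (F t).
Proof. by apply: big_morph => [x y|]; rewrite ?entryD ?entry0. Qed.

Lemma embedD i j a b : embed i j (a + b) = embed i j a + embed i j b.
Proof.
apply: entry_inj => p q; rewrite entryD !entry_embed.
by case: ifP; rewrite ?addr0.
Qed.

Lemma embedZ i j (c : R[i]) a : embed i j (c *: a) = c *: embed i j a.
Proof.
apply: entry_inj => p q; rewrite entryZ !entry_embed.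
by case: ifP; rewrite ?scaler0.
Qed.

Lemma embed_star i j a : (embed i j a)^star = embed j i (a^star).
Proof.
apply: entry_inj => p q; rewrite entry_star !entry_embed andbC.
by case: ifP; rewrite ?cs_star0.
Qed.

Lemma embedM i j l a b : embed i j a ** embed j l b = embed i l (a ** b).
Proof.
apply: entry_inj => p q; rewrite entryM (bigD1 j)//= big1 ?addr0 => [|t tj].
  rewrite !entry_embed !eqxx andbT /=.
  by case: (p == i); case: (q == l); rewrite ?cs_mul0r ?cs_mul0l.
by rewrite !entry_embed (negPf tj) andbF cs_mul0l.
Qed.

(** Matrix units on both sides isolate an entry and move it to any position using the product of M
    alone, so a bound on x becomes a bound on its entries. *)
Lemma embed_entry i j p q x :
  embed p i cs_one ** x ** embed j q cs_one = embed p q (entry i j x).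
Proof.
apply: entry_inj => s t; rewrite entryM (bigD1 j)//= big1 ?addr0 => [|l lj].
  rewrite entryM (bigD1 i)//= big1 ?addr0 => [|l li].
    rewrite !entry_embed !eqxx andbT /=.
    by case: (s == p); case: (t == q); rewrite ?cs_mul0r ?cs_mul0l ?cs_mul1r ?cs_mul1l.
  by rewrite !entry_embed (negPf li) andbF cs_mul0l.
by rewrite !entry_embed (negPf lj) cs_mul0r.
Qed.

Lemma sum_embed x : x = \sum_i \sum_j embed i j (entry i j x).
Proof.
apply: entry_inj => i j; rewrite entry_sum (bigD1 i)//= entry_sum (bigD1 j)//=.
rewrite !big1 ?addr0 ?entry_embed ?eqxx// => [p pi|q qj].
  by rewrite entry_sum big1// => q _; rewrite entry_embed eq_sym (negPf pi).
by rewrite entry_embed [j == q]eq_sym (negPf qj) andbF.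
Qed.

(** On the diagonal [embed i i] is a *-morphism, though not a unital one. The relation 2x = h^2 +
    x^2 mentions no unit, so it survives in M, where [circle_bound] applies. *)
Lemma embed_diag_bound i a : nr (embed i i a) <= 2 * nr a.
Proof.
apply: (@selfadjoint_bound _ _ _ (embed i i) setT) (mem_set I) => {}a.
- by move=> b _; rewrite embedZ.
- by rewrite embed_star embedM.
move=> _ asa a2; have [x [xsa ax xx _]] := circle_complement asa a2.
apply: (@circle_bound _ _ _ (embed i i x)); rewrite ?embed_star ?asa ?xsa//.
  by rewrite !embedM ax.
by rewrite !embedM -!embedD xx.
Qed.

(** The inverse morphism lives on the corner [range (embed i i)] only, while the square root is
    constructed in M. It has to be shown to lie in the corner before the relations can be carried
    back to A. *)
Lemma embed_diag_bound_inv i a : nr a <= 2 * nr (embed i i a).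
Proof.
have embK b : entry i i (embed i i b) = b by rewrite entry_embed !eqxx.
rewrite -{1}[a]embK; apply: (@selfadjoint_bound _ _ _ (entry i i)
  (range (embed i i))); last exact/mem_set/imageT.
- move=> c _ /set_mem[b _ <-]; rewrite entryZ; split=> //.
  by exists (c%:C *: b) => //; rewrite embedZ.
- move=> _ /set_mem[b _ <-]; rewrite embed_star embedM !embK; split.
    by exists (b^star ** b).
  by [].
move=> _ /set_mem[b _ <-] /(congr1 (entry i i)); rewrite embed_star !embK => bsa.
have bbsa : (embed i i b)^star = embed i i b by rewrite embed_star bsa.
move=> /(circle_complement bbsa)[X [Xsa bX XX eX]].
(* The unit of the corner fixes h, hence also X. *)
have [||eX1 X1e] := eX (embed i i cs_one).
- by rewrite embedM cs_mul1l.
- by rewrite embedM cs_mul1r.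
have [x XE] : exists x : A, X = embed i i x.
  by exists (entry i i X); rewrite -embed_entry eX1 X1e.
move: Xsa bX XX; rewrite XE embed_star !embedM -!embedD.
move=> /(congr1 (entry i i)) + /(congr1 (entry i i)) + /(congr1 (entry i i)).
by rewrite !embK => xsa bx xx; exact: circle_bound xx.
Qed.

(** Off the diagonal the inclusion is not multiplicative, so a is placed on the diagonal and then
    moved by a matrix unit. The sum over all matrix units bounds each of them uniformly in the
    position. *)
Lemma embed_bound : exists2 C : R, 0 <= C &
  forall i j a, nr (embed i j a) <= C * nr a.
Proof.
pose C := \sum_(ij : 'I_k * 'I_k) nr (embed ij.1 ij.2 cs_one).
have C0 : 0 <= C by apply: sumr_ge0 => ij _; exact: nr_ge0.
exists (2 * C) => [|i j a]; first by rewrite mulr_ge0.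
have -> : embed i j a = embed i i a ** embed i j cs_one.
  by rewrite embedM cs_mul1r.
have eC : nr (embed i j cs_one) <= C.
  by rewrite /C (bigD1 (i, j))//= lerDl sumr_ge0// => ij _; exact: nr_ge0.
apply: (le_trans (nrM _ _)); rewrite mulrAC ler_pM ?nr_ge0//.
exact: embed_diag_bound.
Qed.

(** Moved to a diagonal position, the entry is a product of x with two matrix units, and
    [embed_diag_bound_inv] carries the bound back to A. *)
Lemma entry_bound : exists2 C : R, 0 <= C &
  forall i j x, nr (entry i j x) <= C * nr x.
Proof.
have [C C0 eC] := embed_bound; exists (2 * (C * C)) => [|i j x].
  by rewrite !mulr_ge0.
apply: (le_trans (embed_diag_bound_inv i _)); rewrite -mulrA ler_wpM2l//.
rewrite -(embed_entry i j i i); apply: (le_trans (nrM _ _)).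
have := nrM (embed i i cs_one) x; have n1 := nr1_le1 (A := A).
have e1 p q : nr (embed p q cs_one) <= C.
  by apply: (le_trans (eC _ _ _)); rewrite ler_piMr.
move=> ex; rewrite mulrAC; apply: ler_pM; rewrite ?nr_ge0//.
by apply: (le_trans ex); rewrite ler_wpM2r ?nr_ge0.
Qed.

End MatrixAlgebra.

(** * Riemann sums of continuous functions *)

Section BoundedLinear.
Context {R : realType} {V W : normedModType R[i]}.
Implicit Types L : V -> W.

Definition bounded_linear L : Prop :=
  [/\ forall x y, L (x + y) = L x + L y, forall (c : R[i]) x, L (c *: x) = c *: L x &
      exists2 C : R, 0 <= C & forall x, nr (L x) <= C * nr x].

Variables (L : V -> W) (hL : bounded_linear L).

Lemma blinD x y : L (x + y) = L x + L y. Proof. by have [+ _ _] := hL; exact. Qed.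

Lemma blinZ (c : R[i]) x : L (c *: x) = c *: L x.
Proof. by have [_ + _] := hL; exact. Qed.

Lemma blin0 : L 0 = 0. Proof. by rewrite -[0 in LHS](scale0r (0 : V)) blinZ scale0r. Qed.

Lemma blinN x : L (- x) = - L x. Proof. by rewrite -scaleN1r blinZ scaleN1r. Qed.

Lemma blinB x y : L (x - y) = L x - L y. Proof. by rewrite blinD blinN. Qed.

Lemma blin_sum (I : Type) (r : seq I) (P : pred I) (F : I -> V) :
  L (\sum_(t <- r | P t) F t) = \sum_(t <- r | P t) L (F t).
Proof. exact: (big_morph L blinD blin0). Qed.

Lemma blin_cvg {T : Type} {F : set_system T} {FF : Filter F} (f : T -> V) (l : V) :
  f @ F --> l -> (fun t => L (f t)) @ F --> L l.
Proof.
have [_ _ [C C0 LC]] := hL.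
move=> /cvg_nrP fl; apply/cvg_nrP => e e0.
have d0 : 0 < e / (C + 1) by rewrite divr_gt0// ltr_wpDl.
apply: filterS (fl _ d0) => t; rewrite ltr_pdivlMr ?ltr_wpDl// => ft.
rewrite -blinB; have := LC (f t - l); have := nr_ge0 (f t - l); nra.
Qed.

End BoundedLinear.

Lemma bounded_linear_comp {R : realType} {U V W : normedModType R[i]}
    (L : V -> W) (K : U -> V) :
  bounded_linear L -> bounded_linear K -> bounded_linear (L \o K).
Proof.
move=> [LD LZ [C C0 LC]] [KD KZ [D D0 KD']]; split=> /=.
- by move=> x y; rewrite KD LD.
- by move=> c x; rewrite KZ LZ.
exists (C * D) => [|x]; first exact: mulr_ge0.
by rewrite -mulrA (le_trans (LC _))// ler_wpM2l.
Qed.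

Lemma bounded_linear_sum {R : realType} {V W : normedModType R[i]} (I : Type)
    (r : seq I) (F : I -> V -> W) :
  (forall t, bounded_linear (F t)) ->
  bounded_linear (fun x => \sum_(t <- r) F t x).
Proof.
move=> hF; split.
- by move=> x y; rewrite -big_split; apply: eq_bigr => t _; rewrite blinD.
- by move=> c x; rewrite scaler_sumr; apply: eq_bigr => t _; rewrite blinZ.
have ex t : exists C : R, 0 <= C /\ forall x, nr (F t x) <= C * nr x.
  by have [_ _ [C C0 FC]] := hF t; exists C.
exists (\sum_(t <- r) projT1 (cid (ex t))).
  by apply: sumr_ge0 => t _; case: cid => C [].
move=> x; rewrite mulr_suml (le_trans (ler_nr_sum _ _ _))//.
by apply: ler_sum => t _; case: cid => C [].
Qed.

Lemma rV_norm_le {R : realType} {m : nat} (x : 'rV[R]_m) (c : R) :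
  0 <= c -> (`|x| <= c) = [forall i, `|x 0 i| <= c].
Proof.
move=> c0; have -> : `|x| = mx_norm x by [].
rewrite mx_normrE; apply/idP/forallP => [xc i|xc].
  apply: le_trans xc; apply/bigmax_geP; right; by exists (0, i).
by apply/bigmax_leP; split=> // -[p q] _; rewrite /= ord1.
Qed.

Lemma rV_norm_coord {R : realType} {m : nat} (x : 'rV[R]_m) i : `|x 0 i| <= `|x|.
Proof. by have := lexx `|x|; rewrite {1}rV_norm_le// => /forallP/(_ i). Qed.

(** Heine-Cantor, with only x confined to the ball: y may leave it, as happens when a step is taken
    from the boundary of a grid. *)
Lemma uniform_continuity {R : realType} {V : normedModType R[i]} {m : nat}
    (f : 'rV[R]_m -> V) (r e : R) :
  continuous f -> 0 < e -> exists2 d : R, 0 < d &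
    forall x y : 'rV[R]_m, `|x| <= r -> `|x - y| < d -> nr (f x - f y) < e.
Proof.
move=> cf e0.
pose K : set 'rV[R]_m := [set x | `|x| <= r].
have cK : compact K.
  apply: bounded_closed_compact.
    exists r; split; first exact: num_real.
    by move=> z rz x /= xr; apply: (le_trans xr); exact: ltW.
  apply: (@preimage_closed _ _ (fun x : 'rV[R]_m => `|x|) [set z : R | z <= r]).
    by move=> x _; exact: norm_continuous.
  exact: closed_le.
have : \forall d \near 0^'+, K `<=`
    (fun x => forall y, `|x - y| < d -> nr (f x - f y) < e).
  move/compact_near_coveringP: cK; apply=> x _.
  have e2 : 0 < e / 2 by rewrite divr_gt0.
  move/cvg_nrP: (cf x) => /(_ _ e2) nfx.
  have /nbhs_ballP[d /= d0 dP] := nfx.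
  rewrite -ball_normE in dP.
  exists (ball x (d / 2), [set t | t < d / 2]).
    split; first by apply: nbhsx_ballx; rewrite divr_gt0.
    by apply: nbhs_right_lt; rewrite divr_gt0.
  move=> [x' t] /= []; rewrite -ball_normE /= => xx' td y xy.
  have fx' := dP x' _; have fy := dP y _; rewrite /= in fx' fy.
  have := ler_nrBD (f x) (f x') (f y); rewrite (nrB (f x)).
  suff : nr (f x' - f x) < e / 2 /\ nr (f y - f x) < e / 2 by case; lra.
  split; first by apply: fx'; lra.
  apply: fy; rewrite -[x - y](subrKA x') (le_lt_trans (ler_normD _ _))//; lra.
case=> d /= d0 dP; exists (d / 2); first exact: divr_gt0.
move=> x y xr; apply: (dP (d / 2)) => //=; last exact: divr_gt0.
by rewrite sub0r normrN gtr0_norm ?divr_gt0//; lra.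
Qed.

Section RiemannSums.
Context {R : realType} {V : normedModType R[i]} {m : nat}.
Implicit Types (f : 'rV[R]_m -> V) (r N L : nat).

Definition mesh r N : R := 2 * r%:R / N.+1%:R.

Definition gridpt r N (t : {ffun 'I_m -> 'I_N.+1}) : 'rV[R]_m :=
  \row_i (mesh r N * (t i)%:R - r%:R).

Lemma riemann_sumE f r N :
  riemann_sum f r N = (mesh r N ^+ m)%:C *: \sum_t f (@gridpt r N t).
Proof. by []. Qed.

Lemma mesh_ge0 r N : 0 <= mesh r N.
Proof. by rewrite divr_ge0// mulr_ge0. Qed.

Lemma gridpt_norm r N t : `|@gridpt r N t| <= r%:R.
Proof.
rewrite rV_norm_le//; apply/forallP => i; rewrite mxE ler_norml.
have N0 : 0 < N.+1%:R :> R by [].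
have tN : (t i)%:R <= N.+1%:R :> R by rewrite ler_nat ltnW.
have := mesh_ge0 r N; have : mesh r N * N.+1%:R = 2 * r%:R by rewrite divfK// gt_eqF.
have : 0 <= (t i)%:R :> R by []; nra.
Qed.

Lemma mesh_volume r N : mesh r N ^+ m * (N.+1 ^ m)%:R = (2 * r%:R) ^+ m.
Proof. by rewrite natrX -exprMn divfK// pnatr_eq0. Qed.

Lemma riemann_sum_bound f r N (c : R) :
  (forall t, nr (f (@gridpt r N t)) <= c) ->
  nr (riemann_sum f r N) <= (2 * r%:R) ^+ m * c.
Proof.
move=> fc; rewrite riemann_sumE nr_realscale ger0_norm ?exprn_ge0 ?mesh_ge0//.
rewrite -(mesh_volume r N) -mulrA ler_wpM2l ?exprn_ge0 ?mesh_ge0//.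
apply: (le_trans (ler_nr_sum _ _ _)).
apply: (le_trans (ler_sum _ (fun t _ => fc t))).
by rewrite sumr_const card_ffun !card_ord mulr_natl.
Qed.

(** The coarse cell containing a fine one, when each side of the N.+1 cells is cut into L.+1. The
    form [.-1.+1] occurs because [riemann_sum] takes the number of cells minus one. *)
Definition coarse N L (t : {ffun 'I_m -> 'I_(N.+1 * L.+1).-1.+1}) :
  {ffun 'I_m -> 'I_N.+1} := [ffun i => inord (t i %/ L.+1)].

Let refN N L : (N.+1 * L.+1).-1.+1 = (N.+1 * L.+1)%N.
Proof. by []. Qed.

Lemma coarseE N L t i : @coarse N L t i = (t i %/ L.+1)%N :> nat.
Proof.
rewrite ffunE inordK// ltn_divLR// -(refN N L); exact: ltn_ord.
Qed.

Lemma sum_coarse {W : zmodType} N L (F : {ffun 'I_m -> 'I_N.+1} -> W) :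
  \sum_t F (@coarse N L t) = (\sum_t F t) *+ L.+1 ^ m.
Proof.
rewrite (partition_big (@coarse N L) xpredT)// -sumrMnl.
apply: eq_bigr => s _.
rewrite (eq_bigr (fun=> F s)) => [|t /eqP->//]; rewrite sumr_const; congr (_ *+ _).
(* The fibre over s is the product of its one-dimensional fibres [B j], each with L.+1 elements,
   enumerated by [g] below. *)
pose B (j : 'I_m) := [pred p : 'I_(N.+1 * L.+1).-1.+1 | (p %/ L.+1)%N == s j].
transitivity #|[pred t | @coarse N L t == s]|; first exact: eq_card.
transitivity #|family B|.
  apply: eq_card => t; rewrite inE; apply/eqP/familyP => [ts j|tB].
    by rewrite inE -(coarseE t) ts.
  by apply/ffunP => j; apply/val_inj; rewrite /= coarseE; apply/eqP/tB.
rewrite card_family -[in RHS](card_ord m) -prod_nat_const.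
rewrite foldrE big_map big_enum /=; apply: eq_bigr => j _.
pose g (p : 'I_L.+1) : 'I_(N.+1 * L.+1).-1.+1 := inord (s j * L.+1 + p).
have gE p : g p = (s j * L.+1 + p)%N :> nat.
  rewrite inordK// refN; apply: (@leq_trans ((s j).+1 * L.+1)).
    by rewrite mulSn addnC ltn_add2r.
  by rewrite leq_mul2r (ltn_ord (s j)) orbT.
rewrite -[RHS](card_ord L.+1) -(@fintype.card_image _ _ g); last first.
  by move=> p q /(congr1 val) /=; rewrite !gE => /addnI/val_inj.
transitivity #|B j|; first exact: eq_card.
apply: eq_card => p; rewrite inE; apply/eqP/fintype.imageP => [ps|[q _ ->]].
  exists (inord (p %% L.+1)) => //; apply/val_inj.
  by rewrite /= gE inordK ?ltn_mod// -ps -divn_eq.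
by rewrite gE divnMDl// divn_small ?addn0.
Qed.

(** The coarse sum is rewritten over the fine grid by repeating each value. A fine grid point
    differs from the corner of its coarse cell by at most the coarse mesh, and the box has volume
    (2r)^m. *)
Lemma riemann_sum_refine f r N L (e : R) : 0 <= e ->
  (forall x y, `|x| <= r%:R -> `|x - y| <= mesh r N -> nr (f x - f y) <= e) ->
  nr (riemann_sum f r (N.+1 * L.+1).-1 - riemann_sum f r N) <= (2 * r%:R) ^+ m * e.
Proof.
move=> e0 fe; set Q := (N.+1 * L.+1).-1.
have mQ : mesh r N = mesh r Q * L.+1%:R.
  by rewrite /mesh refN natrM invfM mulrA divfK// pnatr_eq0.
have -> : riemann_sum f r N =
    (mesh r Q ^+ m)%:C *: \sum_t f (gridpt r (@coarse N L t)).
  rewrite (@sum_coarse _ N L (fun s => f (gridpt r s))) riemann_sumE mQ exprMn.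
  rewrite rmorphM -scalerA; congr (_ *: _).
  by rewrite -natrX -[in RHS]scaler_nat rmorph_nat.
rewrite riemann_sumE -scalerBr -sumrB nr_realscale ger0_norm ?exprn_ge0 ?mesh_ge0//.
rewrite -(mesh_volume r Q) -mulrA ler_wpM2l ?exprn_ge0 ?mesh_ge0//.
apply: (le_trans (ler_nr_sum _ _ _)).
apply: (@le_trans _ _ (\sum_(t : {ffun 'I_m -> 'I_Q.+1}) e)).
  apply: ler_sum => t _; apply: fe; first exact: gridpt_norm.
  rewrite rV_norm_le ?mesh_ge0//; apply/forallP => i; rewrite !mxE coarseE.
  rewrite opprB addrA subrK {1}(divn_eq (t i) L.+1) mQ -mulrA -mulrBr natrD natrM.
  rewrite [L.+1%:R * _]mulrC addrAC subrr add0r ger0_norm; last first.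
    by apply: mulr_ge0; rewrite ?mesh_ge0.
  by rewrite ler_wpM2l ?mesh_ge0// ler_nat ltnW// ltn_mod.
by rewrite sumr_const card_ffun !card_ord mulr_natl.
Qed.

End RiemannSums.

Lemma mesh_lt {R : realType} r (d : R) : 0 < d ->
  exists N0, forall N, (N0 <= N)%N -> mesh r N < d.
Proof.
move=> d0; exists (Num.bound (2 * r%:R / d)) => N N0.
rewrite ltr_pdivrMr// -ltr_pdivrMl// [_^-1 * _]mulrC.
have rd0 : 0 <= 2 * r%:R / d by rewrite divr_ge0 ?mulr_ge0// ltW.
apply: (lt_le_trans (archi_boundP rd0)).
by rewrite ler_nat leqW.
Qed.

Lemma riemann_sum_cvg {R : realType} {V : completeNormedModType R[i]} {m : nat}
    (f : 'rV[R]_m -> V) r :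
  continuous f -> cvg (riemann_sum f r @ \oo).
Proof.
move=> cf; apply: cauchyn_cvg => e e0.
pose c : R := (2 * r%:R) ^+ m; have c0 : 0 <= c by rewrite exprn_ge0// mulr_ge0.
pose e' := e / (2 * c + 1); have e'0 : 0 < e' by rewrite divr_gt0//; lra.
have [d d0 fd] := uniform_continuity r%:R cf e'0.
have [N0 N0P] := mesh_lt r d0.
have step N L : (N0 <= N)%N ->
    nr (riemann_sum f r (N.+1 * L.+1).-1 - riemann_sum f r N) <= c * e'.
  move=> N0N; apply: riemann_sum_refine => [|x y xr xy]; first exact: ltW.
  by apply/ltW/fd => //; apply: le_lt_trans xy (N0P _ N0N).
exists N0 => p q Np Nq; have := step q p Nq; have := step p q Np.
(* The grids p and q are compared through their common refinement. *)
rewrite (mulnC q.+1); set S := riemann_sum f r _; rewrite nrB => H1 H2.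
apply: (le_lt_trans (ler_nrBD S _ _)); apply: (le_lt_trans (lerD H1 H2)).
have : e' * (2 * c + 1) = e by rewrite divfK// gt_eqF//; lra.
by rewrite mulrDr mulr1; lra.
Qed.

(** * Summable product weights on grids *)

Section Weight.
Context {R : realType}.

Definition wgt1 (x : R) : R := ((1 + `|x|) ^+ 2)^-1.

Lemma wgt1_gt0 x : 0 < wgt1 x.
Proof. by rewrite invr_gt0 exprn_gt0// ltr_pwDl. Qed.

Lemma wgt1_le1 x : wgt1 x <= 1.
Proof. by rewrite invf_le1 ?exprn_gt0 ?ltr_pwDl// exprn_ege1// lerDl. Qed.

Lemma le_wgt1 x y : `|x| <= `|y| -> wgt1 y <= wgt1 x.
Proof.
move=> xy; rewrite lef_pV2 ?posrE ?exprn_gt0 ?ltr_pwDl//.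
by rewrite lerXn2r ?nnegrE ?addr_ge0// lerD2l.
Qed.

(** With a = K + p each new term K^2/(a+1)^2 is at most K^2/a - K^2/(a+1), so the sum telescopes and
    the bound is independent of n. The induction carries the remainder K^2/(K+p). *)
Lemma half_sum_wgt1 K n : (0 < K)%N ->
  \sum_(0 <= t < n) wgt1 (K%:R^-1 * t%:R) <= 2 * K%:R.
Proof.
move=> K0; have K1 : 1 <= K%:R :> R by rewrite ler1n.
have Kp : 0 < K%:R :> R by lra.
have H p : \sum_(0 <= t < p.+1) wgt1 (K%:R^-1 * t%:R) <=
    1 + K%:R - K%:R ^+ 2 / (K%:R + p%:R).
  elim: p => [|p IH].
    rewrite big_nat1 mulr0 addr0 expr2 mulfK ?gt_eqF// addrK.
    exact: wgt1_le1.
  rewrite big_nat_recr//=; apply: (le_trans (lerD IH (lexx _))).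
  set a : R := K%:R + p%:R; have a0 : 0 < a by rewrite ltr_wpDr.
  have -> : wgt1 (K%:R^-1 * p.+1%:R) = K%:R ^+ 2 / (a + 1) ^+ 2.
    rewrite /wgt1 ger0_norm ?mulr_ge0 ?invr_ge0//.
    have -> : 1 + K%:R^-1 * p.+1%:R = (a + 1) / K%:R.
      by rewrite /a -natr1; field; rewrite gt_eqF.
    by rewrite expr_div_n invf_div.
  have -> : K%:R + p.+1%:R = a + 1 :> R by rewrite -natr1 addrA.
  suff : K%:R ^+ 2 / (a + 1) ^+ 2 <= K%:R ^+ 2 / a - K%:R ^+ 2 / (a + 1) by lra.
  have -> : K%:R ^+ 2 / a - K%:R ^+ 2 / (a + 1) = K%:R ^+ 2 / (a * (a + 1)).
    by field; rewrite !gt_eqF//; lra.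
  rewrite ler_pM2l ?exprn_gt0// lef_pV2 ?posrE ?exprn_gt0 ?mulr_gt0//; nra.
case: n => [|n]; first by rewrite big_nil mulr_ge0.
apply: (le_trans (H n)); have : 0 <= K%:R ^+ 2 / (K%:R + n%:R) :> R.
  by rewrite divr_ge0 ?exprn_ge0 ?addr_ge0.
by lra.
Qed.

(* Number of cells minus one of the grid of mesh [1/K] on [-r, r]. *)
Definition gsize r K := (2 * r * K).-1.

Lemma gsizeS r K : (0 < r)%N -> (0 < K)%N -> (gsize r K).+1 = (2 * r * K)%N.
Proof. by move=> r0 K0; rewrite /gsize prednK// !muln_gt0 r0. Qed.

Lemma mesh_gsize r K : (0 < r)%N -> (0 < K)%N -> mesh r (gsize r K) = K%:R^-1 :> R.
Proof.
move=> r0 K0; rewrite /mesh gsizeS// !natrM.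
by field; rewrite !pnatr_eq0 -!lt0n r0 K0.
Qed.

Lemma sum_wgt1 r K : (0 < r)%N -> (0 < K)%N ->
  \sum_(j < (gsize r K).+1) wgt1 (mesh r (gsize r K) * j%:R - r%:R) <= 4 * K%:R.
Proof.
move=> r0 K0; have Kp : 0 < K%:R :> R by rewrite ltr0n.
rewrite mesh_gsize// gsizeS//.
rewrite -(big_mkord xpredT (fun j => wgt1 (K%:R^-1 * j%:R - r%:R))) /=.
have E : (2 * r * K = r * K + r * K)%N by rewrite -mulnA mul2n addnn.
(* The index rK is the origin. Reversed, the left half is dominated by a sum of the same kind as the
   right one. *)
rewrite (big_cat_nat (n := (r * K)%N))//=; last by rewrite E leq_addl.
have -> : 4 * K%:R = 2 * K%:R + 2 * K%:R :> R by lra.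
apply: lerD; last first.
  rewrite -{1}[(r * K)%N]add0n big_addn E addnK.
  rewrite (eq_bigr (fun t => wgt1 (K%:R^-1 * t%:R))) ?half_sum_wgt1// => t _.
  by congr wgt1; rewrite natrD natrM; field; rewrite gt_eqF.
rewrite big_nat_rev /= add0n; apply: le_trans (half_sum_wgt1 (r * K) K0).
rewrite !big_nat; apply: ler_sum => t /= tr; apply: le_wgt1.
rewrite natrB// natrM -natr1.
have -> : K%:R^-1 * (r%:R * K%:R - (t%:R + 1)) - r%:R = - (K%:R^-1 * (t%:R + 1)) :> R.
  by field; rewrite gt_eqF.
rewrite normrN !ger0_norm ?mulr_ge0 ?invr_ge0 ?addr_ge0//.
by rewrite ler_wpM2l ?invr_ge0// lerDl.
Qed.

Variable m : nat.

Definition wgt (x : 'rV[R]_m) : R := \prod_i wgt1 (x 0 i).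

Lemma wgt_ge0 x : 0 <= wgt x.
Proof. by apply: prodr_ge0 => i _; rewrite ltW// wgt1_gt0. Qed.

Lemma sum_wgt r K : (0 < r)%N -> (0 < K)%N ->
  \sum_t wgt (@gridpt R m r (gsize r K) t) <= (4 * K%:R) ^+ m.
Proof.
move=> r0 K0; pose F (i : 'I_m) (j : 'I_(gsize r K).+1) : R :=
  wgt1 (mesh r (gsize r K) * j%:R - r%:R).
rewrite (eq_bigr (fun t : {ffun 'I_m -> 'I_(gsize r K).+1} => \prod_i F i (t i))).
  rewrite -bigA_distr_bigA /= -[X in _ ^+ X](card_ord m) -prodr_const.
  apply: ler_prod => i _; rewrite sum_wgt1// sumr_ge0// => j _.
  by rewrite ltW// wgt1_gt0.
by move=> t _; apply: eq_bigr => i _; rewrite mxE.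
Qed.

(** The i-th factor is fixed and at most 1, so one factor of order K is saved over [sum_wgt]. This
    is the size of the boundary terms of a telescoping sum. *)
Lemma sum_wgt_face r K i c : (0 < r)%N -> (0 < K)%N ->
  \sum_(t : {ffun 'I_m -> 'I_(gsize r K).+1} | t i == c) wgt (gridpt r t) <=
  (4 * K%:R) ^+ m.-1.
Proof.
move=> r0 K0; pose F (l : 'I_m) (j : 'I_(gsize r K).+1) : R :=
  if l == i then (j == c)%:R else wgt1 (mesh r (gsize r K) * j%:R - r%:R).
have F0 l j : 0 <= F l j.
  by rewrite /F; case: ifP => _ //; rewrite ltW// wgt1_gt0.
apply: (@le_trans _ _ (\sum_(t : {ffun 'I_m -> 'I_(gsize r K).+1}) \prod_l F l (t l))).
  rewrite big_mkcond; apply: ler_sum => t _; case: ifP => [/eqP tc|_]; last first.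
    exact: prodr_ge0.
  apply: ler_prod => l _; rewrite ltW ?wgt1_gt0//= mxE /F.
  by case: eqP => [->|//]; rewrite tc eqxx wgt1_le1.
rewrite -bigA_distr_bigA /= (bigD1 i)//= /F eqxx -[leRHS]mul1r.
apply: ler_pM.
- by apply: sumr_ge0 => j _.
- by apply: prodr_ge0 => l _; apply: sumr_ge0 => j _; exact: F0.
- by rewrite (bigD1 c)//= eqxx big1 ?addr0// => j /negPf ->.
apply: (@le_trans _ _ (\prod_(l < m | l != i) (4 * K%:R))).
  apply: ler_prod => l /negPf ->; rewrite sum_wgt1// andbT.
  by apply: sumr_ge0 => j _; rewrite ltW ?wgt1_gt0.
by rewrite prodr_const cardC1 card_ord.
Qed.

(** The sup norm dominates every coordinate, so two powers of 1 + |x| pay for each factor of the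
    weight. *)
Lemma decay_le_wgt (x : 'rV[R]_m) : ((1 + `|x|) ^+ (2 * m))^-1 <= wgt x.
Proof.
rewrite exprM -exprVn -[X in _ ^+ X](card_ord m) -prodr_const.
apply: ler_prod => i _; rewrite invr_ge0 exprn_ge0 ?addr_ge0//=.
rewrite -[X in 1 + X]normr_id.
by apply: (@le_wgt1 (x 0 i)); rewrite normr_id rV_norm_coord.
Qed.

Lemma le_decay_wgt (x : 'rV[R]_m) (a C : R) : 0 <= a ->
  (1 + `|x|) ^+ (2 * m) * a <= C -> a <= C * wgt x.
Proof.
move=> a0 aC; have x1 : 0 < (1 + `|x|) ^+ (2 * m) by rewrite exprn_gt0// ltr_pwDl.
have C0 : 0 <= C by apply: le_trans aC; rewrite mulr_ge0// ltW.
apply: (@le_trans _ _ (C * ((1 + `|x|) ^+ (2 * m))^-1)).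
  by rewrite ler_pdivlMr// mulrC.
by rewrite ler_wpM2l// decay_le_wgt.
Qed.

End Weight.

Section GridEstimates.
Context {R : realType} {V : normedModType R[i]} {m : nat}.
Variables (f : 'rV[R]_m -> V) (C : R) (C0 : 0 <= C).

Lemma le_nr_riemann_sum r K : (0 < r)%N -> (0 < K)%N ->
  (forall x, (1 + `|x|) ^+ (2 * m) * nr (f x) <= C) ->
  nr (riemann_sum f r (gsize r K)) <= 4 ^+ m * C.
Proof.
move=> r0 K0 fC; have Kp : 0 < K%:R :> R by rewrite ltr0n.
rewrite riemann_sumE mesh_gsize// nr_realscale ger0_norm ?exprn_ge0 ?invr_ge0//.
rewrite exprVn ler_pdivrMl ?exprn_gt0//; apply: (le_trans (ler_nr_sum _ _ _)).
apply: (@le_trans _ _ (C * \sum_t wgt (@gridpt R m r (gsize r K) t))).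
  by rewrite mulr_sumr; apply: ler_sum => t _; apply: le_decay_wgt; rewrite ?nr_ge0.
by rewrite mulrA -exprMn [_ ^+ m * C]mulrC [K%:R * _]mulrC ler_wpM2l// sum_wgt.
Qed.

(** Both grids have mesh 1/K, so the smaller is part of the larger and only points with |x| >= r
    remain. There the power of 1 + |x| beyond those used by the weight gives the factor 1/(1+r). *)
Lemma nr_riemann_sumB r r' K : (0 < r)%N -> (r <= r')%N -> (0 < K)%N ->
  (forall x, (1 + `|x|) ^+ (2 * m).+1 * nr (f x) <= C) ->
  nr (riemann_sum f r' (gsize r' K) - riemann_sum f r (gsize r K)) <=
  4 ^+ m * (C / (1 + r%:R)).
Proof.
move=> r0 rr' K0 fC; have r'0 : (0 < r')%N by apply: leq_trans rr'.
have Kp : 0 < K%:R :> R by rewrite ltr0n.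
(* The index of the large grid at which the small one begins, in every direction. *)
pose s := ((r' - r) * K)%N; have r1 : 0 < 1 + r%:R :> R by rewrite ltr_pwDl.
have sE : (s + 2 * r * K <= 2 * r' * K)%N.
  by rewrite -mulnDl leq_mul2r; apply/orP; right; lia.
pose inner (t : {ffun 'I_m -> 'I_(gsize r' K).+1}) :=
  [forall i, (s <= t i < s + 2 * r * K)%N].
pose h (t : {ffun 'I_m -> 'I_(gsize r K).+1}) : {ffun 'I_m -> 'I_(gsize r' K).+1} :=
  [ffun i => inord (s + t i)].
pose h' (t : {ffun 'I_m -> 'I_(gsize r' K).+1}) : {ffun 'I_m -> 'I_(gsize r K).+1} :=
  [ffun i => inord (t i - s)].
have hE t i : h t i = (s + t i)%N :> nat.
  rewrite ffunE inordK// [X in (_ < X)%N]gsizeS//; apply: leq_trans sE.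
  by rewrite ltn_add2l -gsizeS// ltn_ord.
have -> : riemann_sum f r (gsize r K) = (mesh r' (gsize r' K) ^+ m)%:C *:
    \sum_(t | inner t) f (gridpt r' t).
  rewrite (reindex_onto h h') /=; last first.
    move=> t /forallP tin; apply/ffunP => i; apply/val_inj; rewrite /= hE ffunE.
    have /andP[st ts] := tin i.
    by rewrite inordK ?[X in (_ < X)%N]gsizeS// ?subnKC// ltn_subLR.
  rewrite riemann_sumE !mesh_gsize//; congr (_ *: _).
  rewrite [RHS](eq_bigl xpredT) => [|t].
    apply: eq_bigr => t _; congr f; apply/rowP => i; rewrite !mxE hE.
    rewrite !mesh_gsize// natrD natrM natrB//.
    by field; rewrite gt_eqF.
  apply/andP; split.
    apply/forallP => i; rewrite hE leq_addr ltn_add2l -gsizeS//.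
    exact: ltn_ord.
  apply/eqP/ffunP => i; apply/val_inj; rewrite /= ffunE hE addKn.
  by rewrite inordK.
rewrite riemann_sumE -scalerBr (bigID inner)/=.
rewrite [X in _ *: X]addrAC subrr add0r.
rewrite mesh_gsize// nr_realscale ger0_norm ?exprn_ge0 ?invr_ge0//.
rewrite exprVn ler_pdivrMl ?exprn_gt0//; apply: (le_trans (ler_nr_sum _ _ _)).
apply: (@le_trans _ _ (C / (1 + r%:R) * \sum_t wgt (@gridpt R m r' (gsize r' K) t))).
  rewrite mulr_sumr big_mkcond; apply: ler_sum => t _; case: ifP => [tout|_]; last first.
    by rewrite mulr_ge0 ?wgt_ge0 ?divr_ge0 ?(ltW r1).
  set x := gridpt _ _; apply: le_decay_wgt; rewrite ?nr_ge0//.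
  have rx : r%:R <= `|x|.
    have /existsP[i {}tout] : [exists i, ~~ (s <= t i < s + 2 * r * K)%N].
      by rewrite -negb_forall.
    apply: le_trans (rV_norm_coord x i); rewrite mxE mesh_gsize//.
    have [ts|st] := ltnP (t i) s.
      have : (t i)%:R <= (r'%:R - r%:R) * K%:R :> R.
        by rewrite -natrB// -natrM ler_nat ltnW.
      rewrite -ler_pdivrMr// mulrC => H; rewrite ler0_norm; last first.
        have : 0 <= r%:R :> R by []; lra.
      by lra.
    have : (r'%:R + r%:R) * K%:R <= (t i)%:R :> R.
      rewrite -natrD -natrM ler_nat; move: tout; rewrite st /= -leqNgt.
      apply: leq_trans; rewrite -mulnDl leq_mul2r; apply/orP; right; lia.
    rewrite -ler_pdivlMr// [_ / _]mulrC => H.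
    by rewrite ger0_norm; have : 0 <= r%:R :> R by []; lra.
  rewrite ler_pdivlMr// -mulrA [nr _ * _]mulrC mulrA.
  apply: le_trans (fC x); rewrite exprSr ler_wpM2r ?nr_ge0//.
  by rewrite ler_wpM2l ?exprn_ge0 ?addr_ge0// lerD2l.
have : 0 <= C / (1 + r%:R) by rewrite divr_ge0// ltW.
set c := C / _ => c0.
by rewrite mulrA -exprMn [_ ^+ m * _]mulrC [K%:R * _]mulrC ler_wpM2l ?sum_wgt.
Qed.

End GridEstimates.

(** * Improper integrals and integrals of derivatives *)

Section MeanValue.
Context {R : realType} {V : normedModType R[i]}.

(** A vector-valued function need not have a mean value point. With a slack e in the slope, the set
    S of points up to which the bound holds contains its supremum, and the derivative there carries
    the bound a little further unless the supremum is b. *)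
Lemma mean_value_le (f f' : R -> V) (a b M : R) : a <= b ->
  (forall t, a <= t <= b ->
    (fun h => (h^-1)%:C *: (f (t + h) - f t)) @ 0^' --> f' t) ->
  (forall t, a <= t <= b -> nr (f' t) <= M) ->
  nr (f b - f a) <= M * (b - a).
Proof.
move=> ab df f'M.
suff H e : 0 < e -> nr (f b - f a) <= (M + e) * (b - a).
  apply/ler_addgt0Pr => e e0; have ba : 0 < b - a + 1 by rewrite ltr_wpDl ?subr_ge0.
  have := H _ (divr_gt0 e0 ba); rewrite mulrDl => /le_trans; apply; rewrite lerD2l.
  by rewrite mulrAC ler_pdivrMr// ler_wpM2l ?(ltW e0)// lerDl.
move=> e0; have Me0 : 0 < M + e.
  by rewrite ltr_wpDl// (le_trans (nr_ge0 (f' a)))// f'M// lexx.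
have loc t : a <= t <= b -> exists2 d, 0 < d &
    forall y, `|y - t| < d -> nr (f y - f t) <= (M + e) * `|y - t|.
  move=> tab; move/cvg_nrP: (df t tab) => /(_ _ e0)[d /= d0 dP].
  exists d => // y yt; have [->|yNt] := eqVneq y t.
    by rewrite !subrr nr0 normr0 mulr0.
  have h0 : y - t != 0 by rewrite subr_eq0.
  have := dP (y - t); rewrite /= sub0r normrN => /(_ yt h0).
  rewrite [t + _]addrC subrK => H.
  have hn : 0 < `|y - t| by rewrite normr_gt0.
  rewrite -ler_pdivrMr//.
  have -> : nr (f y - f t) / `|y - t| = nr (((y - t)^-1)%:C *: (f y - f t)).
    by rewrite nr_realscale normfV mulrC.
  by have := ler_nr_dist (((y - t)^-1)%:C *: (f y - f t)) (f' t); have := f'M t tab; lra.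
pose S : set R := [set t | a <= t <= b /\ nr (f t - f a) <= (M + e) * (t - a)].
have Sa : S a by split; rewrite ?lexx// !subrr nr0 mulr0.
have hS : has_sup S by split; [exists a | exists b => t [/andP[]]].
pose c := sup S.
have ac : a <= c by apply: ub_le_sup => //; case: hS.
have cb : c <= b by apply: ge_sup; [exists a | move=> t [/andP[]]].
have acb : a <= c <= b by rewrite ac.
have [d d0 dP] := loc c acb.
have Sc : nr (f c - f a) <= (M + e) * (c - a).
  have [s Ss] := sup_adherent d0 hS; rewrite -/c => cs.
  have sc : s <= c by apply: ub_le_sup => //; case: hS.
  have := dP s; rewrite distrC ger0_norm ?subr_ge0// => /(_ _)/wrap[|H]; first lra.
  have [_ fs] := Ss; have := ler_nrBD (f s) (f c) (f a); rewrite (nrB (f c) (f s)).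
  by move: fs H; rewrite !mulrBr; lra.
have [->//|cNb] := eqVneq b c.
have cltb : c < b by rewrite lt_neqAle eq_sym cNb.
pose y := Num.min b (c + d / 2).
have cy : c < y by rewrite lt_min cltb ltrDl divr_gt0.
have yb : y <= b by rewrite ge_min lexx.
have yd : y <= c + d / 2 by rewrite ge_min lexx orbT.
suff Sy : S y.
  have yc : y <= c by apply: ub_le_sup => //; case: hS.
  by move: cy; rewrite ltNge yc.
split; first by rewrite yb andbT; lra.
have := dP y; rewrite gtr0_norm ?subr_gt0// => /(_ _)/wrap[|H]; first lra.
have := ler_nrBD (f c) (f y) (f a); move: Sc H; rewrite !mulrBr; lra.
Qed.

Context {m : nat}.
Implicit Types (g : 'rV[R]_m -> V).

(** The mean value inequality for s |-> g(x + s e_i) - s g'(x), whose derivative is the oscillation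
    of g' along the segment. *)
Lemma partial_diff_le (i : 'I_m) g g' (x : 'rV[R]_m) (t e : R) : 0 <= t ->
  (forall y, diff_quotient i g y @ 0^' --> g' y) ->
  (forall s, 0 <= s <= t -> nr (g' (x + s *: delta_mx 0 i) - g' x) <= e) ->
  nr (g (x + t *: delta_mx 0 i) - g x - t%:C *: g' x) <= e * t.
Proof.
move=> t0 dg g'e.
pose f (s : R) : V := g (x + s *: delta_mx 0 i) - s%:C *: g' x.
have := @mean_value_le f (fun s => g' (x + s *: delta_mx 0 i) - g' x) 0 t e t0.
rewrite /f scale0r addr0 scale0r !subr0 addrAC; apply=> // s _.
have := dg (x + s *: delta_mx 0 i).
have cst : (fun=> g' x) @ (0^' : set_system R) --> g' x by exact: cvg_cst.
move=> /cvgB/(_ cst); apply: cvg_trans; apply: near_eq_cvg.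
near=> h; have h0 : h != 0 by near: h; exact: nbhs_dnbhs_neq.
have -> : g (x + (s + h) *: delta_mx 0 i) - (s + h)%:C *: g' x -
    (g (x + s *: delta_mx 0 i) - s%:C *: g' x) =
    g (x + (s + h) *: delta_mx 0 i) - g (x + s *: delta_mx 0 i) - h%:C *: g' x.
  have -> : (s + h)%:C *: g' x = s%:C *: g' x + h%:C *: g' x.
    by rewrite -scalerDl -rmorphD.
  rewrite opprB opprD [- _ - _]addrC -addrA subrKA addrA.
  by rewrite addrAC.
rewrite [RHS]scalerBr scalerA -rmorphM mulVf// scale1r.
by rewrite scalerDl [x + (_ + _)]addrA.
Unshelve. all: by end_near. Qed.

End MeanValue.

(* The exponent is chosen so that [f] is dominated by the summable product
   weight [wgt], with two powers to spare for the decay at infinity. *)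
Definition tame {R : realType} {V : normedModType R[i]} {m : nat}
    (f : 'rV[R]_m -> V) : Prop :=
  continuous f /\ exists2 C : R, 0 <= C &
    forall x, (1 + `|x|) ^+ (2 * m).+2 * nr (f x) <= C.

Lemma tame_decay {R : realType} {V : normedModType R[i]} {m : nat}
    (f : 'rV[R]_m -> V) (C : R) p : (p <= (2 * m).+2)%N ->
  (forall x, (1 + `|x|) ^+ (2 * m).+2 * nr (f x) <= C) ->
  forall x, (1 + `|x|) ^+ p * nr (f x) <= C.
Proof.
move=> pm fC x; apply: le_trans (fC x); rewrite ler_wpM2r ?nr_ge0//.
by rewrite ler_weXn2l// lerDl.
Qed.

Lemma tameD {R : realType} {V : normedModType R[i]} {m : nat}
    (f g : 'rV[R]_m -> V) : tame f -> tame g -> tame (fun x => f x + g x).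
Proof.
move=> [cf [C C0 fC]] [cg [D D0 gD]]; split.
  by move=> x; exact: (cvgD (cf x) (cg x)).
exists (C + D) => [|x]; first exact: addr_ge0.
apply: le_trans (lerD (fC x) (gD x)); rewrite -mulrDr ler_wpM2l ?ler_nrD//.
by rewrite exprn_ge0// addr_ge0.
Qed.

Lemma tame_blin {R : realType} {V W : normedModType R[i]} {m : nat}
    (L : V -> W) (f : 'rV[R]_m -> V) :
  bounded_linear L -> tame f -> tame (fun x => L (f x)).
Proof.
move=> hL [cf [C C0 fC]]; split.
  by move=> x; exact: (blin_cvg hL (cf x)).
have [_ _ [D D0 LD]] := hL.
exists (D * C) => [|x]; first exact: mulr_ge0.
apply: le_trans (_ : D * ((1 + `|x|) ^+ (2 * m).+2 * nr (f x)) <= _); last first.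
  by rewrite ler_wpM2l.
by rewrite mulrCA ler_wpM2l// exprn_ge0// addr_ge0.
Qed.

Lemma tame0 {R : realType} {V : normedModType R[i]} {m : nat} :
  tame (fun _ : 'rV[R]_m => 0 : V).
Proof. by split; [exact: cst_continuous | exists 0 => // x; rewrite nr0 mulr0]. Qed.

Lemma tame_sum {R : realType} {V : normedModType R[i]} {m : nat} (I : Type)
    (s : seq I) (F : I -> 'rV[R]_m -> V) :
  (forall t, tame (F t)) -> tame (fun x => \sum_(t <- s) F t x).
Proof.
move=> tF; elim: s => [|t s IH].
  by under eq_fun do rewrite big_nil; exact: tame0.
by under eq_fun do rewrite big_cons; apply: tameD.
Qed.

(** * Convergence and linearity of the improper integral *)

Section ImproperIntegral.
Context {R : realType} {V : completeNormedModType R[i]} {m : nat}.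
Implicit Types f g : 'rV[R]_m -> V.

Definition box_integral f r : V := lim (riemann_sum f r @ \oo).

Lemma box_integral_cvg f r : tame f ->
  riemann_sum f r @ \oo --> box_integral f r.
Proof. by move=> [cf _]; exact: riemann_sum_cvg. Qed.

Lemma leq_gsize r K : (0 < r)%N -> (K <= gsize r K.+1)%N.
Proof.
by move=> r0; rewrite -ltnS gsizeS// leq_pmull// muln_gt0.
Qed.

(** Restricts the limit to the grids of mesh 1/K, those for which sums over different boxes can be
    compared. *)
Lemma box_integral_approx f r (e : R) : tame f -> (0 < r)%N -> 0 < e ->
  exists K0, forall K, (K0 < K)%N ->
    nr (riemann_sum f r (gsize r K) - box_integral f r) < e.
Proof.
move=> tf r0 e0; have [N NP] := (cvgn_nrP _ _).1 (box_integral_cvg (r := r) tf) _ e0.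
exists N => -[//|K] NK; apply: NP.
by apply: leq_trans (leq_gsize K r0).
Qed.

Lemma nr_box_integral f r (C : R) : tame f -> (0 < r)%N -> 0 <= C ->
  (forall x, (1 + `|x|) ^+ (2 * m) * nr (f x) <= C) ->
  nr (box_integral f r) <= 4 ^+ m * C.
Proof.
move=> tf r0 C0 fC; apply/ler_addgt0Pr => e e0.
have [K0 K0P] := box_integral_approx tf r0 e0.
have := K0P _ (ltnSn K0); have := le_nr_riemann_sum C0 r0 (ltn0Sn K0) fC.
have := ler_nr_dist (box_integral f r) (riemann_sum f r (gsize r K0.+1)).
by rewrite nrB; lra.
Qed.

Lemma nr_box_integralB f r r' (C : R) : tame f -> (0 < r)%N -> (r <= r')%N ->
  0 <= C -> (forall x, (1 + `|x|) ^+ (2 * m).+1 * nr (f x) <= C) ->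
  nr (box_integral f r' - box_integral f r) <= 4 ^+ m * (C / (1 + r%:R)).
Proof.
move=> tf r0 rr' C0 fC; apply/ler_addgt0Pr => e e0.
have e2 : 0 < e / 2 by rewrite divr_gt0.
have [K0 K0P] := box_integral_approx tf r0 e2.
have [K1 K1P] := box_integral_approx tf (leq_trans r0 rr') e2.
pose K := (maxn K0 K1).+1.
have := K0P K; rewrite ltnS leq_maxl => /(_ erefl).
have := K1P K; rewrite ltnS leq_maxr => /(_ erefl).
have := nr_riemann_sumB C0 r0 rr' (ltn0Sn _ : (0 < K)%N) fC.
set S := riemann_sum f r _; set S' := riemann_sum f r' _.
have := ler_nrBD S' (box_integral f r') (box_integral f r).
have := ler_nrBD S S' (box_integral f r).
by rewrite (nrB (box_integral f r') S'); lra.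
Qed.

Lemma div1n_lt (c e : R) : 0 <= c -> 0 < e ->
  exists N, forall n, (N <= n)%N -> c / (1 + n%:R) < e.
Proof.
move=> c0 e0; exists (Num.bound (c / e)) => n Nn.
have n1 : 0 < 1 + n%:R :> R by rewrite ltr_pwDl.
rewrite ltr_pdivrMr// mulrC -ltr_pdivrMr//.
have ce0 : 0 <= c / e by rewrite divr_ge0// ltW.
apply: (lt_le_trans (archi_boundP ce0)).
by apply: (@le_trans _ _ n%:R); rewrite ?ler_nat// lerDr.
Qed.

(** Enlarging a box of side 2r changes the integral by a multiple of 1/(1+r), so the box integrals
    form a Cauchy sequence and the outer [lim] is a genuine limit. *)
Lemma integral_cvg f : tame f -> box_integral f @ \oo --> integral f.
Proof.
move=> tf; have [_ [C C0 fC]] := tf; apply: cauchyn_cvg => e e0.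
have e2 : 0 < e / 2 by rewrite divr_gt0.
have C'0 : 0 <= 4 ^+ m * C by rewrite mulr_ge0// exprn_ge0.
have [N NP] := div1n_lt C'0 e2.
have H p : (N < p)%N -> nr (box_integral f p - box_integral f N.+1) < e / 2.
  move=> Np; apply: le_lt_trans (NP _ (leqnSn N)); rewrite -mulrA.
  apply: nr_box_integralB => //; exact: (tame_decay _ fC).
exists N.+1 => p q /H Np /H Nq.
have := ler_nrBD (box_integral f N.+1) (box_integral f p) (box_integral f q).
by rewrite (nrB (box_integral f N.+1)); lra.
Qed.

Lemma nr_integral_le f (C : R) : tame f -> 0 <= C ->
  (forall x, (1 + `|x|) ^+ (2 * m) * nr (f x) <= C) ->
  nr (integral f) <= 4 ^+ m * C.
Proof.
move=> tf C0 fC; apply: (nr_cvg_le (integral_cvg tf)).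
by exists 1 => // r r0; exact: nr_box_integral.
Qed.

Lemma riemann_sumD f g r N :
  riemann_sum (fun x => f x + g x) r N = riemann_sum f r N + riemann_sum g r N.
Proof. by rewrite !riemann_sumE -scalerDr -big_split. Qed.

Lemma integralD f g : tame f -> tame g ->
  integral (fun x => f x + g x) = integral f + integral g.
Proof.
move=> tf tg; apply: (nr_cvg_unique (integral_cvg (tameD tf tg))).
have -> : box_integral (fun x => f x + g x) =
    fun r => box_integral f r + box_integral g r.
  apply/funext => r; apply: (nr_cvg_unique (box_integral_cvg (r := r) (tameD tf tg))).
  rewrite (_ : riemann_sum _ r = fun N => riemann_sum f r N + riemann_sum g r N).
    by apply: cvgD; exact: box_integral_cvg.
  by apply/funext => N; exact: riemann_sumD.
by apply: cvgD; exact: integral_cvg.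
Qed.

Lemma integral0 : integral (fun _ : 'rV[R]_m => 0 : V) = 0.
Proof.
apply: (nr_cvg_unique (integral_cvg tame0)).
have -> : box_integral (fun=> 0) = fun=> 0.
  apply/funext => r; apply: (nr_cvg_unique (box_integral_cvg (r := r) tame0)).
  rewrite (_ : riemann_sum _ r = fun=> 0); first exact: cvg_cst.
  by apply/funext => N; rewrite riemann_sumE big1 ?scaler0.
exact: cvg_cst.
Qed.

Lemma integral_sum (I : Type) (s : seq I) (F : I -> 'rV[R]_m -> V) :
  (forall t, tame (F t)) ->
  integral (fun x => \sum_(t <- s) F t x) = \sum_(t <- s) integral (F t).
Proof.
move=> tF; elim: s => [|t s IH].
  rewrite big_nil -[RHS]integral0; congr integral.
  by apply/funext => x; rewrite big_nil.
rewrite big_cons -IH -integralD//; last exact: tame_sum.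
by congr integral; apply/funext => x; rewrite big_cons.
Qed.

End ImproperIntegral.

Lemma integral_blin {R : realType} {V W : completeNormedModType R[i]} {m : nat}
    (L : V -> W) (f : 'rV[R]_m -> V) : bounded_linear L -> tame f ->
  integral (fun x => L (f x)) = L (integral f).
Proof.
move=> hL tf; have tLf := tame_blin hL tf.
apply: (nr_cvg_unique (integral_cvg tLf)).
have -> : box_integral (fun x => L (f x)) = fun r => L (box_integral f r).
  apply/funext => r; apply: (nr_cvg_unique (box_integral_cvg (r := r) tLf)).
  rewrite (_ : riemann_sum _ r = fun N => L (riemann_sum f r N)).
    by apply: (blin_cvg hL); exact: box_integral_cvg.
  by apply/funext => N; rewrite !riemann_sumE (blinZ hL) (blin_sum hL).
by apply: (blin_cvg hL); exact: integral_cvg.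
Qed.

(** * Telescoping sums along a coordinate *)

Section IntegralOfDerivative.
Context {R : realType} {V : completeNormedModType R[i]} {m : nat}.
Variables (i : 'I_m) (g : 'rV[R]_m -> V) (C : R).
Hypothesis C0 : 0 <= C.
Hypothesis gC : forall x, (1 + `|x|) ^+ (2 * m).+1 * nr (g x) <= C.
Variables (r K : nat).
Hypotheses (r0 : (0 < r)%N) (K0 : (0 < K)%N).

Local Notation N := (gsize r K).
Local Notation step := (K%:R^-1 *: delta_mx 0 i : 'rV[R]_m).

(* The cyclic shift of the [i]-th index makes the sum of the increments of [g]
   collapse to the boundary face [t i = ord_max]. *)
Let shift (t : {ffun 'I_m -> 'I_N.+1}) : {ffun 'I_m -> 'I_N.+1} :=
  [ffun j => if j == i then ordS (t j) else t j].

Let shift_inj : injective shift.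
Proof.
move=> s t /ffunP st; apply/ffunP => j; have := st j; rewrite !ffunE.
by case: ifP => _ // /ordS_inj.
Qed.

Let Kp : 0 < K%:R :> R. Proof. by rewrite ltr0n. Qed.

Let pt (t : {ffun 'I_m -> 'I_N.+1}) : 'rV[R]_m := gridpt r t.

Let pt_shift (t : {ffun 'I_m -> 'I_N.+1}) : t i != ord_max -> pt (shift t) = pt t + step.
Proof.
move=> ti; apply/rowP => j; rewrite !mxE ffunE eqxx mesh_gsize//=.
case: eqVneq => [->|_]; last by rewrite mulr0 addr0.
have tN : ((t i).+1 < N.+1)%N.
  rewrite ltn_neqAle ltn_ord andbT; apply: contra ti => /eqP ti.
  by apply/eqP/val_inj; case: ti.
by rewrite /= modn_small// mulr1 -natr1 mulrDr mulr1 addrAC.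
Qed.

(** At both ends of a grid line the i-th coordinate has absolute value r, the largest possible on
    the grid, so the weight of x is at most that of [pt t]; the spare power of decay gives
    1/(1+r). *)
Let face_le (t : {ffun 'I_m -> 'I_N.+1}) (x : 'rV[R]_m) :
  t i = ord_max -> `|x 0 i| = r%:R -> (forall j, j != i -> x 0 j = pt t 0 j) ->
  nr (g x) <= C / (1 + r%:R) * wgt (pt t).
Proof.
move=> ti xi xj; have r1 : 0 < 1 + r%:R :> R by rewrite ltr_pwDl.
have Cr0 : 0 <= C / (1 + r%:R) by rewrite divr_ge0// ltW.
apply: (@le_trans _ _ (C / (1 + r%:R) * wgt x)).
  apply: le_decay_wgt; rewrite ?nr_ge0// ler_pdivlMr//.
  apply: le_trans (gC x); rewrite exprSr mulrAC ler_wpM2r ?nr_ge0//.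
  by rewrite ler_wpM2l ?exprn_ge0 ?addr_ge0// lerD2l -xi rV_norm_coord.
rewrite ler_wpM2l//; apply: ler_prod => j _; rewrite ltW ?wgt1_gt0//=.
apply: le_wgt1; have [->|ji] := eqVneq j i; last by rewrite xj.
by rewrite xi (le_trans (rV_norm_coord _ _))// gridpt_norm.
Qed.

(** After the shift of the second sum all terms vanish except where the shift wraps around. There
    the difference is that of g at the two ends of a grid line. *)
Lemma nr_sum_shift :
  nr (\sum_t (g (pt t + step) - g (pt t))) <=
  2 * (C / (1 + r%:R)) * (4 * K%:R) ^+ m.-1.
Proof.
have r1 : 0 < 1 + r%:R :> R by rewrite ltr_pwDl.
have Cr0 : 0 <= C / (1 + r%:R) by rewrite divr_ge0// ltW.
rewrite sumrB [X in _ - X](reindex_inj shift_inj) -sumrB /=.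
apply: (le_trans (ler_nr_sum _ _ _)).
apply: (@le_trans _ _ (\sum_(t : {ffun 'I_m -> 'I_N.+1} | t i == ord_max)
    2 * (C / (1 + r%:R)) * wgt (pt t))); last first.
  by rewrite -mulr_sumr; apply: ler_wpM2l; [exact: mulr_ge0|exact: sum_wgt_face].
rewrite [leRHS]big_mkcond; apply: ler_sum => t _.
case: ifPn => [/eqP ti|ti]; last by rewrite pt_shift// subrr nr0.
apply: (le_trans (ler_nrB _ _)); rewrite -mulrA mulr_natl mulr2n.
have tN : (t i)%:R + 1 = 2 * r%:R * K%:R :> R.
  by rewrite natr1 ti -!natrM -gsizeS.
apply: lerD; apply: face_le => //.
- rewrite !mxE !eqxx mesh_gsize//= mulr1.
  have -> : K%:R^-1 * (t i)%:R - r%:R + K%:R^-1 = r%:R :> R.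
    have -> : (t i)%:R = 2 * r%:R * K%:R - 1 :> R by rewrite -tN addrK.
    by field; rewrite gt_eqF.
  by rewrite ger0_norm.
- by move=> j ji; rewrite !mxE (negPf ji) mulr0 addr0.
- rewrite !mxE ffunE eqxx ti /= modnn mulr0 sub0r normrN ger0_norm//.
- by move=> j ji; rewrite !mxE ffunE (negPf ji).
Qed.

End IntegralOfDerivative.

(** In the Riemann sum of g' with mesh 1/K, g' is replaced by the difference quotient of g with
    increment 1/K. The quotients telescope to boundary terms of size 1/(1+r), uniformly in K, and
    uniform continuity of g' controls the error on each box; then r tends to infinity. *)
Lemma integral_partial {R : realType} {V : completeNormedModType R[i]} {m : nat}
    (i : 'I_m) (g g' : 'rV[R]_m -> V) : tame g -> tame g' ->
  (forall y, diff_quotient i g y @ 0^' --> g' y) -> integral g' = 0.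
Proof.
move=> tg tg' dg; have [_ [C C0 gC]] := tg.
have box r : (0 < r)%N ->
    nr (box_integral g' r) <= 2 * 4 ^+ m.-1 * C / (1 + r%:R).
  move=> r0; apply/ler_addgt0Pr => e e0; have e2 : 0 < e / 2 by rewrite divr_gt0.
  have [K0 K0P] := box_integral_approx tg' r0 e2.
  pose c : R := (2 * r%:R) ^+ m + 1.
  have c0 : 0 < c by rewrite ltr_wpDl// exprn_ge0// mulr_ge0.
  have e' : 0 < e / 2 / c by rewrite !divr_gt0.
  have [d d0 dP] := uniform_continuity r%:R tg'.1 e'.
  pose K := (maxn K0 (Num.bound d^-1)).+1.
  have Kp : 0 < K%:R :> R by rewrite ltr0n.
  have Kd : K%:R^-1 < d.
    rewrite -[ltRHS]invrK ltf_pV2 ?posrE ?invr_gt0//.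
    have d'0 : 0 <= d^-1 by rewrite invr_ge0 ltW.
    apply: (lt_le_trans (archi_boundP d'0)).
    by rewrite ler_nat leqW// leq_maxr.
  have := K0P K; rewrite ltnS leq_maxl => /(_ erefl).
  have := ler_nr_dist (box_integral g' r) (riemann_sum g' r (gsize r K)).
  rewrite nrB.
  suff : nr (riemann_sum g' r (gsize r K)) <=
    2 * 4 ^+ m.-1 * C / (1 + r%:R) + e / 2 by lra.
  set N := gsize r K; set step : 'rV[R]_m := K%:R^-1 *: delta_mx 0 i.
  have m0 : (0 < m)%N by apply: leq_ltn_trans (ltn_ord i).
  have -> : riemann_sum g' r N =
      (K%:R * K%:R^-1 ^+ m)%:C *: \sum_(t : {ffun 'I_m -> 'I_N.+1})
        (g (gridpt r t + step) - g (gridpt r t)) -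
      riemann_sum (fun x => K%:R%:C *: (g (x + step) - g x - K%:R^-1%:C *: g' x)) r N.
    rewrite !riemann_sumE mesh_gsize// -scaler_sumr.
    have -> : (K%:R * K%:R^-1 ^+ m)%:C = (K%:R^-1 ^+ m)%:C * K%:R%:C :> R[i].
      by rewrite mulrC rmorphM.
    rewrite -scalerA -scalerBr -scalerBr -sumrB; congr (_ *: _).
    rewrite scaler_sumr; apply: eq_bigr => t _.
    rewrite opprB [X in _ *: X]addrC subrK scalerA -rmorphM divff ?scale1r//.
    by rewrite gt_eqF.
  apply: (le_trans (ler_nrB _ _)); apply: lerD.
    rewrite nr_realscale ger0_norm ?mulr_ge0 ?exprn_ge0 ?invr_ge0//.
    apply: (le_trans (ler_wpM2l _ (nr_sum_shift i C0 _ r0 _))) => //.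
    - by rewrite mulr_ge0 ?exprn_ge0 ?invr_ge0.
    - exact: (tame_decay _ gC).
    (* The K of the difference quotients, the volume K^-m of a cell and the factor K^(m-1) from the
       face cancel. *)
    - rewrite exprMn -{1}(prednK m0) exprS mulrA mulfV ?gt_eqF// mul1r.
      have -> : K%:R^-1 ^+ m.-1 * (2 * (C / (1 + r%:R)) * (4 ^+ m.-1 * K%:R ^+ m.-1)) =
        2 * 4 ^+ m.-1 * C / (1 + r%:R) * (K%:R^-1 * K%:R) ^+ m.-1 :> R.
        by rewrite exprMn; ring.
      by rewrite mulVf ?gt_eqF// expr1n mulr1.
  apply: (@le_trans _ _ ((2 * r%:R) ^+ m * (e / 2 / c))); last first.
    have : e / 2 / c * c = e / 2 by rewrite divfK// gt_eqF.
    by rewrite mulrDr mulr1 mulrC; lra.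
  apply: riemann_sum_bound => t; rewrite nr_realscale ger0_norm//.
  rewrite mulrC -ler_pdivlMr//; apply: partial_diff_le => //.
    by rewrite invr_ge0.
  move=> s /andP[s0 sK]; rewrite nrB; apply/ltW/dP; first exact: gridpt_norm.
  rewrite opprD addrA subrr add0r normrN normrZ ger0_norm//.
  apply: le_lt_trans Kd; apply: le_trans sK; rewrite ler_piMr//.
  rewrite rV_norm_le//; apply/forallP => j; rewrite mxE eqxx /=.
  by case: eqP; rewrite ?normr1 ?normr0.
apply: closeness_eq => e e0; rewrite subr0.
have c0 : 0 <= 2 * 4 ^+ m.-1 * C by rewrite !mulr_ge0// exprn_ge0.
have [N NP] := div1n_lt c0 e0.
apply: (nr_cvg_le (integral_cvg tg')).
exists N.+1 => // r Nr; apply: le_trans (box _ _) _; first exact: leq_trans Nr.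
exact/ltW/NP/ltnW.
Qed.

(** * Fourier transforms of Schwartz functions *)

Lemma cvg_congr {T : Type} {W : topologicalType} {F : set_system T}
    (f g : T -> W) (l : W) : f =1 g -> f @ F --> l -> g @ F --> l.
Proof. by move=> /funext->. Qed.

Section Expi.
Context {R : realType}.
Local Notation C := (R[i]^o : normedModType R[i]).

Lemma nr_real_complex (a : R) : nr (a%:C : C) = `|a|.
Proof. by rewrite /nr normc_def /= expr0n addr0 sqrtr_sqr. Qed.

Lemma cvg_real_complex {T : Type} {F : set_system T} {FF : Filter F}
    (f : T -> R) (a : R) :
  f @ F --> a -> (fun t => (f t)%:C : C) @ F --> (a%:C : C).
Proof.
move=> /cvgrPdist_lt fa; apply/cvg_nrP => e /fa; apply: filterS => t.
by rewrite -rmorphB nr_real_complex distrC.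
Qed.

Lemma expiE (t : R) : expi t = (cos t)%:C + 'i * (sin t)%:C :> R[i].
Proof. by rewrite /expi -complexiE; simpc. Qed.

Lemma cvg_expi {T : Type} {F : set_system T} {FF : Filter F} (f g : T -> R) (a b : R) :
  f @ F --> a -> g @ F --> b ->
  (fun t => (f t)%:C + 'i * (g t)%:C : C) @ F --> (a%:C + 'i * b%:C : C).
Proof.
move=> fa gb; apply: cvgD; first exact: cvg_real_complex.
exact: (cvgZ (V := C) (cvg_cst _) (cvg_real_complex gb)).
Qed.

(** The chain rule for h |-> f(p + h q), taken from the directional derivative so that q = 0 is
    covered. *)
Lemma dirderive_cvg (f : R -> R) (p q d : R) : is_derive p 1 f d ->
  (fun h => h^-1 * (f (p + h * q) - f p)) @ 0^' --> q * d.
Proof.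
move=> fd; have df : differentiable f p by apply/derivable1_diffP; exact: ex_derive.
have <- : 'D_q f p = q * d.
  have dE v : 'd f p v = 'D_v f p by rewrite deriveE.
  rewrite -dE -[q in LHS]mulr1 -[q * 1]/(q *: (1 : R)) linearZ /= dE.
  by rewrite derive_val.
have := diff_derivable df : derivable f p q.
rewrite /derivable => /cvg_ex[l fl]; rewrite /derive (cvg_lim _ fl)//.
by apply: cvg_congr fl => h /=; rewrite [_ + p]addrC.
Qed.

Lemma expi_diff_cvg (p q : R) :
  (fun h => (h^-1)%:C *: (expi (p + h * q) - expi p) : C) @ 0^' -->
  ('i * q%:C * expi p : C).
Proof.
have -> : 'i * q%:C * expi p =
    (q * - sin p)%:C + 'i * (q * cos p)%:C :> R[i].
  have ii : 'i * 'i = -1 :> R[i] by rewrite -expr2 sqrCi.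
  rewrite expiE !rmorphM rmorphN mulrDr /=.
  have -> : 'i * q%:C * ('i * (sin p)%:C) = ('i * 'i) * q%:C * (sin p)%:C :> R[i].
    by ring.
  by rewrite ii; ring.
apply: cvg_congr (cvg_expi (dirderive_cvg (q := q) (is_derive_cos p))
  (dirderive_cvg (q := q) (is_derive_sin p))) => h.
rewrite !expiE !rmorphM !rmorphB /= -[RHS]/((h^-1)%:C * _); ring.
Qed.

Lemma expi_lipschitz (a b : R) : nr (expi a - expi b : C) <= `|a - b|.
Proof.
wlog ba : a b / b <= a => [H|].
  case/orP: (le_total b a) => /H//; by rewrite nrB distrC.
have := @mean_value_le R C (fun t => expi t : C) (fun t => 'i * expi t) b a 1 ba.
rewrite mul1r ger0_norm ?subr_ge0//; apply=> t _.
  have := expi_diff_cvg (p := t) (q := 1); rewrite mulr1.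
  by apply: cvg_congr => h; rewrite mulr1.
rewrite /nr normrM normCi mul1r -[expi t]mulr1 -[_ * _]/(expi t *: (1 : C)).
by have := nr_expi t (1 : C); rewrite /nr normr1 /= => ->.
Qed.

End Expi.

(** 1 + x is at most 2 when x <= 1 and at most 2x otherwise. This turns decay against |x|^p into
    decay against (1 + |x|)^p. *)
Lemma le_expr1D {R : realType} (x : R) p : 0 <= x ->
  (1 + x) ^+ p <= 2 ^+ p * (1 + x ^+ p).
Proof.
move=> x0; have [x1|/ltW x1] := leP x 1.
  apply: (@le_trans _ _ (2 ^+ p)).
    by rewrite lerXn2r ?nnegrE ?addr_ge0// -[2]/(1 + 1) lerD2l.
  by rewrite ler_peMr ?exprn_ge0// lerDl exprn_ge0.
apply: (@le_trans _ _ (2 ^+ p * x ^+ p)).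
  by rewrite -exprMn lerXn2r ?nnegrE ?addr_ge0 ?mulr_ge0// mulr_natl mulr2n lerD2r.
by rewrite ler_wpM2l ?exprn_ge0// lerDr.
Qed.

(** * Calculus of smooth, Schwartz and bounded smooth functions *)

Section SmoothTheory.
Context {R : realType} {V : normedModType R[i]} {m : nat}.
Implicit Types f g : 'rV[R]_m -> V.

Lemma pderives_cvg f s i x : smooth f ->
  diff_quotient i (pderives s f) x @ 0^' --> pderives (i :: s) f x.
Proof. by move=> /(_ s)[_ /(_ i x)]. Qed.

Lemma pderives_rcons f s i : pderives s (pderive i f) = pderives (rcons s i) f.
Proof. by rewrite /pderives foldr_rcons. Qed.

Lemma smooth_pderive f i : smooth f -> smooth (pderive i f).
Proof. by move=> sf s; rewrite pderives_rcons; exact: sf. Qed.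

Lemma smooth_continuous f : smooth f -> continuous f.
Proof. by move=> /(_ [::])[]. Qed.

(** Smoothness and the values of the derivatives are established together: [pderives] is an iterated
    [lim], so each order can be treated only once the previous one is identified. *)
Lemma smooth_by_derivatives f (g : seq 'I_m -> 'rV[R]_m -> V) :
  g [::] = f -> (forall s, continuous (g s)) ->
  (forall s i x, diff_quotient i (g s) x @ 0^' --> g (i :: s) x) ->
  smooth f /\ forall s, pderives s f = g s.
Proof.
move=> g0 cg dg; have E s : pderives s f = g s.
  elim: s => [//|i s IH]; apply/funext => x.
  rewrite [LHS]/= -/(pderives s f) IH /pderive.
  exact: (nr_cvg_unique (cvgP _ (dg s i x)) (dg s i x)).
split=> // s; rewrite E; split=> // i x; exact: cvgP (dg s i x).
Qed.

Lemma smoothD f g : smooth f -> smooth g ->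
  smooth (fun x => f x + g x) /\
  forall s, pderives s (fun x => f x + g x) = fun x => pderives s f x + pderives s g x.
Proof.
move=> sf sg; apply: smooth_by_derivatives => //.
  by move=> s x; exact: (cvgD ((sf s).1 x) ((sg s).1 x)).
move=> s i x; apply: cvg_congr (cvgD (pderives_cvg (s := s) (i := i) (x := x) sf)
  (pderives_cvg (s := s) (i := i) (x := x) sg)).
move=> h.
rewrite -[LHS]/(diff_quotient i (pderives s f) x h + diff_quotient i (pderives s g) x h).
by rewrite /diff_quotient -scalerDr opprD [RHS]/= addrACA.
Qed.

Lemma smooth0 : smooth (fun _ : 'rV[R]_m => 0 : V) /\
  forall s, pderives s (fun _ : 'rV[R]_m => 0 : V) = fun=> 0.
Proof.
apply: smooth_by_derivatives => //; first by move=> s; exact: cst_continuous.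
move=> s i x; apply: (@cvg_congr _ _ _ (fun=> 0)); last exact: cvg_cst.
by move=> h; rewrite /diff_quotient subrr scaler0.
Qed.

Lemma smooth_sum (I : Type) (r : seq I) (F : I -> 'rV[R]_m -> V) :
  (forall t, smooth (F t)) ->
  smooth (fun x => \sum_(t <- r) F t x) /\
  forall s, pderives s (fun x => \sum_(t <- r) F t x) =
            fun x => \sum_(t <- r) pderives s (F t) x.
Proof.
move=> sF; elim: r => [|t r [IH1 IH2]].
  under eq_fun do rewrite big_nil; split=> [|s]; first exact: smooth0.1.
  by rewrite smooth0.2; apply/funext => x; rewrite big_nil.
under eq_fun do rewrite big_cons.
have [H1 H2] := smoothD (sF t) IH1; split=> // s.
by rewrite H2 IH2; apply/funext => x; rewrite big_cons.
Qed.

Lemma schwartz_pderive f i : schwartz f -> schwartz (pderive i f).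
Proof.
move=> [sf fM]; split=> [|s p]; first exact: smooth_pderive.
by rewrite pderives_rcons; exact: fM.
Qed.

Lemma schwartz_pderives f s : schwartz f -> schwartz (pderives s f).
Proof. by move=> sf; elim: s => //= i s IH; exact: schwartz_pderive. Qed.

Lemma schwartzP f : schwartz f <-> smooth f /\ forall s p, exists2 C : R, 0 <= C &
  forall x, (1 + `|x|) ^+ p * nr (pderives s f x) <= C.
Proof.
have coef (a b : R) : (a%:C * b%:C = (a * b)%:C :> R[i]) by rewrite rmorphM.
split=> [[sf fM]|[sf fM]]; split=> // s p; last first.
  have [C C0 fC] := fM s p; exists C => x; rewrite nrE coef lecR.
  apply: le_trans (fC x); rewrite ler_wpM2r ?nr_ge0//.
  by rewrite lerXn2r ?nnegrE ?addr_ge0// lerDr.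
have [M0 fM0] := fM s 0; have [Mp fMp] := fM s p.
exists (2 ^+ p * (`|M0| + `|Mp|)) => [|x].
  by rewrite mulr_ge0 ?exprn_ge0 ?addr_ge0.
have := fM0 x; have := fMp x; rewrite nrE !coef !lecR expr0 mul1r => H1 H0.
have le2 := le_expr1D p (normr_ge0 x).
apply: (le_trans (ler_wpM2r (nr_ge0 _) le2)); rewrite -mulrA ler_wpM2l ?exprn_ge0//.
rewrite mulrDl mul1r; apply: lerD; apply: (le_trans _ (ler_norm _)) => //.
Qed.

Lemma schwartz_decay f p : schwartz f -> exists2 C : R, 0 <= C &
  forall x, (1 + `|x|) ^+ p * nr (f x) <= C.
Proof. by move=> /schwartzP[_ /(_ [::] p)]. Qed.

Lemma schwartz_smooth f : schwartz f -> smooth f. Proof. by case. Qed.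

Lemma schwartz_tame f : schwartz f -> tame f.
Proof.
move=> sf; split; first exact/smooth_continuous/schwartz_smooth.
exact: schwartz_decay.
Qed.

Lemma schwartzD f g : schwartz f -> schwartz g -> schwartz (fun x => f x + g x).
Proof.
move=> /schwartzP[sf fC] /schwartzP[sg gC]; have [sfg dfg] := smoothD sf sg.
apply/schwartzP; split=> // s p; have [C C0 fCx] := fC s p; have [D D0 gDx] := gC s p.
exists (C + D) => [|x]; first exact: addr_ge0.
rewrite dfg; apply: le_trans (lerD (fCx x) (gDx x)).
by rewrite -mulrDr ler_wpM2l ?ler_nrD// exprn_ge0// addr_ge0.
Qed.

Lemma schwartz0 : schwartz (fun _ : 'rV[R]_m => 0 : V).
Proof.
apply/schwartzP; split=> [|s p]; first exact: smooth0.1.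
by exists 0 => // x; rewrite smooth0.2 nr0 mulr0.
Qed.

Lemma schwartz_sum (I : Type) (r : seq I) (F : I -> 'rV[R]_m -> V) :
  (forall t, schwartz (F t)) -> schwartz (fun x => \sum_(t <- r) F t x).
Proof.
move=> sF; elim: r => [|t r IH].
  by under eq_fun do rewrite big_nil; exact: schwartz0.
by under eq_fun do rewrite big_cons; apply: schwartzD.
Qed.

Lemma smooth_boundedP f : smooth_bounded f <-> smooth f /\
  forall s, exists2 C : R, 0 <= C & forall x, nr (pderives s f x) <= C.
Proof.
split=> [[sf fM]|[sf fM]]; split=> // s.
  have [C fC] := fM s; exists `|C| => // x.
  by have := fC x; rewrite nr_le_norm => /le_trans; apply; exact: ler_norm.
by have [C C0 fC] := fM s; exists C => x; rewrite nr_le_norm.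
Qed.

Lemma smooth_bounded0 : smooth_bounded (fun _ : 'rV[R]_m => 0 : V).
Proof.
apply/smooth_boundedP; split=> [|s]; first exact: smooth0.1.
by exists 0 => // x; rewrite smooth0.2 nr0.
Qed.

Lemma smooth_bounded_sum (I : Type) (r : seq I) (F : I -> 'rV[R]_m -> V) :
  (forall t, smooth_bounded (F t)) ->
  smooth_bounded (fun x => \sum_(t <- r) F t x).
Proof.
move=> sF; have sF' t : smooth (F t) by case: (sF t).
apply/smooth_boundedP; have [sm ds] := smooth_sum r sF'; split=> // s.
rewrite ds; elim: r {sm ds} => [|t r [C C0 IH]].
  by exists 0 => // x; rewrite big_nil nr0.
have [D D0 fD] := ((smooth_boundedP _).1 (sF t)).2 s.
exists (D + C) => [|x]; first exact: addr_ge0.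
by rewrite big_cons (le_trans (ler_nrD _ _))// lerD.
Qed.

End SmoothTheory.

Section SmoothBoundedLinear.
Context {R : realType} {V W : normedModType R[i]} {m : nat}.
Variables (L : V -> W) (hL : bounded_linear L).
Implicit Types f : 'rV[R]_m -> V.

Lemma smooth_blin f : smooth f -> smooth (fun x => L (f x)) /\
  forall s, pderives s (fun x => L (f x)) = fun x => L (pderives s f x).
Proof.
move=> sf; apply: smooth_by_derivatives => //.
  by move=> s x; exact: (blin_cvg hL ((sf s).1 x)).
move=> s i x; apply: cvg_congr (blin_cvg hL (pderives_cvg (s := s) (i := i) (x := x) sf)).
by move=> h; rewrite /diff_quotient (blinZ hL) (blinB hL).
Qed.

Lemma schwartz_blin f : schwartz f -> schwartz (fun x => L (f x)).
Proof.
move=> /schwartzP[sf fC]; have [sLf dLf] := smooth_blin sf.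
have [_ _ [D D0 LD]] := hL.
apply/schwartzP; split=> // s p; have [C C0 fCx] := fC s p.
exists (D * C) => [|x]; first exact: mulr_ge0.
rewrite dLf; apply: le_trans (ler_wpM2l D0 (fCx x)).
by rewrite mulrCA ler_wpM2l// exprn_ge0// addr_ge0.
Qed.

Lemma smooth_bounded_blin f : smooth_bounded f -> smooth_bounded (fun x => L (f x)).
Proof.
move=> /smooth_boundedP[sf fC]; have [sLf dLf] := smooth_blin sf.
have [_ _ [D D0 LD]] := hL.
apply/smooth_boundedP; split=> // s; have [C C0 fCx] := fC s.
exists (D * C) => [|x]; first exact: mulr_ge0.
by rewrite dLf; apply: (le_trans (LD _)); rewrite ler_wpM2l.
Qed.

End SmoothBoundedLinear.

Lemma scale_bounded_linear {R : realType} {V : normedModType R[i]} (c : R[i]) :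
  bounded_linear (fun x : V => c *: x).
Proof.
split=> [x y|d x|]; first exact: scalerDr.
  by rewrite !scalerA mulrC.
exists (complex.Re `|c|) => [|x]; last by rewrite nr_scale.
by rewrite -ler0c -normC_ReE.
Qed.

Lemma near_norm_lt {R : realType} {n : nat} (x : 'rV[R]_n) (e : R) : 0 < e ->
  \forall t \near x, `|x - t| < e.
Proof.
by move=> e0; have := nbhsx_ballx x e e0; rewrite -ball_normE.
Qed.

Section Dotp.
Context {R : realType} {n : nat}.
Implicit Types x y z : 'rV[R]_n.

Lemma dotpC x y : dotp x y = dotp y x.
Proof. by apply: eq_bigr => i _; rewrite mulrC. Qed.

Lemma dotpBl x y z : dotp (x - y) z = dotp x z - dotp y z.
Proof. by rewrite /dotp -sumrB; apply: eq_bigr => i _; rewrite !mxE mulrBl. Qed.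

Lemma dotpBr x y z : dotp x (y - z) = dotp x y - dotp x z.
Proof. by rewrite !(dotpC x) dotpBl. Qed.

Lemma dotpDl x y z : dotp (x + y) z = dotp x z + dotp y z.
Proof. by rewrite /dotp -big_split; apply: eq_bigr => i _; rewrite !mxE mulrDl. Qed.

Lemma dotp_delta (h : R) i y : dotp (h *: delta_mx 0 i) y = h * y 0 i.
Proof.
rewrite /dotp (bigD1 i)//= big1 ?addr0 ?mxE ?eqxx ?mulr1// => j ji.
by rewrite !mxE (negPf ji) mulr0 mul0r.
Qed.

Lemma norm_dotp_le x y : `|dotp x y| <= n%:R * `|x| * `|y|.
Proof.
apply: (le_trans (ler_norm_sum _ _ _)).
apply: (@le_trans _ _ (\sum_(i < n) `|x| * `|y|)).
  by apply: ler_sum => i _; rewrite normrM ler_pM ?rV_norm_coord.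
by rewrite sumr_const card_ord -mulrA mulr_natl.
Qed.

Lemma dotp_continuous y : continuous (fun x => dotp x y).
Proof.
move=> x; apply/(@cvgrPdist_lt _ _ _ (nbhs x)) => e e0.
have d0 : 0 < n%:R * `|y| + 1 by rewrite ltr_wpDl// mulr_ge0.
apply: filterS (near_norm_lt x (divr_gt0 e0 d0)).
move=> t; rewrite ltr_pdivlMr// => xt; rewrite -dotpBl.
apply: (le_lt_trans (norm_dotp_le _ _)); apply: le_lt_trans xt.
by rewrite mulrAC mulrC ler_wpM2l// lerDl.
Qed.

End Dotp.

Section Oscillation.
Context {R : realType} {V : normedModType R[i]} {m : nat}.
Implicit Types (u : 'rV[R]_m -> V) (p : 'rV[R]_m -> R).

Lemma nr_expiB (a b : R) (v : V) :
  nr (expi a *: v - expi b *: v) <= `|a - b| * nr v.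
Proof. by rewrite -scalerBl nr_scale ler_wpM2r ?nr_ge0// expi_lipschitz. Qed.

Lemma cvg_expi_comp {T : Type} {F : set_system T} {FF : Filter F} (f : T -> R) (a : R) :
  f @ F --> a -> (fun t => expi (f t) : R[i]^o) @ F --> (expi a : R[i]^o).
Proof.
move=> /cvgrPdist_lt fa; apply/cvg_nrP => e /fa; apply: filterS => t.
by rewrite distrC; apply: le_lt_trans; exact: expi_lipschitz.
Qed.

Lemma tame_osc p u : continuous p -> tame u -> tame (fun x => expi (p x) *: u x).
Proof.
move=> cp [cu [C C0 uC]]; split; last by exists C => // x; rewrite nr_expi.
by move=> x; exact: (cvgZ (cvg_expi_comp (cp x)) (cu x)).
Qed.

(** The product rule, with the exponential taken at the shifted point in one term, so that its
    continuity enters besides its derivative. *)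
Lemma osc_diff_cvg (z : 'rV[R]_m) i u (u' : V) x :
  diff_quotient i u x @ 0^' --> u' ->
  diff_quotient i (fun y => expi (- dotp y z) *: u y) x @ 0^' -->
  expi (- dotp x z) *: u' - ('i * (z 0 i)%:C) *: (expi (- dotp x z) *: u x).
Proof.
move=> uu'.
have H1 : (fun h : R => expi (- dotp x z - h * z 0 i) *: diff_quotient i u x h) @ 0^'
    --> expi (- dotp x z) *: u'.
  apply: cvgZ uu'; apply: cvg_expi_comp; rewrite -[X in _ --> X]subr0.
  apply: cvgB; first exact: cvg_cst.
  have := @cvgM R _ (0^' : set_system R) _ id (fun=> z 0 i) 0 (z 0 i).
  rewrite mul0r; apply; last exact: cvg_cst.
  exact: nbhs_dnbhs.
have H2 : (fun h : R => ((h^-1)%:C * (expi (- dotp x z - h * z 0 i) - expi (- dotp x z)))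
    *: u x) @ 0^' --> ('i * (- z 0 i)%:C * expi (- dotp x z)) *: u x.
  apply: cvgZ; last exact: cvg_cst.
  by apply: cvg_congr (expi_diff_cvg (p := _) (q := _)) => h; rewrite mulrN.
have -> : - (('i * (z 0 i)%:C) *: (expi (- dotp x z) *: u x)) =
    ('i * (- z 0 i)%:C * expi (- dotp x z)) *: u x.
  by rewrite scalerA -scaleNr rmorphN mulrN mulNr.
apply: cvg_congr (cvgD H1 H2) => h.
rewrite -[LHS]/(_ *: diff_quotient i u x h + _ *: u x) /diff_quotient.
rewrite dotpDl dotp_delta opprD scalerA mulrC -!scalerA -scalerDr; congr (_ *: _).
by rewrite scalerBr scalerBl addrA subrK.
Qed.

End Oscillation.

(** * Decay and continuity of the Fourier transform *)

Section Fourier.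
Context {R : realType} {A : cstarAlgType R} {m : nat}.
Implicit Types (u : 'rV[R]_m -> A) (z : 'rV[R]_m).

Lemma opp_dotp_continuous z : continuous (fun y => - dotp y z).
Proof. by move=> y; exact: (cvgN (dotp_continuous (y := z) (x := y))). Qed.

Lemma tame_fourier_integrand z u : tame u -> tame (fun y => expi (- dotp y z) *: u y).
Proof. by apply: tame_osc; exact: opp_dotp_continuous. Qed.

(** Integration by parts: the difference of the two sides is, up to the constant, the integral of
    the i-th derivative of y |-> e^(-iy.z) u(y), which vanishes. *)
Lemma fourier_pderive i u z : schwartz u ->
  fourier (pderive i u) z = ('i * (z 0 i)%:C) *: fourier u z.
Proof.
move=> su; have su' := schwartz_pderive i su.
rewrite /fourier; set k := (_)%:C; rewrite [RHS]scalerA [_ * k]mulrC -scalerA.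
congr (_ *: _); pose f y : A := expi (- dotp y z) *: u y.
pose f' y : A := expi (- dotp y z) *: pderive i u y.
have tf : tame f by apply/tame_fourier_integrand/schwartz_tame.
have tf' : tame f' by apply/tame_fourier_integrand/schwartz_tame.
pose c : R[i] := 'i * (z 0 i)%:C.
have tcf := tame_blin (scale_bounded_linear (- c)) tf.
have := integral_partial (i := i) tf (tameD tf' tcf).
rewrite integralD// integral_blin//; last exact: scale_bounded_linear.
rewrite scaleNr => H; apply/subr0_eq/H => y; rewrite scaleNr.
exact/osc_diff_cvg/(pderives_cvg (s := [::]))/schwartz_smooth.
Qed.

Lemma fourier_pderives p i u z : schwartz u ->
  fourier (pderives (nseq p i) u) z = ('i * (z 0 i)%:C) ^+ p *: fourier u z.
Proof.
move=> su; elim: p => [|p IH]; first by rewrite scale1r.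
rewrite [pderives _ _]/= fourier_pderive; last exact: schwartz_pderives.
by rewrite IH scalerA -exprS.
Qed.

Lemma nr_fourier_le u (C : R) z : tame u -> 0 <= C ->
  (forall y, (1 + `|y|) ^+ (2 * m) * nr (u y) <= C) ->
  nr (fourier u z) <= (2 * pi) `^ (- (m%:R / 2)) * (4 ^+ m * C).
Proof.
move=> tu C0 uC; rewrite /fourier nr_realscale ger0_norm ?powR_ge0//.
rewrite ler_wpM2l ?powR_ge0//; apply: nr_integral_le => //.
  exact: tame_fourier_integrand.
by move=> y; rewrite nr_expi.
Qed.

Lemma fourier_bounded u : schwartz u ->
  exists2 C : R, 0 <= C & forall z, nr (fourier u z) <= C.
Proof.
move=> su; have [C C0 uC] := schwartz_decay (2 * m) su.
exists ((2 * pi) `^ (- (m%:R / 2)) * (4 ^+ m * C)).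
  by rewrite !mulr_ge0 ?powR_ge0 ?exprn_ge0.
by move=> z; apply: nr_fourier_le => //; exact: schwartz_tame.
Qed.

(** The sup norm of z is attained at some coordinate z_i, and the p-th power of |z_i| is produced by
    p derivatives in that direction. *)
Lemma fourier_decay u p : schwartz u -> exists2 C : R, 0 <= C &
  forall z, (1 + `|z|) ^+ p * nr (fourier u z) <= C.
Proof.
move=> su.
have ex i : exists C : R, 0 <= C /\ forall z, `|z 0 i| ^+ p * nr (fourier u z) <= C.
  have [C C0 uC] := fourier_bounded (schwartz_pderives (nseq p i) su).
  exists C; split=> // z; have := uC z; rewrite fourier_pderives// nr_scale.
  suff -> : complex.Re `|('i * (z 0 i)%:C) ^+ p| = `|z 0 i| ^+ p by [].
  rewrite normrX normrM normCi mul1r.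
  by rewrite (nrE ((z 0 i)%:C : R[i]^o)) nr_real_complex -rmorphXn.
pose D i := projT1 (cid (ex i)).
have D0 i : 0 <= D i by rewrite /D; case: cid => ? [].
have DP i z : `|z 0 i| ^+ p * nr (fourier u z) <= D i.
  by rewrite /D; case: cid => ? [].
have [C C0 uC] := fourier_bounded su.
(* The outer C serves the power 0, the inner one the point z = 0, which has no attaining coordinate;
   the sum stands for the maximum over coordinates. *)
exists (2 ^+ p * (C + (C + \sum_i D i))) => [|z].
  by rewrite mulr_ge0 ?exprn_ge0 ?addr_ge0 ?sumr_ge0.
have le2 := le_expr1D p (normr_ge0 z).
apply: (le_trans (ler_wpM2r (nr_ge0 _) le2)); rewrite -mulrA ler_wpM2l ?exprn_ge0//.
rewrite mulrDl mul1r; apply: lerD => //.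
have [z0|z0] := eqVneq (mx_norm z) 0.
  apply: (@le_trans _ _ (nr (fourier u z))).
    rewrite ler_piMl ?nr_ge0// exprn_ile1// -[`|z|]/(mx_norm z) z0 //.
  by apply: (le_trans (uC z)); rewrite lerDl sumr_ge0.
have [[j i] /= zi] := mx_norm_neq0 z0; rewrite ord1 in zi.
rewrite -[`|z|]/(mx_norm z) zi; apply: (le_trans (DP i z)).
rewrite (bigD1 i)//= addrCA lerDl addr_ge0// sumr_ge0//.
Qed.

(** A Lipschitz bound: the exponentials at t and z differ by at most m |y| |t - z|, and one more
    power of decay of u absorbs |y|. *)
Lemma fourier_continuous u : schwartz u -> continuous (fourier u).
Proof.
move=> su z; have tu := schwartz_tame su.
have [C C0 uC] := schwartz_decay (2 * m).+1 su.
apply/(@cvg_nrP _ _ _ (nbhs z)) => e e0.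
pose c : R := (2 * pi) `^ (- (m%:R / 2)) * (4 ^+ m * (m%:R * C)).
have c0 : 0 <= c by rewrite !mulr_ge0 ?powR_ge0 ?exprn_ge0.
have d0 : 0 < c + 1 by rewrite ltr_wpDl.
apply: filterS (near_norm_lt z (divr_gt0 e0 d0)).
move=> t; rewrite ltr_pdivlMr// => zt.
have -> : fourier u t - fourier u z = ((2 * pi) `^ (- (m%:R / 2)))%:C *:
    integral (fun y => expi (- dotp y t) *: u y - expi (- dotp y z) *: u y).
  rewrite /fourier -scalerBr; congr (_ *: _).
  have tf := tame_fourier_integrand z tu.
  have := integralD (tame_fourier_integrand t tu)
    (tame_blin (scale_bounded_linear (-1)) tf).
  rewrite integral_blin//; last exact: scale_bounded_linear.
  rewrite scaleN1r => <-; congr integral; apply/funext => y.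
  by rewrite scaleN1r.
rewrite nr_realscale ger0_norm ?powR_ge0//.
apply: (@le_lt_trans _ _ (c * `|z - t|)); last first.
  by apply: le_lt_trans zt; rewrite mulrC ler_wpM2l// lerDl.
rewrite /c -!mulrA ler_wpM2l ?powR_ge0//; apply: nr_integral_le.
- apply: tameD; first exact: tame_fourier_integrand.
  have := tame_blin (scale_bounded_linear (-1)) (tame_fourier_integrand z tu).
  by under eq_fun do rewrite scaleN1r.
- by rewrite !mulr_ge0.
move=> y; apply: (@le_trans _ _
  ((1 + `|y|) ^+ (2 * m) * (m%:R * `|y| * `|z - t| * nr (u y)))).
  rewrite ler_wpM2l ?exprn_ge0 ?addr_ge0//; apply: (le_trans (nr_expiB _ _ _)).
  rewrite ler_wpM2r ?nr_ge0// -opprD normrN -dotpBr distrC.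
  exact: norm_dotp_le.
rewrite [leRHS]mulrCA; rewrite [_ * nr _]mulrC; set N := nr _; set d := `|z - t|.
have -> : (1 + `|y|) ^+ (2 * m) * (N * (m%:R * `|y| * d)) =
  m%:R * d * ((1 + `|y|) ^+ (2 * m) * `|y| * N) by ring.
have dd : 0 <= d by exact: normr_ge0.
rewrite [C * _]mulrC ler_wpM2l ?(mulr_ge0 _ dd)//.
apply: (le_trans _ (uC y)); rewrite ler_wpM2r ?nr_ge0//.
by rewrite exprSr ler_wpM2l ?exprn_ge0 ?addr_ge0// lerDr.
Qed.

End Fourier.

(** * Hilbert modules *)

Section HilbertModule.
Context {R : realType} {A : cstarAlgType R} {E : hilbertModType A}.
Implicit Types (f g h : E) (a : A).

Local Notation inner := (hm_inner : E -> E -> A).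

Lemma inner0r f : inner f 0 = 0.
Proof. by rewrite -(scale0r (0 : E)) hm_innerZ scale0r. Qed.

Lemma inner0l f : inner 0 f = 0.
Proof. by rewrite -hm_innerC inner0r cs_star0. Qed.

Lemma innerNr f g : inner f (- g) = - inner f g.
Proof. by rewrite -scaleN1r hm_innerZ scaleN1r. Qed.

Lemma innerBr f g h : inner f (g - h) = inner f g - inner f h.
Proof. by rewrite hm_innerD innerNr. Qed.

Lemma innerBl f g h : inner (f - g) h = inner f h - inner g h.
Proof. by rewrite -hm_innerC innerBr cs_starD cs_starN !hm_innerC. Qed.

Lemma inner_actl f g a : inner (hm_act f a) g = a^star ** inner f g.
Proof. by rewrite -hm_innerC hm_inner_act cs_starM hm_innerC. Qed.

Lemma nr_inner f : nr f ^+ 2 = nr (inner f f).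
Proof. by apply: complexI; rewrite rmorphXn /= -!nrE hm_normE. Qed.

Lemma inner_eq f g : (forall h, inner f h = inner g h) -> f = g.
Proof.
move=> fg; apply/subr0_eq/nr_eq0/eqP; rewrite -sqrf_eq0 nr_inner.
by rewrite innerBl fg subrr nr0.
Qed.

(* Polarization replaces the Cauchy-Schwarz inequality, at the cost of the
   constant. *)
Lemma nr_inner_le f g : nr (inner f g) <= 4 * (nr f * nr g).
Proof.
have S_le p q : nr (inner p q + inner q p) <= (nr p + nr q) ^+ 2.
  have : 2%:C *: (inner p q + inner q p) = inner (p + q) (p + q) - inner (p - q) (p - q).
    have -> : inner (p + q) (p + q) = (inner p p + inner q q) + (inner p q + inner q p).
      rewrite hm_innerD !hm_innerDl [inner p q + _]addrC addrACA.
      by rewrite [inner q p + _]addrC.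
    have -> : inner (p - q) (p - q) = (inner p p + inner q q) - (inner p q + inner q p).
      rewrite innerBr !innerBl opprB addrACA opprD.
      by rewrite [- inner q p + _]addrC.
    have -> : (2%:C : R[i]) = 1 + 1 by rewrite -rmorphD.
    rewrite scalerDl scale1r opprB [X in _ = X]addrC.
    by rewrite subrKA.
  move=> /(congr1 nr); rewrite nr_realscale ger0_norm//.
  have := ler_nrB (inner (p + q) (p + q)) (inner (p - q) (p - q)).
  rewrite -!nr_inner; have := ler_nrD p q; have := ler_nrB p q.
  have := nr_ge0 (p + q); have := nr_ge0 (p - q).
  have := nr_ge0 p; have := nr_ge0 q; nra.
(* Using i q as well recovers the inner product from its symmetrization. *)
have H p q : nr (inner p q) <= (nr p + nr q) ^+ 2.
  have : 2%:C *: inner p q = (inner p q + inner q p) -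
      'i *: (inner p ('i *: q) + inner ('i *: q) p).
    rewrite hm_innerZ hm_innerZl conjCi scaleNr -scalerBr scalerA -expr2 sqrCi.
    rewrite scaleN1r opprK addrACA subrr addr0.
    by rewrite -[in RHS](scale1r (inner p q)) -scalerDl -rmorphD.
  move=> /(congr1 nr); rewrite nr_realscale ger0_norm//.
  have := ler_nrB (inner p q + inner q p) ('i *: (inner p ('i *: q) + inner ('i *: q) p)).
  have nri (V : normedModType R[i]) (x : V) : nr ('i *: x) = nr x.
    by rewrite nr_scale normCi /= mul1r.
  rewrite nri; have := S_le p q; have := S_le p ('i *: q); rewrite nri.
  by have := nr_ge0 (inner p q); lra.
have [f0|fn0] := eqVneq (nr f) 0.
  by rewrite (nr_eq0 f0) inner0l !nr0 mul0r mulr0.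
have [g0|gn0] := eqVneq (nr g) 0.
  by rewrite (nr_eq0 g0) inner0r !nr0 !mulr0.
have f0 : 0 < nr f by rewrite lt_neqAle eq_sym fn0 nr_ge0.
have g0 : 0 < nr g by rewrite lt_neqAle eq_sym gn0 nr_ge0.
(* On unit vectors the bound is (1 + 1)^2, whence the constant 4. *)
have := H ((nr f)^-1%:C *: f) ((nr g)^-1%:C *: g).
rewrite hm_innerZl hm_innerZ !nr_realscale !ger0_norm ?invr_ge0 ?nr_ge0//.
rewrite !mulVf// conj_Creal ?complex_real// !nr_realscale !ger0_norm ?invr_ge0 ?nr_ge0//.
rewrite mulrA -invfM ler_pdivrMl ?mulr_gt0// => /le_trans; apply.
by have := mulr_gt0 f0 g0; set t := _ * _; nra.
Qed.

Lemma nr_act f a : nr (hm_act f a) <= nr f * nr a.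
Proof.
rewrite -(@ler_pXn2r _ 2) ?nnegrE ?mulr_ge0 ?nr_ge0//.
rewrite nr_inner inner_actl hm_inner_act exprMn nr_inner cs_mulA.
apply: (le_trans (nrM _ _)); apply: (le_trans (ler_wpM2r (nr_ge0 _) (nrM _ _))).
by rewrite nr_star; have := nr_ge0 a; have := nr_ge0 (inner f f); nra.
Qed.

Lemma act_bounded_linear a : bounded_linear (fun f => hm_act f a : E).
Proof.
split=> [f g|c f|]; [exact: hm_actDl | exact: hm_actZl |].
by exists (nr a) => [|f]; rewrite ?nr_ge0// mulrC nr_act.
Qed.

(** Linearity is not part of [adjointable]: it follows by moving the operator across the inner
    product, which separates points. The same applies to the right action. *)
Lemma adjointable_act (T : adjop E) f a : T (hm_act f a) = hm_act (T f) a.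
Proof.
have /asboolP[_ [S TS]] := adjopP T; apply: inner_eq => h.
by rewrite TS !inner_actl TS.
Qed.

Lemma adjop_bounded_linear (T : adjop E) : bounded_linear T.
Proof.
have /asboolP[[M TM] [S TS]] := adjopP T; split.
- by move=> f g; apply: inner_eq => h; rewrite TS !hm_innerDl !TS.
- by move=> c f; apply: inner_eq => h; rewrite TS !hm_innerZl !TS.
exists `|M| => // f; have := TM f; rewrite !nrE -rmorphM /= lecR => /le_trans; apply.
by rewrite ler_wpM2r ?nr_ge0// ler_norm.
Qed.

Lemma nr_opnorm (T : adjop E) : nr T = opnorm T.
Proof. by []. Qed.

Lemma adjop_ext (S T : adjop E) : (forall f, S f = T f) -> S = T.
Proof. by move=> ST; apply/val_inj/funext. Qed.

End HilbertModule.

(** * Extension by density *)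

Section DenseExtension.
Context {R : realType} {V : normedModType R[i]}.

Definition lipschitz_map {W : normedModType R[i]} (G : V -> W) : Prop :=
  exists2 C : R, 0 <= C & forall f g, nr (G f - G g) <= C * nr (f - g).

Lemma dense_approx (D : set V) (f : V) (e : R) : dense D -> 0 < e ->
  exists2 d, D d & nr (d - f) < e.
Proof.
move=> dD e0; have [||d [fd Dd]] := dD (ball f e%:C).
- by exists f; apply: ballxx; rewrite (ltcR 0).
- by apply: ball_open; rewrite (ltcR 0).
exists d => //; move: fd; rewrite -ball_normE /ball_ /= nrE ltcR.
by rewrite nrB.
Qed.

Lemma dense_eq {W : normedModType R[i]} (D : set V) (G H : V -> W) : dense D ->
  lipschitz_map G -> lipschitz_map H -> (forall d, D d -> G d = H d) ->
  forall f, G f = H f.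
Proof.
move=> dD [C C0 GC] [C' C'0 HC] GH f; apply: closeness_eq => e e0.
have d0 : 0 < e / (C + C' + 1) by rewrite divr_gt0// ltr_wpDl// addr_ge0.
have [d Dd] := dense_approx f dD d0; rewrite ltr_pdivlMr ?ltr_wpDl ?addr_ge0// => df.
have := ler_nrBD (G d) (G f) (H f); have := GC d f; have := HC d f.
by rewrite (nrB (G f) (G d)) GH//; have := nr_ge0 (d - f); nra.
Qed.

(** [al] need not be injective: the Lipschitz hypothesis makes [be] factor through it. G f is the
    limit of [be] along approximants of f, and only the simultaneous approximation of f and G f by
    some u is used afterwards. *)
Lemma dense_extension {W : completeNormedModType R[i]} {X : Type} (D : set X)
    (al : X -> V) (be : X -> W) (C : R) : 0 <= C -> dense (al @` D) ->
  (forall u v, D u -> D v -> nr (be u - be v) <= C * nr (al u - al v)) ->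
  exists2 G : V -> W, (forall u, D u -> G (al u) = be u) &
    forall f g, nr (G f - G g) <= C * nr (f - g).
Proof.
move=> C0 dD beC.
have ex f : exists l : W, forall e, 0 < e -> exists2 u, D u &
    nr (al u - f) < e /\ nr (be u - l) < e.
  have exu n : exists u, D u /\ nr (al u - f) < 2^-1 ^+ n.
    have [|_ [u Du <-] uf] := @dense_approx _ f (2^-1 ^+ n) dD.
      by rewrite exprn_gt0// invr_gt0.
    by exists u.
  pose s n := projT1 (cid (exu n)).
  have sP n : D (s n) /\ nr (al (s n) - f) < 2^-1 ^+ n by rewrite /s; case: cid.
  have cv : cvg ((fun n => be (s n)) @ \oo).
    apply: cauchyn_cvg => e e0.
    have d0 : 0 < e / (2 * C + 1) by rewrite divr_gt0// ltr_wpDl// mulr_ge0.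
    have [N NP] := half_pow_lt d0; exists N => p q Np Nq.
    have := beC _ _ (sP p).1 (sP q).1.
    have := ler_nrBD f (al (s p)) (al (s q)); rewrite (nrB f).
    have := NP _ Np; have := NP _ Nq.
    rewrite !ltr_pdivlMr ?ltr_wpDl ?mulr_ge0//.
    have := (sP p).2; have := (sP q).2; have := nr_ge0 (al (s p) - al (s q)).
    have := nr_ge0 (al (s p) - f); have := nr_ge0 (al (s q) - f); nra.
  exists (lim ((fun n => be (s n)) @ \oo)) => e e0.
  have [N NP] := half_pow_lt e0.
  have [N' NP'] := (cvgn_nrP _ _).1 cv _ e0.
  exists (s (maxn N N')); first exact: (sP _).1.
  split; last exact/NP'/leq_maxr.
  by apply: lt_trans (sP _).2 (NP _ (leq_maxl _ _)).
pose G f := projT1 (cid (ex f)).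
have GP f e : 0 < e -> exists2 u, D u & nr (al u - f) < e /\ nr (be u - G f) < e.
  by rewrite /G; case: cid => l /= H e0; exact: H.
have C1 : 0 < 2 * C + 2 by rewrite ltr_wpDl// mulr_ge0.
exists G => [v Dv|f g].
  apply: closeness_eq => e e0.
  have [u Du [uv uG]] := GP (al v) _ (divr_gt0 e0 C1).
  move: uv uG; rewrite !ltr_pdivlMr// => uv uG.
  have := beC _ _ Du Dv; have := ler_nrBD (be u) (G (al v)) (be v).
  rewrite (nrB (G (al v)) (be u)); have := nr_ge0 (al u - al v).
  by have := nr_ge0 (be u - G (al v)); nra.
apply/ler_addgt0Pr => e e0.
have [u Du [uf uG]] := GP f _ (divr_gt0 e0 C1).
have [v Dv [vg vG]] := GP g _ (divr_gt0 e0 C1).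
move: uf uG vg vG; rewrite !ltr_pdivlMr// => uf uG vg vG.
have := beC _ _ Du Dv; have := ler_nrBD (be u) (G f) (G g).
have := ler_nrBD (be v) (be u) (G g).
have := ler_nrBD f (al u) (al v); have := ler_nrBD g f (al v).
rewrite (nrB (G f) (be u)) (nrB g (al v)) => H1 H2 H3 H4 H5.
have : C * nr (al u - al v) <= C * (nr (al u - f) + (nr (f - g) + nr (al v - g))).
  by rewrite ler_wpM2l//; lra.
have := nr_ge0 (be u - G f); have := nr_ge0 (be v - G g).
have := nr_ge0 (al u - f); have := nr_ge0 (al v - g).
rewrite !mulrDr; nra.
Qed.

Lemma bounded_linear_lipschitz {W : normedModType R[i]} (L : V -> W) :
  bounded_linear L -> lipschitz_map L.
Proof.
by move=> hL; have [_ _ [C C0 LC]] := hL; exists C => // f g; rewrite -(blinB hL).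
Qed.

End DenseExtension.

(** * Symbols with values in matrices *)

Lemma fourier_blin {R : realType} {A B : cstarAlgType R} {m : nat}
    (L : A -> B) (u : 'rV[R]_m -> A) z : bounded_linear L -> schwartz u ->
  fourier (fun x => L (u x)) z = L (fourier u z).
Proof.
move=> hL su; rewrite /fourier (blinZ hL) -(integral_blin hL); last first.
  exact/tame_fourier_integrand/schwartz_tame.
by congr (_ *: _); congr integral; apply/funext => y; rewrite (blinZ hL).
Qed.

Lemma row_mx_continuous {R : realType} {n : nat} (x : 'rV[R]_n) :
  continuous (fun z : 'rV[R]_n => row_mx x z).
Proof.
move=> z; apply/(@cvgrPdist_lt _ _ _ (nbhs z)) => e e0.
apply: filterS (near_norm_lt z e0) => t; apply: le_lt_trans.
rewrite rV_norm_le//; apply/forallP => i; rewrite !mxE.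
case: fintype.split => j; first by rewrite subrr normr0.
by have := rV_norm_coord (z - t) j; rewrite !mxE.
Qed.

Section Products.
Context {R : realType} {A : cstarAlgType R} {n : nat}.
Implicit Types (u v : 'rV[R]_n -> A) (b : 'rV[R]_(n + n) -> A).

(** The symbol is bounded and the exponential has modulus 1, so the decay comes from the transform
    of u. *)
Lemma tame_psido_integrand b u x : smooth_bounded b -> schwartz u ->
  tame (fun z => expi (dotp x z) *: (b (row_mx x z) ** fourier u z)).
Proof.
move=> /smooth_boundedP[sb bB] su; apply: tame_osc.
  have -> : dotp x = fun z => dotp z x by apply/funext => y; rewrite dotpC.
  exact: dotp_continuous.
have [C C0 bC] := bB [::]; have [D D0 uD] := fourier_decay (2 * n).+2 su.
split=> [z|].
  apply: (cs_cvgM _ (fourier_continuous su (x := z))).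
  exact: (continuous_comp (row_mx_continuous (x := x) (x0 := z))
    (smooth_continuous sb (x := row_mx x z))).
exists (C * D) => [|z]; first exact: mulr_ge0.
apply: (@le_trans _ _ (C * ((1 + `|z|) ^+ (2 * n).+2 * nr (fourier u z)))); last first.
  by rewrite ler_wpM2l.
rewrite mulrCA ler_wpM2l ?exprn_ge0 ?addr_ge0//; apply: (le_trans (nrM _ _)).
by rewrite ler_wpM2r ?nr_ge0// bC.
Qed.

Lemma tame_inner u v : schwartz u -> schwartz v -> tame (fun x => (u x)^star ** v x).
Proof.
move=> su sv; have cu := smooth_continuous (schwartz_smooth su).
have cv := smooth_continuous (schwartz_smooth sv).
have [C C0 uC] := schwartz_decay 0 su; have [D D0 vD] := schwartz_decay (2 * n).+2 sv.
split=> [x|]; first exact: (cs_cvgM (cs_cvg_star (cu x)) (cv x)).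
exists (C * D) => [|x]; first exact: mulr_ge0.
apply: (@le_trans _ _ (C * ((1 + `|x|) ^+ (2 * n).+2 * nr (v x)))); last first.
  by rewrite ler_wpM2l.
rewrite mulrCA ler_wpM2l ?exprn_ge0 ?addr_ge0//; apply: (le_trans (nrM _ _)).
by rewrite ler_wpM2r ?nr_ge0// nr_star; have := uC x; rewrite expr0 mul1r.
Qed.

Lemma psido0 u : psido (fun=> 0) u = fun=> 0.
Proof.
apply/funext => x; rewrite /psido (_ : (fun z => _) = fun=> 0).
  by rewrite integral0 scaler0.
by apply/funext => z; rewrite cs_mul0l scaler0.
Qed.

Lemma lmul_bounded_linear (a : A) : bounded_linear (fun x : A => a ** x).
Proof.
split=> [x y|c x|]; [exact: cs_mulDr | exact: cs_mulZr |].
by exists (nr a) => [|x]; [exact: nr_ge0 | exact: nrM].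
Qed.

End Products.

Section MatrixSymbols.
Context {R : realType} {A M : cstarAlgType R} {k n : nat} (phi : 'M[A]_k -> M).
Hypothesis Mk : is_matrix_algebra phi.

Lemma entry_bounded_linear i j : bounded_linear (entry Mk i j).
Proof.
have [C C0 eC] := entry_bound Mk.
by split; [exact: entryD | exact: entryZ | exists C].
Qed.

Lemma embed_bounded_linear i j : bounded_linear (embed phi i j).
Proof.
have [C C0 eC] := embed_bound Mk.
by split; [exact: (embedD Mk) | exact: (embedZ Mk) | exists C].
Qed.

Lemma psido_entry (b : 'rV[R]_(n + n) -> M) (u : 'rV[R]_n -> M) x i j :
  smooth_bounded b -> schwartz u ->
  entry Mk i j (psido b u x) =
  \sum_l psido (fun w => entry Mk i l (b w)) (fun y => entry Mk l j (u y)) x.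
Proof.
move=> sb su; rewrite /psido entryZ -scaler_sumr; congr (_ *: _).
rewrite -(integral_blin (entry_bounded_linear i j)); last exact: tame_psido_integrand.
rewrite -integral_sum => [|l].
  congr integral; apply/funext => z; rewrite entryZ entryM scaler_sumr.
  apply: eq_bigr => l _.
  by rewrite (fourier_blin z (entry_bounded_linear l j) su).
apply: (@tame_psido_integrand _ _ _ (fun w => entry Mk i l (b w))).
  exact: (smooth_bounded_blin (entry_bounded_linear i l)).
exact: (schwartz_blin (entry_bounded_linear l j)).
Qed.

End MatrixSymbols.

(** * Completions of Schwartz functions *)

Section Completion.
Context {R : realType} {A : cstarAlgType R} {n : nat} {E : hilbertModType A}.
Variables (iota : ('rV[R]_n -> A) -> E) (cE : is_L2_completion iota).
Implicit Types u v : 'rV[R]_n -> A.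

Lemma schwartzZ (c : R[i]) u : schwartz u -> schwartz (fun x => c *: u x).
Proof. exact: (schwartz_blin (scale_bounded_linear c)). Qed.

Lemma iotaB u v : schwartz u -> schwartz v ->
  iota u - iota v = iota (fun x => u x - v x).
Proof.
move=> su sv; rewrite -scaleN1r -(iotaZ cE)// -(Defs.iotaD cE)//; last exact: schwartzZ.
by congr iota; apply/funext => x; rewrite scaleN1r.
Qed.

Lemma iota0 : iota (fun=> 0) = 0.
Proof.
rewrite -[RHS](scale0r (iota (fun=> 0))) -(iotaZ cE); last exact: schwartz0.
by congr iota; apply/funext => x; rewrite scaler0.
Qed.

Lemma schwartzB u v : schwartz u -> schwartz v -> schwartz (fun x => u x - v x).
Proof.
move=> su sv; have := schwartzD su (schwartzZ (-1) sv).
by under eq_fun do rewrite scaleN1r.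
Qed.

Lemma iota_sum (I : Type) (r : seq I) (G : I -> 'rV[R]_n -> A) :
  (forall t, schwartz (G t)) ->
  iota (fun x => \sum_(t <- r) G t x) = \sum_(t <- r) iota (G t).
Proof.
move=> sG; elim: r => [|t r IH].
  by rewrite big_nil -iota0; congr iota; apply/funext => x; rewrite big_nil.
rewrite big_cons -IH -(Defs.iotaD cE)//; last exact: schwartz_sum.
by congr iota; apply/funext => x; rewrite big_cons.
Qed.

Lemma nr_iota u : schwartz u ->
  nr (iota u) ^+ 2 = nr (integral (fun x => (u x)^star ** u x)).
Proof. by move=> su; rewrite nr_inner (iota_inner cE). Qed.

(** Left multiplication by an isometry preserves the inner product, and isometries span A. The
    resulting constant depends on the decomposition of a. *)
Lemma lmul_L2_bound (a : A) : exists2 C : R, 0 <= C & forall u, schwartz u ->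
  nr (iota (fun x => a ** u x)) <= C * nr (iota u).
Proof.
move: a; apply: isometry_ind => [a aa|c a b [C C0 aC] [D D0 bD]].
  exists 1 => // u su; have sau := schwartz_blin (lmul_bounded_linear a) su.
  rewrite mul1r -(@ler_pXn2r _ 2) ?nnegrE ?nr_ge0// !nr_iota//.
  rewrite le_eqVlt; apply/orP; left; apply/eqP; congr nr; congr integral.
  by apply/funext => x; rewrite cs_starM -cs_mulA [a^star ** _]cs_mulA aa cs_mul1l.
have c0 : 0 <= complex.Re `|c| by rewrite -ler0c -normC_ReE.
exists (complex.Re `|c| * C + D) => [|u su]; first by rewrite addr_ge0 ?mulr_ge0.
have sau := schwartz_blin (lmul_bounded_linear a) su.
have sbu := schwartz_blin (lmul_bounded_linear b) su.
have -> : (fun x => (c *: a + b) ** u x) = fun x => c *: (a ** u x) + b ** u x.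
  by apply/funext => x; rewrite cs_mulDl cs_mulZl.
rewrite (Defs.iotaD cE)//; last exact: schwartzZ.
rewrite (iotaZ cE)//; apply: (le_trans (ler_nrD _ _)).
by rewrite nr_scale mulrDl -mulrA lerD ?bD// ler_wpM2l// aC.
Qed.

Lemma adjop_eq (S T : adjop E) :
  (forall u, schwartz u -> S (iota u) = T (iota u)) -> S = T.
Proof.
move=> ST; apply: adjop_ext; apply: (dense_eq (iota_dense cE)).
- exact/bounded_linear_lipschitz/adjop_bounded_linear.
- exact/bounded_linear_lipschitz/adjop_bounded_linear.
by move=> _ [u su <-]; exact: ST.
Qed.

Lemma extensionP (L : ('rV[R]_n -> A) -> 'rV[R]_n -> A) (T : adjop E) :
  (forall u, schwartz u -> schwartz (L u) /\ T (iota u) = iota (L u)) ->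
  extension iota L = T.
Proof.
move=> LT; rewrite /extension; case: xgetP => [S _ LS|/(_ T)/(_ LT)//].
by apply: adjop_eq => u su; rewrite (LS u su).2 (LT u su).2.
Qed.

Lemma extension_dummy (L : ('rV[R]_n -> A) -> 'rV[R]_n -> A) :
  (~ exists T : adjop E, forall u, schwartz u ->
    schwartz (L u) /\ T (iota u) = iota (L u)) ->
  extension iota L = 0.
Proof.
by move=> LT; rewrite /extension; case: xgetP => // T _ LT'; case: LT; exists T.
Qed.

End Completion.

Lemma pointwise_extension {R : realType} {A B : cstarAlgType R} {n : nat}
    {E : hilbertModType A} {F : hilbertModType B}
    (iota : ('rV[R]_n -> A) -> E) (jota : ('rV[R]_n -> B) -> F)
    (L : A -> B) (C : R) :
  is_L2_completion iota -> is_L2_completion jota -> bounded_linear L -> 0 <= C ->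
  (forall u, schwartz u -> nr (jota (fun x => L (u x))) <= C * nr (iota u)) ->
  exists2 G : E -> F, bounded_linear G &
    forall u, schwartz u -> G (iota u) = jota (fun x => L (u x)).
Proof.
move=> cE cF hL C0 LC.
have sL (u : 'rV[R]_n -> A) : schwartz u -> schwartz (fun x => L (u x)).
  exact: schwartz_blin.
have [|G Gi GC] := dense_extension C0 (iota_dense cE)
    (be := fun u => jota (fun x => L (u x))).
  move=> u v su sv; rewrite (iotaB cF) ?(iotaB cE)//; try exact: sL.
  rewrite (_ : (fun x => _) = fun x => L (u x - v x)).
    exact: (LC _ (schwartzB su sv)).
  by apply/funext => x; rewrite (blinB hL).
exists G => //.
have lipG : lipschitz_map G by exists C.
(* Additivity is extended by density in one argument at a time. *)
have GD1 u g : schwartz u -> G (iota u + g) = G (iota u) + G g.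
  move=> su; move: g; apply: (dense_eq (iota_dense cE)).
  - by exists C => // f g; apply: (le_trans (GC _ _)); rewrite opprD addrACA subrr add0r.
  - by exists C => // f g; rewrite opprD addrACA subrr add0r.
  move=> _ [v sv <-]; rewrite -(Defs.iotaD cE)// !Gi//; last exact: schwartzD.
  rewrite -(Defs.iotaD cF); try exact: sL.
  by congr jota; apply/funext => x; rewrite (blinD hL).
have GD f g : G (f + g) = G f + G g.
  move: f; apply: (dense_eq (iota_dense cE)).
  - by exists C => // f f'; apply: (le_trans (GC _ _)); rewrite opprD addrACA subrr addr0.
  - by exists C => // f f'; rewrite opprD addrACA subrr addr0.
  by move=> _ [u su <-]; exact: GD1.
have GZ c f : G (c *: f) = c *: G f.
  have c0 : 0 <= complex.Re `|c| by rewrite -ler0c -normC_ReE.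
  have Cc0 : 0 <= C * complex.Re `|c| by rewrite mulr_ge0.
  move: f; apply: (dense_eq (iota_dense cE)).
  - exists (C * complex.Re `|c|) => // f g; apply: (le_trans (GC _ _)).
    by rewrite -scalerBr nr_scale mulrA.
  - exists (C * complex.Re `|c|) => // f g.
    by rewrite -scalerBr nr_scale [C * _]mulrC -mulrA ler_wpM2l.
  move=> _ [u su <-]; rewrite -(iotaZ cE)// !Gi//; last exact: schwartzZ.
  rewrite -(iotaZ cF); last exact: sL.
  by congr jota; apply/funext => x; rewrite (blinZ hL).
have G0 : G 0 = 0 by rewrite -(scale0r (0 : E)) GZ scale0r.
by split=> //; exists C => // f; have := GC f 0; rewrite G0 !subr0.
Qed.

(** * The entries of the completed module *)

Section Matrices.
Context {R : realType} {A M : cstarAlgType R} {k n : nat} {phi : 'M[A]_k -> M}.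
Context {E : hilbertModType A} {F : hilbertModType M}.
Variables (iota : ('rV[R]_n -> A) -> E) (jota : ('rV[R]_n -> M) -> F).
Hypotheses (Mk : is_matrix_algebra phi).
Hypotheses (cE : is_L2_completion iota) (cF : is_L2_completion jota).
Implicit Types (u : 'rV[R]_n -> M) (v : 'rV[R]_n -> A) (i j l a b : 'I_k).

Local Notation ent := (entry Mk).
Local Notation emb := (embed phi).

(** The inner square of the embedded function is [embed j j] of that of v, so the diagonal bound
    suffices. *)
Lemma embed_L2_bound i j v : schwartz v ->
  nr (jota (fun x => emb i j (v x))) <= 2 * nr (iota v).
Proof.
move=> sv; have sev := schwartz_blin (embed_bounded_linear Mk i j) sv.
have : nr (jota (fun x => emb i j (v x))) ^+ 2 <= 2 * nr (iota v) ^+ 2.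
  rewrite (nr_iota cF)// (nr_iota cE)//.
  apply: le_trans (embed_diag_bound Mk j _).
  rewrite -(integral_blin (embed_bounded_linear Mk j j)); last exact: tame_inner.
  rewrite le_eqVlt; apply/orP; left; apply/eqP; congr nr; congr integral.
  by apply/funext => x; rewrite (embed_star Mk) (embedM Mk).
have := nr_ge0 (iota v); have := nr_ge0 (jota (fun x => emb i j (v x))).
by nra.
Qed.

(** The (i, j)-th entry put back in its place is [w] = e_ii u e_jj. Left multiplication by e_ii is
    bounded by [lmul_L2_bound], right multiplication by the module action, and
    [embed_diag_bound_inv] compares the inner squares. *)
Lemma entry_L2_bound i j : exists2 C : R, 0 <= C & forall u, schwartz u ->
  nr (iota (fun x => ent i j (u x))) <= C * nr (jota u).
Proof.
have [C C0 eC] := lmul_L2_bound cF (emb i i cs_one).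
exists (2 * (C * nr (emb j j cs_one))) => [|u su].
  by rewrite !mulr_ge0 ?nr_ge0.
have seu := schwartz_blin (entry_bounded_linear Mk i j) su.
pose w x := emb i j (ent i j (u x)).
have sw : schwartz w by exact: (schwartz_blin (embed_bounded_linear Mk i j)).
have wb : nr (jota w) <= C * nr (jota u) * nr (emb j j cs_one).
  have seu' := schwartz_blin (lmul_bounded_linear (emb i i cs_one)) su.
  have -> : jota w = hm_act (jota (fun x => emb i i cs_one ** u x)) (emb j j cs_one).
    rewrite -(iota_act cF)//; congr jota; apply/funext => x.
    by rewrite (embed_entry Mk).
  by apply: (le_trans (nr_act _ _)); rewrite ler_wpM2r ?nr_ge0// eC.
have : nr (iota (fun x => ent i j (u x))) ^+ 2 <= 2 * nr (jota w) ^+ 2.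
  rewrite (nr_iota cE)// (nr_iota cF)//.
  apply: (le_trans (embed_diag_bound_inv Mk j _)); rewrite ler_wpM2l//.
  rewrite -(integral_blin (embed_bounded_linear Mk j j)); last exact: tame_inner.
  rewrite le_eqVlt; apply/orP; left; apply/eqP; congr nr; congr integral.
  by apply/funext => x; rewrite (embed_star Mk) (embedM Mk).
move=> H.
apply: (@le_trans _ _ (2 * nr (jota w))).
  by have := nr_ge0 (iota (fun x => ent i j (u x))); have := nr_ge0 (jota w); nra.
by rewrite -mulrA ler_wpM2l// mulrAC.
Qed.

Let coord_ex i j : exists G : F -> E, bounded_linear G /\
  forall u, schwartz u -> G (jota u) = iota (fun x => ent i j (u x)).
Proof.
have [C C0 eC] := entry_L2_bound i j.
have [G ? ?] := pointwise_extension cF cE (entry_bounded_linear Mk i j) C0 eC.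
by exists G.
Qed.

Let inj_ex i j : exists G : E -> F, bounded_linear G /\
  forall v, schwartz v -> G (iota v) = jota (fun x => emb i j (v x)).
Proof.
have two0 : 0 <= 2 :> R by [].
have [G ? ?] := pointwise_extension cE cF (embed_bounded_linear Mk i j) two0
  (embed_L2_bound i j).
by exists G.
Qed.

(* [coord i j] and [inject i j] extend to the completions the passage to the
   [(i, j)]-th entry and the inclusion as [(i, j)]-th entry. *)
Definition coord i j : F -> E := projT1 (cid (coord_ex i j)).

Definition inject i j : E -> F := projT1 (cid (inj_ex i j)).

Lemma coord_blin i j : bounded_linear (coord i j).
Proof. by rewrite /coord; case: cid => G []. Qed.

Lemma coord_jota i j u : schwartz u ->
  coord i j (jota u) = iota (fun x => ent i j (u x)).
Proof. by rewrite /coord; case: cid => G [? H] /=; exact: H. Qed.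

Lemma inject_blin i j : bounded_linear (inject i j).
Proof. by rewrite /inject; case: cid => G []. Qed.

Lemma inject_iota i j v : schwartz v ->
  inject i j (iota v) = jota (fun x => emb i j (v x)).
Proof. by rewrite /inject; case: cid => G [? H] /=; exact: H. Qed.

Let schwartz_ent i j u : schwartz u -> schwartz (fun x => ent i j (u x)).
Proof. exact: (schwartz_blin (entry_bounded_linear Mk i j)). Qed.

Let schwartz_emb i j v : schwartz v -> schwartz (fun x => emb i j (v x)).
Proof. exact: (schwartz_blin (embed_bounded_linear Mk i j)). Qed.

Lemma zero_lipschitz {V W : normedModType R[i]} : lipschitz_map (fun _ : V => 0 : W).
Proof. by exists 0 => // f g; rewrite subrr nr0 mul0r. Qed.

Lemma id_lipschitz {V : normedModType R[i]} : lipschitz_map (fun f : V => f).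
Proof. by exists 1 => // f g; rewrite mul1r. Qed.

Lemma coord_inject i j a b f :
  coord a b (inject i j f) = if (a == i) && (b == j) then f else 0.
Proof.
move: f; apply: (dense_eq (iota_dense cE)).
- apply: bounded_linear_lipschitz.
  exact: (bounded_linear_comp (coord_blin a b) (inject_blin i j)).
- by case: (_ && _); [exact: id_lipschitz | exact: zero_lipschitz].
move=> _ [v sv <-]; rewrite inject_iota// coord_jota; last exact: schwartz_emb.
case: ifP => abij.
  by congr iota; apply/funext => x; rewrite entry_embed abij.
by rewrite -(iota0 cE); congr iota; apply/funext => x; rewrite entry_embed abij.
Qed.

(** Moving column j to column b is the right action of a matrix unit, hence commutes with every
    adjointable operator. *)
Lemma sum_inject_coord j b f :
  \sum_l inject l b (coord l j f) = hm_act f (emb j b cs_one).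
Proof.
move: f; apply: (dense_eq (iota_dense cF)).
- apply/bounded_linear_lipschitz/bounded_linear_sum => l.
  exact: (bounded_linear_comp (inject_blin l b) (coord_blin l j)).
- exact/bounded_linear_lipschitz/act_bounded_linear.
move=> _ [u su <-]; rewrite -(iota_act cF)//.
rewrite (eq_bigr (fun l => jota (fun x => emb l b (ent l j (u x))))) => [|l _].
  rewrite -(iota_sum cF) => [|l]; last exact/schwartz_emb/schwartz_ent.
  congr jota; apply/funext => x; apply: (entry_inj (Mk := Mk)) => p q.
  rewrite entry_sum (bigD1 p)//= big1 ?addr0 => [|l lp].
    rewrite entry_embed eqxx entryM (bigD1 j)//= big1 ?addr0 => [|l lj].
      by rewrite entry_embed eqxx /=; case: ifP; rewrite ?cs_mul1r ?cs_mul0r.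
    by rewrite entry_embed (negPf lj) cs_mul0r.
  by rewrite entry_embed eq_sym (negPf lp).
by rewrite coord_jota// inject_iota//; exact: schwartz_ent.
Qed.

Lemma inject_coord f : f = \sum_j \sum_l inject l j (coord l j f).
Proof.
rewrite (eq_bigr (fun j => hm_act f (emb j j cs_one))) => [|j _]; last first.
  exact: sum_inject_coord.
rewrite -[LHS](hm_act1 (f : F)) [cs_one in LHS](sum_embed Mk).
rewrite (eq_bigr (fun i => emb i i cs_one)) => [|i _].
  apply: (big_morph (hm_act f)) => [x y|]; first exact: hm_actDr.
  by rewrite -(scale0r (0 : M)) hm_actZr scale0r.
rewrite (bigD1 i)//= big1 ?addr0 => [|j ji]; first by rewrite entry1 eqxx.
by rewrite entry1 eq_sym (negPf ji) (blin0 (embed_bounded_linear Mk i j)).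
Qed.

Lemma coord_ext f g : (forall i j, coord i j f = coord i j g) -> f = g.
Proof.
move=> fg; rewrite (inject_coord f) (inject_coord g); apply: eq_bigr => j _.
by apply: eq_bigr => l _; rewrite fg.
Qed.

Lemma inner_bounded_linear {B : cstarAlgType R} {G : hilbertModType B} (f : G) :
  bounded_linear (fun g : G => hm_inner f g : B).
Proof.
split=> [g h|c g|]; [exact: hm_innerD | exact: hm_innerZ |].
exists (4 * nr f) => [|g]; first by rewrite mulr_ge0 ?nr_ge0.
by rewrite -mulrA nr_inner_le.
Qed.

Lemma innerl_lipschitz {B : cstarAlgType R} {G : hilbertModType B} (g : G) :
  lipschitz_map (fun f : G => hm_inner f g : B).
Proof.
exists (4 * nr g) => [|f h]; first by rewrite mulr_ge0 ?nr_ge0.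
rewrite -innerBl; apply: (le_trans (nr_inner_le _ _)).
by rewrite -mulrA [nr g * _]mulrC.
Qed.

Lemma lipschitz_comp {U V W : normedModType R[i]} (G : V -> W) (H : U -> V) :
  lipschitz_map G -> lipschitz_map H -> lipschitz_map (G \o H).
Proof.
move=> [C C0 GC] [D D0 HD]; exists (C * D) => [|f g /=]; first exact: mulr_ge0.
by apply: (le_trans (GC _ _)); rewrite -mulrA ler_wpM2l.
Qed.

Lemma lipschitz_sum {V W : normedModType R[i]} (I : Type) (r : seq I)
    (G : I -> V -> W) : (forall t, lipschitz_map (G t)) ->
  lipschitz_map (fun f => \sum_(t <- r) G t f).
Proof.
move=> lG; elim: r => [|t r [C C0 IH]].
  by under eq_fun do rewrite big_nil; exact: zero_lipschitz.
have [D D0 GD] := lG t; exists (D + C) => [|f g]; first exact: addr_ge0.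
rewrite !big_cons opprD addrACA mulrDl.
by apply: (le_trans (ler_nrD _ _)); rewrite lerD.
Qed.

(** A matrix product under the integral for Schwartz functions, extended by density in each argument
    separately. *)
Lemma entry_inner f g a b :
  ent a b (hm_inner f g) = \sum_l hm_inner (coord l a f) (coord l b g).
Proof.
move: f; apply: (dense_eq (iota_dense cF)).
- apply: (lipschitz_comp (G := ent a b)); last exact: innerl_lipschitz.
  exact/bounded_linear_lipschitz/entry_bounded_linear.
- apply: lipschitz_sum => l; apply: (lipschitz_comp
    (G := fun f : E => hm_inner f (coord l b g) : A) (H := coord l a)).
    exact: innerl_lipschitz.
  exact/bounded_linear_lipschitz/coord_blin.
move=> _ [u su <-]; move: g; apply: (dense_eq (iota_dense cF)).
- apply/bounded_linear_lipschitz/(bounded_linear_comp (entry_bounded_linear Mk a b)).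
  exact: inner_bounded_linear.
- apply/bounded_linear_lipschitz/bounded_linear_sum => l.
  apply: (bounded_linear_comp _ (coord_blin l b)).
  exact: inner_bounded_linear.
move=> _ [v sv <-]; rewrite (iota_inner cF)//.
rewrite -(integral_blin (entry_bounded_linear Mk a b)); last exact: tame_inner.
rewrite (eq_bigr (fun l => integral (fun x => (ent l a (u x))^star ** ent l b (v x)))).
  rewrite -integral_sum => [|l]; last by apply: tame_inner; exact: schwartz_ent.
  congr integral; apply/funext => x; rewrite entryM; apply: eq_bigr => l _.
  by rewrite entry_star.
by move=> l _; rewrite !coord_jota// (iota_inner cE)//; exact: schwartz_ent.
Qed.

End Matrices.

(** * Operators on the matrix module as matrices of operators *)

Section AdjointableMatrices.
Context {R : realType} {A M : cstarAlgType R} {k n : nat} {phi : 'M[A]_k -> M}.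
Context {E : hilbertModType A} {F : hilbertModType M}.
Context {iota : ('rV[R]_n -> A) -> E} {jota : ('rV[R]_n -> M) -> F}.
Variables (Mk : is_matrix_algebra phi).
Variables (cE : is_L2_completion iota) (cF : is_L2_completion jota).
Variable o : 'I_k.
Implicit Types (u : 'rV[R]_n -> M) (v : 'rV[R]_n -> A) (i j l a b p : 'I_k).
Implicit Types (S : adjop E) (T : adjop F).

Local Notation ent := (entry Mk).
Local Notation emb := (embed phi).
Local Notation coord := (coord Mk cE cF).
Local Notation inject := (inject Mk cE cF).

Lemma adjop_sumE {B : cstarAlgType R} {G : hilbertModType B} (I : Type)
    (r : seq I) (H : I -> adjop G) f :
  (\sum_(t <- r) H t) f = \sum_(t <- r) H t f.
Proof. exact: (big_morph (fun T : adjop G => T f)). Qed.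

Lemma bounded_linear_bound {V W : normedModType R[i]} (G : V -> W) :
  bounded_linear G -> exists C : R, forall f, `|G f| <= C%:C * `|f|.
Proof.
move=> [_ _ [C C0 GC]]; exists C => f.
by rewrite !nrE -rmorphM lecR.
Qed.

Lemma nr_adjop_le {B : cstarAlgType R} {G : hilbertModType B} (T : adjop G) (C : R) :
  0 <= C -> (forall f, nr (T f) <= C * nr f) -> nr T <= C.
Proof.
move=> C0 TC; rewrite nr_opnorm; apply: opnorm_le => // f.
by rewrite !nrE -rmorphM lecR.
Qed.

Lemma nr_adjopP {B : cstarAlgType R} {G : hilbertModType B} (T : adjop G) f :
  nr (T f) <= nr T * nr f.
Proof. by have := opnormP T f; rewrite !nrE -rmorphM lecR nr_opnorm. Qed.

(** Up to a diagonal entry [coord i j] is the adjoint of [inject i j]; this provides the adjoints of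
    compressions. *)
Lemma entry_inner_injectr i j h (g : E) :
  ent j j (hm_inner h (inject i j g)) = hm_inner (coord i j h) g.
Proof.
rewrite (entry_inner Mk cE cF) (bigD1 i)//= big1 ?addr0 => [|l li].
  by rewrite coord_inject !eqxx.
by rewrite coord_inject (negPf li) inner0r.
Qed.

Lemma entry_inner_injectl i j h (g : E) :
  ent j j (hm_inner (inject i j g) h) = hm_inner g (coord i j h).
Proof. by rewrite -hm_innerC entry_star entry_inner_injectr hm_innerC. Qed.

(* An adjointable operator on [F] commutes with the right action of the matrix
   units, hence is the left multiplication by a [k x k] matrix of operators on
   [E]: [compress i l] extracts its [(i, l)]-th entry, from the column [o], and
   [spread i l] is the inclusion as [(i, l)]-th entry. *)
Lemma compress_adjointable i l T :
  adjointable (fun f : E => coord i o (T (inject l o f)) : E).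
Proof.
split.
  apply: bounded_linear_bound; apply: (bounded_linear_comp (coord_blin _ _ _ i o)).
  exact: (bounded_linear_comp (adjop_bounded_linear T) (inject_blin _ _ _ l o)).
have /asboolP[_ [S TS]] := adjopP T.
exists (fun g => coord l o (S (inject i o g))) => f g.
by rewrite -entry_inner_injectr TS entry_inner_injectl.
Qed.

Definition compress i l T : adjop E := AdjOp (asboolT (compress_adjointable i l T)).

Lemma coord_sum_inject i l (G : E -> E) a p f :
  coord p a (\sum_j inject i j (G (coord l j f))) =
  if p == i then G (coord l a f) else 0.
Proof.
rewrite (blin_sum (coord_blin _ _ _ p a)) (bigD1 a)//= big1 ?addr0 => [|j ja].
  by rewrite coord_inject eqxx andbT.
by rewrite coord_inject [a == j]eq_sym (negPf ja) andbF.
Qed.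

Lemma spread_adjointable i l S :
  adjointable (fun f : F => \sum_j inject i j (S (coord l j f)) : F).
Proof.
split.
  apply/bounded_linear_bound/bounded_linear_sum => j.
  apply: (bounded_linear_comp (inject_blin _ _ _ i j)).
  exact: (bounded_linear_comp (adjop_bounded_linear S) (coord_blin _ _ _ l j)).
have /asboolP[_ [S' SS']] := adjopP S.
(* The adjoint of S at the transposed position. *)
exists (fun g => \sum_j inject l j (S' (coord i j g))) => f g.
apply: (entry_inj (Mk := Mk)) => a b; rewrite !(entry_inner Mk cE cF).
rewrite (bigD1 i)//= [X in _ + X]big1 => [|p pi]; last first.
  by rewrite coord_sum_inject (negPf pi) inner0l.
rewrite [RHS](bigD1 l)//= [X in _ = _ + X]big1 => [|p pl]; last first.
  by rewrite coord_sum_inject (negPf pl) inner0r.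
by rewrite !coord_sum_inject !eqxx SS'.
Qed.

Definition spread i l S : adjop F := AdjOp (asboolT (spread_adjointable i l S)).

(** Boundedness for the operator norms is what lets smoothness of the Heisenberg conjugates pass to
    the entries. *)
Lemma compress_blin i l : bounded_linear (compress i l).
Proof.
have hc := coord_blin Mk cE cF i o; have hi := inject_blin Mk cE cF l o.
split=> [T T'|c T|].
- by apply: adjop_ext => f; exact: (blinD hc).
- by apply: adjop_ext => f; exact: (blinZ hc).
have [_ _ [C C0 cC]] := hc; have [_ _ [D D0 iD]] := hi.
exists (C * D) => [|T]; first exact: mulr_ge0.
apply: nr_adjop_le => [|f]; first by rewrite !mulr_ge0 ?nr_ge0.
apply: (le_trans (cC _)); rewrite -!mulrA ler_wpM2l//.
apply: (le_trans (nr_adjopP _ _)); rewrite mulrCA ler_wpM2l ?nr_ge0//.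
Qed.

Lemma spread_blin i l : bounded_linear (spread i l).
Proof.
split=> [S S'|c S|].
- apply: adjop_ext => f; rewrite -[RHS]/(\sum_j inject i j (S (coord l j f)) +
    \sum_j inject i j (S' (coord l j f))) -big_split; apply: eq_bigr => j _.
  exact: (blinD (inject_blin _ _ _ i j)).
- apply: adjop_ext => f.
  rewrite -[RHS]/(c *: \sum_j inject i j (S (coord l j f))) scaler_sumr.
  apply: eq_bigr => j _.
  exact: (blinZ (inject_blin _ _ _ i j)).
have ex j : exists C : R, 0 <= C /\ forall S f,
    nr (inject i j (S (coord l j f))) <= C * nr S * nr f.
  have [_ _ [C C0 cC]] := coord_blin Mk cE cF l j.
  have [_ _ [D D0 iD]] := inject_blin Mk cE cF i j.
  exists (D * C); split=> [|S f]; first exact: mulr_ge0.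
  apply: (le_trans (iD _)); rewrite -!mulrA ler_wpM2l//.
  by apply: (le_trans (nr_adjopP _ _)); rewrite mulrCA ler_wpM2l ?nr_ge0.
exists (\sum_j projT1 (cid (ex j))) => [|S].
  by apply: sumr_ge0 => j _; case: cid => C [].
apply: nr_adjop_le => [|f].
  by rewrite mulr_ge0 ?nr_ge0// sumr_ge0// => j _; case: cid => C [].
rewrite !mulr_suml; apply: (le_trans (ler_nr_sum _ _ _)).
by apply: ler_sum => j _; case: cid => C [? H] /=; exact: H.
Qed.

Lemma coord_spread i l S p a f :
  coord p a (spread i l S f) = if p == i then S (coord l a f) else 0.
Proof. exact: coord_sum_inject. Qed.

Lemma coord_sum_spread (S : 'I_k -> 'I_k -> adjop E) p a f :
  coord p a ((\sum_i \sum_l spread i l (S i l)) f) =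
  \sum_l S p l (coord l a f).
Proof.
rewrite adjop_sumE (blin_sum (coord_blin _ _ _ p a)) (bigD1 p)//= [X in _ + X]big1 => [|i ip].
  rewrite addr0 adjop_sumE (blin_sum (coord_blin _ _ _ p a)).
  by apply: eq_bigr => l _; rewrite coord_spread eqxx.
rewrite adjop_sumE (blin_sum (coord_blin _ _ _ p a)) big1// => l _.
by rewrite coord_spread eq_sym (negPf ip).
Qed.

Lemma compress_sum_spread (S : 'I_k -> 'I_k -> adjop E) i l :
  compress i l (\sum_p \sum_q spread p q (S p q)) = S i l.
Proof.
apply: adjop_ext => f; rewrite [LHS]coord_sum_spread (bigD1 l)//= big1 ?addr0.
  by rewrite coord_inject !eqxx.
move=> q ql; rewrite coord_inject (negPf ql) /=.
exact: (blin0 (adjop_bounded_linear _)).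
Qed.

(** T commutes with the matrix unit that moves column a to column o, so its action on column a is
    determined by the compressions, which see column o only. *)
Lemma sum_spread_compress T : \sum_i \sum_l spread i l (compress i l T) = T.
Proof.
apply: adjop_ext => f; apply: (coord_ext (Mk := Mk) (cE := cE) (cF := cF)) => p a.
rewrite coord_sum_spread /= -(blin_sum (coord_blin _ _ _ p o)).
rewrite -(blin_sum (adjop_bounded_linear T)) sum_inject_coord adjointable_act.
rewrite -(sum_inject_coord Mk cE cF) (blin_sum (coord_blin _ _ _ p o)).
rewrite (bigD1 p)//= big1 ?addr0 => [|l lp]; first by rewrite coord_inject !eqxx.
by rewrite coord_inject eq_sym (negPf lp).
Qed.

(* No information on the existence of the extensions is needed: they exist on
   both sides or on none, and are then both the dummy 0. *)
Section Intertwining.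
Variables (LA : ('rV[R]_n -> A) -> 'rV[R]_n -> A).
Variables (LM : ('rV[R]_n -> M) -> 'rV[R]_n -> M).
Hypothesis ent_LM : forall i j u x, ent i j (LM u x) = LA (fun y => ent i j (u y)) x.
Hypothesis emb_LM : forall i j v x, LM (fun y => emb i j (v y)) x = emb i j (LA v x).

Lemma extension_coord_inject i j :
  (forall f, coord i j (extension jota LM f) = extension iota LA (coord i j f)) /\
  (forall f, extension jota LM (inject i j f) = inject i j (extension iota LA f)).
Proof.
have sent a b u : schwartz u -> schwartz (fun x => ent a b (u x)).
  exact: (schwartz_blin (entry_bounded_linear Mk a b)).
have semb a b v : schwartz v -> schwartz (fun x => emb a b (v x)).
  exact: (schwartz_blin (embed_bounded_linear Mk a b)).
have [[X XL]|noX] := pselect (exists X : adjop E, forall v, schwartz v ->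
    schwartz (LA v) /\ X (iota v) = iota (LA v)).
  (* The diagonal matrix with X in every diagonal place. *)
  pose Y := \sum_a \sum_b spread a b (if a == b then X else 0).
  have cY p a f : coord p a (Y f) = X (coord p a f).
    rewrite coord_sum_spread (bigD1 p)//= eqxx big1 ?addr0// => l lp.
    by rewrite eq_sym (negPf lp).
  have YL u : schwartz u -> schwartz (LM u) /\ Y (jota u) = jota (LM u).
    move=> su; have sLM : schwartz (LM u).
      have -> : LM u = fun x => \sum_a \sum_b emb a b (LA (fun y => ent a b (u y)) x).
        apply/funext => x; rewrite {1}(sum_embed Mk (LM u x)).
        by apply: eq_bigr => a _; apply: eq_bigr => b _; rewrite ent_LM.
      apply: schwartz_sum => a; apply: schwartz_sum => b; apply: semb.
      exact: (XL _ (sent a b u su)).1.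
    split=> //; apply: (coord_ext (Mk := Mk) (cE := cE) (cF := cF)) => p a.
    rewrite cY !coord_jota// (XL _ (sent p a u su)).2.
    by congr iota; apply/funext => x; rewrite ent_LM.
  rewrite (extensionP cE XL) (extensionP cF YL); split=> f; first exact: cY.
  apply: (coord_ext (Mk := Mk) (cE := cE) (cF := cF)) => p a.
  rewrite cY !coord_inject; case: ifP => // _.
  exact: (blin0 (adjop_bounded_linear X)).
rewrite (extension_dummy noX).
rewrite extension_dummy; last first.
  case=> Y YL; apply: noX; exists (compress o o Y) => v sv.
  have [sLM YLM] := YL _ (semb o o v sv).
  have LAE : (fun x => ent o o (LM (fun y => emb o o (v y)) x)) = LA v.
    by apply/funext => x; rewrite emb_LM entry_embed !eqxx.
  split; first by rewrite -LAE; exact: sent.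
  by rewrite /= inject_iota// YLM coord_jota// LAE.
by split=> f; [exact: (blin0 (coord_blin _ _ _ i j)) |
  exact/esym/(blin0 (inject_blin _ _ _ i j))].
Qed.

End Intertwining.

Lemma translate_coord_inject z i j :
  (forall f, coord i j (extension jota (translate z) f) =
             extension iota (translate z) (coord i j f)) /\
  (forall f, extension jota (translate z) (inject i j f) =
             inject i j (extension iota (translate z) f)).
Proof. exact: extension_coord_inject. Qed.

Lemma modulate_coord_inject z i j :
  (forall f, coord i j (extension jota (modulate z) f) =
             extension iota (modulate z) (coord i j f)) /\
  (forall f, extension jota (modulate z) (inject i j f) =
             inject i j (extension iota (modulate z) f)).
Proof.
apply: extension_coord_inject => a b u x; first exact: entryZ.
by rewrite /modulate (embedZ Mk).
Qed.

Lemma heisenberg_compress T w i l :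
  heisenberg_conj iota (compress i l T) w = compress i l (heisenberg_conj jota T w).
Proof.
apply: adjop_ext => f; rewrite /heisenberg_conj /=.
rewrite (translate_coord_inject _ i o).1 (modulate_coord_inject _ i o).1.
by rewrite (translate_coord_inject _ l o).2 (modulate_coord_inject _ l o).2.
Qed.

Lemma heisenberg_spread S w i l :
  heisenberg_conj jota (spread i l S) w = spread i l (heisenberg_conj iota S w).
Proof.
apply: adjop_ext => f; apply: (coord_ext (Mk := Mk) (cE := cE) (cF := cF)) => p a.
rewrite coord_spread /heisenberg_conj /=.
rewrite (translate_coord_inject _ p a).1 (modulate_coord_inject _ p a).1.
rewrite coord_sum_inject (modulate_coord_inject _ l a).1 (translate_coord_inject _ l a).1.
case: ifP => // _.
by rewrite !(blin0 (adjop_bounded_linear _)).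
Qed.

Lemma heisenberg_sum {B : cstarAlgType R} {G : hilbertModType B}
    (eta : ('rV[R]_n -> B) -> G) (I : Type) (r : seq I) (H : I -> adjop G) w :
  heisenberg_conj eta (\sum_(t <- r) H t) w = \sum_(t <- r) heisenberg_conj eta (H t) w.
Proof.
apply: (big_morph (fun T : adjop G => heisenberg_conj eta T w)) => [T T'|];
  apply: adjop_ext => f; rewrite /heisenberg_conj /=.
  by rewrite !(blinD (adjop_bounded_linear _)).
by rewrite !(blin0 (adjop_bounded_linear _)).
Qed.

Hypothesis bijA : set_bij (smooth_bounded : set ('rV[R]_(n + n) -> A))
  (heisenberg_smooth iota) (symbol_op iota).

(* If [psido b] had no extension, [symbol_op b] would be the dummy 0, which is
   also the operator of the symbol 0. *)
Lemma psido_extends (b : 'rV[R]_(n + n) -> A) v :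
  smooth_bounded b -> schwartz v ->
  schwartz (psido b v) /\ symbol_op iota b (iota v) = iota (psido b v).
Proof.
move=> sb; have [_ injA _] := bijA.
have op0 v' : schwartz v' -> schwartz (psido (fun=> 0) v' : _ -> A) /\
    (0 : adjop E) (iota v') = iota (psido (fun=> 0) v').
  by rewrite psido0 (iota0 cE); split=> //; exact: schwartz0.
have [[T bT]|noT] := pselect (exists T : adjop E, forall v, schwartz v ->
    schwartz (psido b v) /\ T (iota v) = iota (psido b v)).
  by rewrite /symbol_op (extensionP cE bT); exact: bT.
have b0 : b = fun=> 0.
  apply: injA; rewrite ?inE//; first exact: smooth_bounded0.
  by rewrite /symbol_op (extension_dummy noT) (extensionP cE op0).
by case: noT; exists 0; rewrite b0.
Qed.

(** The right-hand side is itself shown to extend [psido b], so existence over M comes from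
    existence over A entry by entry. *)
Lemma symbol_op_matrix (b : 'rV[R]_(n + n) -> M) : smooth_bounded b ->
  symbol_op jota b =
  \sum_i \sum_l spread i l (symbol_op iota (fun w => ent i l (b w))).
Proof.
move=> sb.
have sbe i l : smooth_bounded (fun w => ent i l (b w)).
  exact: (smooth_bounded_blin (entry_bounded_linear Mk i l)).
apply: (extensionP cF) => u su.
have su' i l : schwartz (fun y => ent i l (u y)).
  exact: (schwartz_blin (entry_bounded_linear Mk i l)).
have sp : schwartz (psido b u).
  have -> : psido b u = fun x => \sum_i \sum_j emb i j (\sum_l
      psido (fun w => ent i l (b w)) (fun y => ent l j (u y)) x).
    apply/funext => x; rewrite {1}(sum_embed Mk (psido b u x)).
    by apply: eq_bigr => i _; apply: eq_bigr => j _; rewrite psido_entry.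
  apply: schwartz_sum => i; apply: schwartz_sum => j.
  apply: (schwartz_blin (embed_bounded_linear Mk i j)).
  by apply: schwartz_sum => l; case: (psido_extends (sbe i l) (su' l j)).
split=> //; apply: (coord_ext (Mk := Mk) (cE := cE) (cF := cF)) => p a.
rewrite coord_sum_spread coord_jota//.
rewrite (eq_bigr (fun l => iota
  (psido (fun w => ent p l (b w)) (fun y => ent l a (u y))))); last first.
  by move=> l _; rewrite coord_jota// (psido_extends (sbe p l) (su' l a)).2.
rewrite -(iota_sum cE) => [|l]; last by case: (psido_extends (sbe p l) (su' l a)).
by congr iota; apply/funext => x; rewrite psido_entry.
Qed.

(** * Transfer of bijectivity *)

Lemma symbol_op_matrix_bij : set_bij (smooth_bounded : set ('rV[R]_(n + n) -> M))
  (heisenberg_smooth jota) (symbol_op jota).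
Proof.
have [funA injA surjA] := bijA.
have sbe (b : 'rV[R]_(n + n) -> M) i l :
    smooth_bounded b -> smooth_bounded (fun w => ent i l (b w)).
  exact: (smooth_bounded_blin (entry_bounded_linear Mk i l)).
split.
- move=> b sb; rewrite /heisenberg_smooth /= (symbol_op_matrix sb).
  have -> : heisenberg_conj jota
      (\sum_i \sum_l spread i l (symbol_op iota (fun w => ent i l (b w)))) =
      fun w => \sum_i \sum_l spread i l
        (heisenberg_conj iota (symbol_op iota (fun w => ent i l (b w))) w).
    apply/funext => w; rewrite heisenberg_sum; apply: eq_bigr => i _.
    rewrite heisenberg_sum; apply: eq_bigr => l _; exact: heisenberg_spread.
  apply: (smooth_sum _ _).1 => i; apply: (smooth_sum _ _).1 => l.
  exact: (smooth_blin (spread_blin i l) (funA _ (sbe b i l sb))).1.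
- move=> b b' /set_mem sb /set_mem sb' bb'; apply/funext => w.
  apply: (entry_inj (Mk := Mk)) => i l.
  apply: (congr1 (fun c => c w) (x := fun w => ent i l (b w))
    (y := fun w => ent i l (b' w))).
  apply: injA; [exact/mem_set/sbe | exact/mem_set/sbe |].
  (* Compression reads the operators of the entries of the symbols off the operators over M. *)
  move: bb' => /(congr1 (compress i l)).
  by rewrite (symbol_op_matrix sb) (symbol_op_matrix sb') !compress_sum_spread.
move=> T sT.
(* Compressions of a Heisenberg smooth operator are Heisenberg smooth, hence have symbols, which
   become the entries of the symbol of T. *)
have ex i l : exists b : 'rV[R]_(n + n) -> A,
    smooth_bounded b /\ symbol_op iota b = compress i l T.
  have sTil : heisenberg_smooth iota (compress i l T).
    rewrite /heisenberg_smooth /=.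
    have -> : heisenberg_conj iota (compress i l T) =
        fun w => compress i l (heisenberg_conj jota T w).
      by apply/funext => w; exact: heisenberg_compress.
    exact: (smooth_blin (compress_blin i l) sT).1.
  by have [b sb bT] := surjA _ sTil; exists b.
pose c i l := projT1 (cid (ex i l)).
have [sc cT] : (forall i l, smooth_bounded (c i l)) /\
    forall i l, symbol_op iota (c i l) = compress i l T.
  by split=> i l; rewrite /c; case: cid => b [].
pose b w := \sum_i \sum_l emb i l (c i l w).
have bE i l : (fun w => ent i l (b w)) = c i l.
  apply/funext => w; rewrite entry_sum (bigD1 i)//= entry_sum (bigD1 l)//=.
  rewrite !big1 ?addr0 ?entry_embed ?eqxx// => [p pi|q ql].
    by rewrite entry_sum big1// => q _; rewrite entry_embed eq_sym (negPf pi).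
  by rewrite entry_embed [l == q]eq_sym (negPf ql) andbF.
have sb : smooth_bounded b.
  apply: smooth_bounded_sum => i; apply: smooth_bounded_sum => l.
  exact: (smooth_bounded_blin (embed_bounded_linear Mk i l)).
exists b => //; rewrite (symbol_op_matrix sb) -[RHS]sum_spread_compress.
by apply: eq_bigr => i _; apply: eq_bigr => l _; rewrite bE cT.
Qed.

End AdjointableMatrices.

Theorem theorem3 (R : realType) (n k : nat) (n_ge1 : (1 <= n)%N)
    (k_ge1 : (1 <= k)%N) (A : cstarAlgType R) (sepA : separable A)
    (E : hilbertModType A) (iota : ('rV[R]_n -> A) -> E)
    (E_completion : is_L2_completion iota)
    (MkA : cstarAlgType R) (phi : 'M[A]_k -> MkA)
    (MkA_matrices : is_matrix_algebra phi)
    (F : hilbertModType MkA) (jota : ('rV[R]_n -> MkA) -> F)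
    (F_completion : is_L2_completion jota) :
  set_bij (smooth_bounded : set ('rV[R]_(n + n) -> A))
    (heisenberg_smooth iota) (symbol_op iota) ->
  set_bij (smooth_bounded : set ('rV[R]_(n + n) -> MkA))
    (heisenberg_smooth jota) (symbol_op jota).
Proof.
(* The column from which the operators on [F] are read off. *)
have o : 'I_k := Ordinal k_ge1.
exact: (symbol_op_matrix_bij MkA_matrices E_completion F_completion o).
Qed.
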